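(* Let $D$ be a division ring with center $F$, where $F$ contains at least four elements, let $n$ be a positive integer, let $G$ be a non-central subnormal subgroup of $\mathrm{GL}_n(D)$, and let $\star$ be an involution of the first kind on $A:=\mathrm{M}_n(D)$. Then the following conditions are all equivalent: (C1) $x^\star x=xx^\star$ for all $x\in A$; (C2) for each $x\in A$ there exists a positive integer $N$ depending on $x$ such that $\mathrm{d}_x^N(x^\star)=0$; (C3) for each $x\in A$ there exists a positive integer $N$ depending on $x$ such that $x^\star x^N=x^Nx^\star$; (C4) $x+x^\star$ is central for all $x\in A$; (C5) $xx^\star$ is central for all $x\in A$; (1) $x+x^\star$ is central for all $x\in G$; (2) $xx^\star$ is central for all $x\in G$. Moreover, if one of these assertions holds, then either (i) $n=1$ and $D$ is a quaternion division algebra over $F$, or (ii) $n=2$, $D=F$ and $\star$ is the ordinary symplectic involution on $\mathrm{M}_2(F)$.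
   Context: Rings are associative with identity $1\neq 0$. An involution on a ring $A$ is a map $\star:A\to A$ with $(x+y)^\star=x^\star+y^\star$, $(xy)^\star=y^\star x^\star$ and $(x^\star)^\star=x$ for all $x,y\in A$. It is of the first kind if $z^\star=z$ for every $z$ in the center $Z(A)$. An element or subset of $A$ is central if it lies in $Z(A)$. For $x\in A$, $\mathrm{d}_x:A\to A$ is the map $y\mapsto yx-xy$, and $\mathrm{d}_x^N$ is its $N$-th power under composition. $\mathrm{GL}_n(D)$ is the multiplicative group of $\mathrm{M}_n(D)$. A quaternion division algebra over $F$ is a division ring with center $F$ and of dimension $4$ over $F$. The ordinary symplectic involution on $\mathrm{M}_2(F)$ is $\begin{pmatrix} a & b\\ c& d\end{pmatrix}^\star=\begin{pmatrix} d & -b\\ -c& a\end{pmatrix}$. *)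

(* Defs.v *)
From mathcomp Require Import all_boot all_algebra.

Set Implicit Arguments.
Unset Strict Implicit.
Unset Printing Implicit Defensive.

Import GRing.Theory.
Local Open Scope ring_scope.

(* The definitions below are stated over [pzRingType] (rings in which 1 = 0 is
   allowed) because this is the structure that 'M[D]_n carries for a variable
   size n. *)
Section Rings.
Variable R : pzRingType.
Implicit Types (x y z : R) (star : R -> R) (G H K : R -> Prop).

Definition is_central x : Prop := forall y, GRing.comm x y.

Definition central_subset G : Prop := forall x, G x -> is_central x.

Definition is_involution star : Prop :=
  [/\ {morph star : x y / x + y},
      {morph star : x y / x * y >-> y * x}
    & involutive star].

Definition involution_first_kind star : Prop :=
  is_involution star /\ forall z, is_central z -> star z = z.

Definition inner_der x y : R := y * x - x * y.

Definition mutual_inverses x y : Prop := x * y = 1 /\ y * x = 1.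

Definition unit_group x : Prop := exists y, mutual_inverses x y.

(* The last clause forces every element of H to be a unit. *)
Definition is_unit_subgroup H : Prop :=
  [/\ H 1,
      forall x y, H x -> H y -> H (x * y)
    & forall x, H x -> exists2 y, H y & mutual_inverses x y].

Definition is_normal_in H K : Prop :=
  (forall x, H x -> K x) /\
  (forall h k k', H h -> K k -> mutual_inverses k k' -> H (k * h * k')).

(* H is reached from the group of units by finitely many steps, each passing
   to a normal subgroup of the previous group. *)
Inductive subnormal_in_units : (R -> Prop) -> Prop :=
| Subnormal_units : subnormal_in_units unit_group
| Subnormal_step H K :
    subnormal_in_units K -> is_unit_subgroup H -> is_normal_in H K ->
    subnormal_in_units H.

Definition star_commuting star : Prop :=
  forall x, star x * x = x * star x.

Definition star_engel star : Prop :=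
  forall x, exists2 N, (0 < N)%N & iter N (inner_der x) (star x) = 0.

Definition star_power_commuting star : Prop :=
  forall x, exists2 N, (0 < N)%N & star x * x ^+ N = x ^+ N * star x.

Definition central_traces star : Prop :=
  forall x, is_central (x + star x).

Definition central_norms star : Prop :=
  forall x, is_central (x * star x).

Definition central_traces_on G star : Prop :=
  forall x, G x -> is_central (x + star x).

Definition central_norms_on G star : Prop :=
  forall x, G x -> is_central (x * star x).

End Rings.

(* D is a division ring whose center is F, embedded by a |-> a%:A; the
   inclusion of F in the center is part of the algebra structure. *)
Definition division_ring_with_center (F : fieldType) (D : unitAlgType F) :=
  GRing.field_axiom D /\ forall z : D, is_central z -> exists a : F, z = a%:A.

Definition quaternion_division_algebra (F : fieldType) (D : unitAlgType F) :=
  division_ring_with_center D /\ inhabited (Vector.axiom 4 D).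

(* 'M_2 is read as 'M_(1 + 1), and the four blocks of A are its entries. *)
Definition symplectic2 (R : nzRingType) (A : 'M[R]_(1 + 1)) : 'M[R]_(1 + 1) :=
  block_mx (drsubmx A) (- ursubmx A)
           (- dlsubmx A) (ulsubmx A).

(* Main.v *)
From HB Require Import structures.
From mathcomp Require Import all_boot all_algebra all_field cyclic.
From mathcomp Require Import boolp zify ring.
From Stdlib Require Ncring Ncring_tac.
Require Import Defs.

Set Implicit Arguments.
Unset Strict Implicit.
Unset Printing Implicit Defensive.

Import GRing.Theory.
Local Open Scope ring_scope.

(** Write [tr x = x + x*]. All the conditions are compared with
    the centrality of the traces. Central traces and central norms are equivalent
    by short computations ([central_norms_of_traces], [central_traces_of_norms])
    and imply the pointwise conditions because then [x* = tr x - x].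

    In degree [n > 1] each condition implies that every idempotent [e] commutes
    with [e*]: an idempotent satisfies [(ad e)^3 = ad e] and [e^N = e], and
    [1 + z e] is a unit for enough central [z]. This applies to [E_ii] and to
    [E_ii + d E_ij]. A nontrivial symmetric idempotent cannot exist, so
    [E_ii* = 1 - E_ii] and [n = 2]; then [(d E_ij)* = - d E_ij], so that [D] is
    commutative and [star] is symplectic, with scalar traces ([star_diag],
    [star_offdiag], [traces_two]).

    In degree 1, if [x] and [x*] always commute, then linearization yields
    [[tr x, y] [x*, z] = 0] and hence central traces ([traces_of_commuting]); an
    element [x] with [x <> x*] then generates a quadratic extension of the center
    that is its own centralizer, and [D] is spanned by [1], [x], [y0], [x y0]
    ([quaternion_span]). For the Engel condition, let [T = tr y]. If the kernel of
    [ad T] is its generalized 0-eigenspace, then the Engel conditions at the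
    conjugates of [T] say that [h^-1 [T, h]] commutes with [T] for all norms [h];
    inserting [g + f] for four central [f], one gets that [T] commutes with all
    traces, and with [y] ([sym_reduced_comm_trace], [reduced_trace_comm]). The
    other case is excluded outside characteristic 2 ([sym_ad_reduced]); in
    characteristic 2 the Engel conditions along an infinite family of elements
    are the values of one polynomial ([char2_translate]) and lead to the same
    conclusion ([char2_trace_comm]). For the condition on powers, a power of
    every translate [x + c] by a central [c] lies in the field of the elements of
    [F(x)] that commute with [x*]. If [x] is not in it, then the quotients of the
    translates of [x] and of a conjugate of [x] are roots of unity. This is absurd
    in characteristic 0 ([radical_char0]); in characteristic [p] either a power of
    [x] with exponent [p^e] commutes with [x*], which gives back the Engel
    condition, or [x] and [F] are algebraic over the prime field ([radical_pchar]).
    In the latter situation the argument for the Engel condition works at the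
    elements that are not algebraic over the prime field, of which the centralizer
    of a noncentral algebraic element has enough ([nontor_commuting]).

    For the conditions on [G], let [G] be normal in [K] and [h] in [K]. Central
    norms on [G] imply that [h* h] commutes with [G] up to central factors;
    central traces on [G] imply that [h* h] moves the elements of [G] by central
    elements, and then that it commutes with them. Thus everything follows, by
    ascent to the whole group of units ([ascend_norms], [ascend_traces]), once an
    element that commutes with a noncentral subnormal subgroup up to central
    factors is known to be central.

    For [n > 1] this holds because such a subgroup contains all transvections
    ([subnormal_transvections]). For [n = 1] it is reduced to the theorem that the
    centralizer of a noncentral subnormal subgroup [H] of a division ring is the
    center ([subn_centralizer]). If it is false, then some [H] and its centralizer
    are both noncommutative, as abelian subnormal subgroups are central
    ([abelian_subn_central]). But the iterated commutators of an element [p] of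
    [H] with arbitrary units lie in [H]; taking these units in families depending
    on a parameter shows that the conjugation by [p] is unipotent on the double
    centralizer of [H], and that the centralizer of [H] is radical of bounded
    exponent over its center, hence commutative ([subnormal_centralizer_comm]). *)

(** * Identities in noncommutative rings *)

#[local] Instance ncr_ops (R : pzRingType) :
  @Ncring.Ring_ops R 0 1 (@GRing.add R) (@GRing.mul R)
    (fun x y => x - y) (@GRing.opp R) (@eq R) := {}.

#[local] Instance ncr_ring (R : pzRingType) : Ncring.Ring (Ro := ncr_ops R).
Proof.
split.
- exact: RelationClasses.eq_equivalence.
- by move=> x y -> u v ->.
- by move=> x y -> u v ->.
- by move=> x y -> u v ->.
- by move=> x y ->.
- exact: (@add0r R).
- exact: (@addrC R).
- exact: (@addrA R).
- exact: (@mul1r R).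
- exact: (@mulr1 R).
- exact: (@mulrA R).
- exact: (@mulrDl R).
- by move=> x y z; exact: (@mulrDr R).
- by [].
- exact: (@subrr R).
Qed.

(* doublings and squares are expanded because the reification does not know them *)
Ltac ncr := rewrite ?mulr2n ?expr2; Ncring_tac.non_commutative_ring.

(** * Division rings *)

Definition cj (D : unitRingType) (a y : D) : D := a * y * a^-1.

Definition centr (R : pzRingType) (S : R -> Prop) : R -> Prop :=
  fun y => forall x, S x -> GRing.comm x y.

(** Division subrings are predicates, and not types, because the centralizers
    and double centralizers of subsets that vary during the proofs are used. *)
Record div_closed (D : unitRingType) (E : D -> Prop) : Prop := DivClosed {
  dc1 : E 1;
  dcB : forall x y, E x -> E y -> E (x - y);
  dcM : forall x y, E x -> E y -> E (x * y);
  dcV : forall x, E x -> E x^-1 }.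

Section DivClosed.
Variables (D : unitRingType) (E : D -> Prop) (dE : div_closed E).

Lemma dc0 : E 0.
Proof. by rewrite -(subrr 1); apply: (dcB dE); apply: dc1. Qed.
Lemma dcN x : E x -> E (- x).
Proof. by move=> Ex; rewrite -sub0r; apply: (dcB dE) => //; apply: dc0. Qed.
Lemma dcD x y : E x -> E y -> E (x + y).
Proof. by move=> Ex Ey; rewrite -[y]opprK; apply: (dcB dE) => //; apply: dcN. Qed.
Lemma dcX x n : E x -> E (x ^+ n).
Proof.
move=> Ex; elim: n => [|n IHn]; first exact: dc1.
by rewrite exprS; apply: (dcM dE).
Qed.
Lemma dc_nat n : E n%:R.
Proof.
elim: n => [|n IHn]; first exact: dc0.
by rewrite -natr1; apply: dcD => //; apply: dc1.
Qed.
Lemma dc_cj x y : E x -> E y -> E (cj x y).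
Proof. by move=> Ex Ey; apply: (dcM dE); [apply: (dcM dE) | apply: (dcV dE)]. Qed.
Lemma dc_sum (I : Type) (r : seq I) (P : pred I) (F : I -> D) :
  (forall i, P i -> E (F i)) -> E (\sum_(i <- r | P i) F i).
Proof. by move=> EF; apply: big_ind => //; [apply: dc0 | apply: dcD]. Qed.
End DivClosed.

Lemma centr_div_closed (D : unitRingType) (S : D -> Prop) :
  div_closed (centr S).
Proof.
split=> [x _|x y cx cy z Sz|x y cx cy z Sz|x cx z Sz].
- exact: commr1.
- by apply: commrB; [exact: cx Sz | exact: cy Sz].
- by apply: commrM; [exact: cx Sz | exact: cy Sz].
- by apply: commrV; exact: cx Sz.
Qed.

Lemma centr_sub (R : pzRingType) (S T : R -> Prop) :
  (forall x, S x -> T x) -> forall x, centr T x -> centr S x.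
Proof. by move=> sST x cx y /sST; exact: cx. Qed.

Lemma sub_centr2 (R : pzRingType) (S : R -> Prop) x :
  S x -> centr (centr S) x.
Proof. by move=> Sx y cy; apply: commr_sym; exact: cy Sx. Qed.

Section Basics.
Variables (D : unitRingType) (divD : GRing.field_axiom D).
Implicit Types a b x y z : D.

Lemma nzU x : x != 0 -> x \is a GRing.unit. Proof. exact: divD. Qed.
Lemma mulVD x : x != 0 -> x^-1 * x = 1. Proof. by move/nzU/mulVr. Qed.
Lemma mulDV x : x != 0 -> x * x^-1 = 1. Proof. by move/nzU/mulrV. Qed.
Lemma mulKD x y : x != 0 -> x^-1 * (x * y) = y.
Proof. by move=> x0; rewrite mulrA mulVD ?mul1r. Qed.
Lemma mulVKD x y : x != 0 -> x * (x^-1 * y) = y.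
Proof. by move=> x0; rewrite mulrA mulDV ?mul1r. Qed.
Lemma mulDK x y : x != 0 -> y * x * x^-1 = y.
Proof. by move=> x0; rewrite -mulrA mulDV ?mulr1. Qed.
Lemma mulDVK x y : x != 0 -> y * x^-1 * x = y.
Proof. by move=> x0; rewrite -mulrA mulVD ?mulr1. Qed.
Lemma invD_eq0 x : (x^-1 == 0) = (x == 0).
Proof.
apply/eqP/eqP=> h; last by rewrite h invr0.
by rewrite -[x]invrK h invr0.
Qed.
Lemma mulD_eq0 x y : (x * y == 0) = (x == 0) || (y == 0).
Proof.
apply/eqP/orP=> [xy0|[/eqP->|/eqP->]]; rewrite ?mul0r ?mulr0 //.
have [x0|x0] := eqVneq x 0; [by left | right].
by apply/eqP; rewrite -(mulKD y x0) xy0 mulr0.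
Qed.
Lemma mulD_neq0 x y : x != 0 -> y != 0 -> x * y != 0.
Proof. by move=> x0 y0; rewrite mulD_eq0 negb_or x0. Qed.
Lemma expD_eq0 x n : x ^+ n = 0 -> x = 0.
Proof.
elim: n => [/eqP|n IHn /eqP]; first by rewrite oner_eq0.
by rewrite exprS mulD_eq0 => /orP[/eqP//|/eqP/IHn].
Qed.
Lemma expD_neq0 x n : x != 0 -> x ^+ n != 0.
Proof. by move=> x0; apply: contraNneq x0 => /expD_eq0->. Qed.
Lemma mulDI x y z : x != 0 -> x * y = x * z -> y = z.
Proof. by move=> x0 h; rewrite -(mulKD y x0) h mulKD. Qed.
Lemma mulID x y z : x != 0 -> y * x = z * x -> y = z.
Proof. by move=> x0 h; rewrite -(mulDK y x0) h mulDK. Qed.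
Lemma invMD x y : x != 0 -> y != 0 -> (x * y)^-1 = y^-1 * x^-1.
Proof. by move=> x0 y0; rewrite invrM ?nzU. Qed.
Lemma invM1 x y : x != 0 -> x * y = 1 -> y = x^-1.
Proof. by move=> x0 h; rewrite -(mulKD y x0) h mulr1. Qed.
Lemma mul1_neq0 x y : x * y = 1 -> x != 0.
Proof. by move=> h; apply/eqP=> x0; move/eqP: h; rewrite x0 mul0r eq_sym oner_eq0. Qed.
Lemma unit_groupD x : unit_group x <-> x != 0.
Proof.
split=> [[y [xy _]]|x0]; first exact: mul1_neq0 xy.
by exists x^-1; split; [apply: mulDV | apply: mulVD].
Qed.

Lemma natr0_pchar n : (0 < n)%N -> n%:R = 0 :> D -> exists p, p \in [pchar D].
Proof.
elim: n {-2}n (leqnn n) => [[]//|N IHN] n nN n0 hn.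
have [n1|n1] := leqP n 1.
  have n1' : n = 1%N by apply/eqP; rewrite eqn_leq n1.
  by move/eqP: hn; rewrite n1' oner_eq0.
have pp := pdiv_prime n1; move/eqP: hn.
rewrite -(divnK (pdiv_dvd n)) natrM mulD_eq0 => /orP[/eqP h|h].
  apply: (IHN _ _ _ h); last by rewrite divn_gt0 ?pdiv_gt0 // dvdn_leq ?pdiv_dvd.
  rewrite -ltnS; apply: leq_trans nN; apply: ltn_Pdiv => //; exact: prime_gt1.
by exists (pdiv n); rewrite inE pp.
Qed.

Lemma cj_neq0 a x : a != 0 -> x != 0 -> cj a x != 0.
Proof. by move=> a0 x0; rewrite !mulD_neq0 ?invD_eq0. Qed.
Lemma cjM a x y : a != 0 -> cj a (x * y) = cj a x * cj a y.
Proof. by move=> a0; rewrite /cj !mulrA mulDVK. Qed.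
Lemma cjD a x y : cj a (x + y) = cj a x + cj a y.
Proof. by rewrite /cj mulrDr mulrDl. Qed.
Lemma cjN a x : cj a (- x) = - cj a x.
Proof. by rewrite /cj mulrN mulNr. Qed.
Lemma cjB a x y : cj a (x - y) = cj a x - cj a y.
Proof. by rewrite cjD cjN. Qed.
Lemma cj0 a : cj a 0 = 0. Proof. by rewrite /cj mulr0 mul0r. Qed.
Lemma cj1 a : a != 0 -> cj a 1 = 1.
Proof. by move=> a0; rewrite /cj mulr1 mulDV. Qed.
Lemma cjX a x n : a != 0 -> cj a (x ^+ n) = cj a x ^+ n.
Proof.
move=> a0; elim: n => [|n IHn]; first exact: cj1.
by rewrite !exprS cjM // IHn.
Qed.
Lemma cjV a x : a != 0 -> cj a x^-1 = (cj a x)^-1.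
Proof.
move=> a0; have [->|x0] := eqVneq x 0; first by rewrite invr0 cj0 invr0.
by apply: invM1; rewrite ?cj_neq0 // -cjM // mulDV ?cj1.
Qed.
Lemma cj_comm a x : a != 0 -> GRing.comm a x -> cj a x = x.
Proof. by move=> a0 h; rewrite /cj h mulDK. Qed.
Lemma cj_id a x : a != 0 -> cj a x = x -> GRing.comm a x.
Proof. by move=> a0 h; rewrite /GRing.comm -{2}h /cj mulDVK. Qed.
Lemma cjE a x : a != 0 -> cj a x * a = a * x.
Proof. by move=> a0; rewrite /cj mulDVK. Qed.
Lemma cj_cj a b x : a != 0 -> b != 0 -> cj a (cj b x) = cj (a * b) x.
Proof. by move=> a0 b0; rewrite /cj invMD // !mulrA. Qed.
Lemma cjK a x : a != 0 -> cj a^-1 (cj a x) = x.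
Proof. by move=> a0; rewrite /cj invrK !mulrA mulVD // mul1r mulDVK. Qed.
Lemma cjVK a x : a != 0 -> cj a (cj a^-1 x) = x.
Proof. by move=> a0; rewrite -{1}[a]invrK cjK ?invD_eq0. Qed.
Lemma comm_cj a x y : a != 0 -> GRing.comm x y -> GRing.comm (cj a x) (cj a y).
Proof. by move=> a0 h; rewrite /GRing.comm -!cjM // h. Qed.

End Basics.

(** * The field generated by commuting elements *)

Definition bicent (D : unitRingType) (S : D -> Prop) : {pred D} :=
  fun y => `[< centr (centr S) y >].

Lemma bicentP (D : unitRingType) (S : D -> Prop) y :
  reflect (centr (centr S) y) (y \in bicent S).
Proof. exact: asboolP. Qed.

Lemma bicent_divring (D : unitRingType) (S : D -> Prop) :
  divring_closed (bicent S).
Proof.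
have dE := centr_div_closed (centr S).
split=> [|x y /bicentP Ex /bicentP Ey|x y /bicentP Ex /bicentP Ey]; apply/bicentP.
- exact: dc1.
- exact: (dcB dE).
- by apply: (dcM dE) => //; apply: (dcV dE).
Qed.
HB.instance Definition _ (D : unitRingType) (S : D -> Prop) :=
  GRing.isDivringClosed.Build D (bicent S) (bicent_divring S).

Definition commuting (D : unitRingType) (S : D -> Prop) :=
  forall x y, S x -> S y -> GRing.comm x y.

Section BicentField.
Variables (D : unitRingType) (S : D -> Prop).

(** The double centralizer of a set of commuting elements of a division ring,
    as a field; the two hypotheses are parameters of the type so that its
    field structure can be inferred from it. *)
Record bfield (divD : GRing.field_axiom D) (comS : commuting S) :=
  BField { bval :> D; bvalP : bval \in bicent S }.

Variables (divD : GRing.field_axiom D) (comS : commuting S).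
Local Notation K := (bfield divD comS).
HB.instance Definition _ := [isSub for @bval divD comS].
HB.instance Definition _ := [Choice of K by <:].
HB.instance Definition _ := [SubChoice_isSubUnitRing of K by <:].

Lemma bfield_mulC : @commutative K K *%R.
Proof.
move=> [x Ex] [y Ey]; apply: val_inj => /=.
have /bicentP Cx := Ex; have /bicentP Cy := Ey.
by apply: (Cy) => z Sz; apply: (Cx) => t St; apply: comS.
Qed.
HB.instance Definition _ := GRing.PzRing_hasCommutativeMul.Build K bfield_mulC.

Lemma bfield_field : GRing.field_axiom K.
Proof.
move=> x x0; have x0': bval x != 0.
  by apply: contra_neq x0 => h; apply: val_inj.
have /bicentP Cx := bvalP x.
have Ci : (bval x)^-1 \in bicent S.
  by apply/bicentP; apply: (dcV (centr_div_closed _)).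
apply/unitrP; exists (BField divD comS Ci).
by split; apply: val_inj; rewrite /= ?mulVD ?mulDV.
Qed.
HB.instance Definition _ := GRing.ComUnitRing_isField.Build K bfield_field.

Lemma bval_inj : injective (@bval divD comS). Proof. exact: val_inj. Qed.
Lemma bvalB (x y : K) : bval (x - y) = bval x - bval y. Proof. by []. Qed.
Lemma bvalD (x y : K) : bval (x + y) = bval x + bval y. Proof. by []. Qed.
Lemma bval0 : bval (0 : K) = 0. Proof. by []. Qed.
Lemma bval1 : bval (1 : K) = 1. Proof. by []. Qed.
Lemma bvalM (x y : K) : bval (x * y) = bval x * bval y. Proof. by []. Qed.
Lemma bvalX (x : K) n : bval (x ^+ n) = bval x ^+ n.
Proof. by elim: n => [|n IHn] //; rewrite !exprS -IHn. Qed.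
Lemma bval_eq0 (x : K) : (bval x == 0) = (x == 0).
Proof. by rewrite -bval0 (inj_eq bval_inj). Qed.
Lemma bvalV (x : K) : bval x^-1 = (bval x)^-1.
Proof.
have [->|x0] := eqVneq x 0; first by rewrite invr0 bval0 invr0.
by apply: (invM1 divD); rewrite ?bval_eq0 // -bvalM mulfV.
Qed.
Lemma bval_nat n : bval (n%:R : K) = n%:R.
Proof. by elim: n => [|n IHn] //; rewrite -!natr1 bvalD IHn. Qed.
Lemma mem_bfield x : S x -> x \in bicent S.
Proof. by move=> Sx; apply/bicentP; apply: sub_centr2. Qed.
End BicentField.

(** * Finite subrings and torsion elements *)

(** A finite subring, given by its list of elements, is made into a finite ring
    in order to inherit the commutativity of finite division rings. *)
Section FiniteSubring.
Variables (D : unitRingType) (s : seq D).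

Definition fpred of subring_closed [in s] : {pred D} := [in s].
Record fsub (h : subring_closed [in s]) :=
  FSub { fval :> D; _ : fval \in fpred h }.
Variable h : subring_closed [in s].
Local Notation T := (fsub h).
HB.instance Definition _ := [isSub for @fval h].
HB.instance Definition _ := [Choice of T by <:].
HB.instance Definition _ := GRing.isSubringClosed.Build D (fpred h) h.
HB.instance Definition _ := [SubChoice_isSubNzRing of T by <:].

Definition fsub_seq (x : T) : seq_sub s := SeqSub (valP x).
Definition seq_fsub (x : seq_sub s) : T := @FSub h (ssval x) (ssvalP x).
Lemma fsub_seqK : cancel fsub_seq seq_fsub.
Proof. by move=> x; apply: val_inj. Qed.
HB.instance Definition _ := Countable.copy T (can_type fsub_seqK).
HB.instance Definition _ : isFinite T := CanIsFinite fsub_seqK.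
HB.instance Definition _ := FinRing.isNzRing.Build T.

Lemma finite_subring_comm (divD : GRing.field_axiom D) x y :
  x \in s -> y \in s -> x * y = y * x.
Proof.
move=> sx sy.
have dom : GRing.integral_domain_axiom T.
  move=> u v uv0; have /eqP : fval u * fval v = 0 by rewrite -[RHS]/(fval 0) -uv0.
  by rewrite (mulD_eq0 divD).
by have /(congr1 (@fval h)) := finDomain_mulrC dom (@FSub h x sx) (@FSub h y sy).
Qed.
End FiniteSubring.

Section Finite.
Variables (D : unitRingType) (divD : GRing.field_axiom D).
Variables (p : nat) (cp : p \in [pchar D]).

(** The linear combinations of the elements of a finite monoid over the prime
    field are a finite ring. *)
Lemma finite_monoid_comm (s : seq D) :
  1 \in s -> (forall x y, x \in s -> y \in s -> x * y \in s) ->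
  forall x y, x \in s -> y \in s -> x * y = y * x.
Proof.
move=> s1 sM.
have p0 : (0 < p)%N by case/andP: cp => /prime_gt0.
pose comb (f : 'I_(size s) -> nat) := \sum_(i < size s) s`_i *+ f i.
pose S := [seq comb (fun i => nat_of_ord (f i)) | f : {ffun 'I_(size s) -> 'I_p}].
have SP y : reflect (exists f, y = comb f) (y \in S).
  apply: (iffP imageP) => [[f _ ->]|[f ->]]; first by exists (fun i => nat_of_ord (f i)).
  exists [ffun i => Ordinal (ltn_pmod (f i) p0)]; first by [].
  apply: eq_bigr => i _; rewrite ffunE /= {1}(divn_eq (f i) p) mulrnDr.
  by rewrite mulnC mulrnA (mulrn_pchar cp) mul0rn add0r.
have SD y z : y \in S -> z \in S -> y + z \in S.
  move=> /SP[f ->] /SP[g ->]; apply/SP; exists (fun i => (f i + g i)%N).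
  by rewrite -big_split; apply: eq_bigr => i _; rewrite mulrnDr.
have S0 : 0 \in S.
  by apply/SP; exists (fun=> 0%N); rewrite /comb big1.
have Smn y n : y \in S -> y *+ n \in S.
  move=> Sy; elim: n => [|n IHn]; first by rewrite mulr0n.
  by rewrite mulrS SD.
have Ss y : y \in s -> y \in S.
  move=> sy; have ys : (index y s < size s)%N by rewrite index_mem.
  apply/SP; exists (fun i => (i == Ordinal ys) : nat).
  rewrite /comb (bigD1 (Ordinal ys)) //= eqxx mulr1n nth_index // big1 ?addr0 //.
  by move=> i /negPf->.
have SM y z : y \in S -> z \in S -> y * z \in S.
  move=> /SP[f ->] /SP[g ->]; rewrite /comb mulr_suml.
  apply: (big_ind (fun x => x \in S)) => // i _; rewrite mulr_sumr.
  apply: (big_ind (fun x => x \in S)) => // j _.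
  by rewrite mulrnAl mulrnAr; do 2!apply: (Smn); apply: Ss; apply: sM; apply: mem_nth.
have SN y : y \in S -> - y \in S.
  move=> Sy; rewrite -[- y](_ : y *+ p.-1 = _) ?Smn //.
  by apply/eqP; rewrite -addr_eq0 -mulrSr prednK // (mulrn_pchar cp).
have hS : subring_closed [in S].
  by split=> [|y z Sy Sz|y z Sy Sz]; rewrite ?(Ss _ s1) ?SM // SD ?SN.
by move=> x y sx sy; apply: (finite_subring_comm hS) => //; apply: Ss.
Qed.

(** The products [x d^k] are a finite monoid. *)
Lemma finite_ext_comm (s : seq D) d M :
  1 \in s -> (forall x y, x \in s -> y \in s -> x * y \in s) ->
  (0 < M)%N -> d ^+ M = 1 -> (forall x, x \in s -> cj d x \in s) ->
  forall x, x \in s -> GRing.comm x d.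
Proof.
move=> s1 sM M0 dM sd.
have d0 : d != 0.
  by apply: contraTneq isT => d0; move/eqP: dM; rewrite d0 expr0n (gtn_eqF M0) eq_sym oner_eq0.
pose S := [seq e * d ^+ k | e <- s, k <- iota 0 M].
have memS e k : e \in s -> e * d ^+ k \in S.
  move=> se; rewrite -(expr_mod k dM); apply: allpairs_f => //.
  by rewrite mem_iota add0n ltn_mod.
have mv e k : e \in s -> exists2 e', e' \in s & d ^+ k * e = e' * d ^+ k.
  elim: k e => [|k IHk] e se; first by exists e; rewrite // mul1r mulr1.
  have [e' se' he'] := IHk e se; exists (cj d e'); first exact: sd.
  by rewrite !exprS -mulrA he' mulrA -(cjE divD _ d0) !mulrA.
move=> x sx; rewrite /GRing.comm.
apply: (@finite_monoid_comm S).
- by rewrite -[1]mulr1 -[X in _ * X](expr0 d) memS.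
- move=> y z /allpairsP[[e k] /= [se _ ->]] /allpairsP[[f l] /= [sf _ ->]].
  have [f' sf' hf'] := mv f k sf.
  by rewrite -mulrA (mulrA (d ^+ k)) hf' -mulrA -exprD mulrA memS ?sM.
- by rewrite -[x]mulr1 -[X in _ * X](expr0 d) memS.
- by rewrite -[d]mul1r -[X in _ * X](expr1 d) memS.
Qed.

End Finite.

Section Eigen.
Variables (D : unitRingType) (divD : GRing.field_axiom D).

(** The sums of the conjugates of [z] by the powers of [a], weighted by the
    powers of a power of [a^-1], are eigenvectors of the conjugation by [a], and
    their own sum is a multiple of [z]; so one of them has an eigenvalue other
    than 1 when [z] does not commute with [a]. *)
Lemma root_unity_eigenvector (E : D -> Prop) (dE : div_closed E) a z n :
  E a -> E z -> (0 < n)%N -> n%:R != 0 :> D -> a ^+ n = 1 ->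
  ~ GRing.comm a z ->
  exists d i, [/\ E d, d != 0, cj d a = a ^+ i & cj d a != a].
Proof.
move=> Ea Ez n0 nD an ncz.
have [m m_prim /dvdnP[q def_n]] := prim_order_exists n0 an.
have mD : m%:R != 0 :> D by apply: contraNneq nD => m0; rewrite def_n natrM m0 mulr0.
have m0 := prim_order_gt0 m_prim; have am := prim_expr_order m_prim.
have a0 : a != 0.
  apply: contraTneq isT => a0; move/eqP: am; rewrite a0 expr0n.
  by rewrite (gtn_eqF m0) eq_sym oner_eq0.
pose b := a^-1; have bm : b ^+ m = 1 by rewrite exprVn am invr1.
have cab : GRing.comm a b by apply: commrV.
pose f j i := b ^+ (i * j) * (a ^+ i * z * b ^+ i).
pose w j := \sum_(i < m) f j i.
have fm j : f j m = f j 0%N.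
  by rewrite /f mul0n (exprM b m j) bm expr1n am.
have fS j i : a * f j i * b = a ^+ j * f j i.+1.
  rewrite /f mulSn exprD !mulrA -exprMn_comm // mulDV // expr1n mul1r.
  rewrite (commrX (i * j) cab) -!mulrA; congr (_ * _).
  by rewrite exprS -!mulrA -exprSr.
have wE j : a * w j * b = a ^+ j * w j.
  rewrite /w mulr_sumr mulr_suml; under eq_bigr do rewrite fS.
  rewrite -mulr_sumr.
  congr (_ * _); case: (m) m0 (fm j) => // m' _ fm'.
  by rewrite big_ord_recr [RHS]big_ord_recl /= fm' addrC.
have Ew j : E (w j).
  have Eb := dcV dE Ea.
  apply: (dc_sum dE) => i _; apply: (dcM dE); first exact: (dcX dE).
  by apply: (dcM dE); [apply: (dcM dE) => // |]; apply: (dcX dE).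
have sw : \sum_(j < m) w j = m%:R * z.
  rewrite exchange_big /=; case: (m) m0 mD m_prim am bm => // m' _ mD m_prim am bm.
  rewrite big_ord_recl /= [X in _ + X]big1 ?addr0 => [|i _].
    under eq_bigr do rewrite /f mul0n !expr0 !mul1r mulr1.
    by rewrite sumr_const card_ord mulr_natl.
  rewrite -mulr_suml; set S := \sum_ _ _.
  suff -> : S = 0 by rewrite mul0r.
  have hS : (b ^+ bump 0 i - 1) * S = 0.
    rewrite /S; under eq_bigr do rewrite exprM.
    by rewrite -subrX1 -exprM mulnC exprM bm expr1n subrr.
  move/eqP: hS; rewrite (mulD_eq0 divD) => /orP[|/eqP//].
  rewrite subr_eq0 /b exprVn => /eqP/(congr1 (fun x => x^-1)).
  rewrite invrK invr1 => /eqP; rewrite -(prim_order_dvd m_prim) => /dvdn_leq.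
  by move=> /(_ isT); rewrite leqNgt ltnS /= ltn_ord.
have [j [j0 jm wj0]] : exists j, [/\ (0 < j)%N, (j < m)%N & w j != 0].
  apply: contrapT => nex; apply: ncz.
  have w0 j : (0 < j)%N -> (j < m)%N -> w j = 0.
    by move=> j0 jm; apply/eqP/negPn/negP => wj; apply: nex; exists j.
  have : w 0%N = m%:R * z.
    rewrite -sw; case: (m) m0 w0 => // m' _ w0.
    by rewrite big_ord_recl big1 ?addr0 //= => i _; rewrite w0 // /bump ltnS ltn_ord.
  move=> w0z; have := wE 0%N; rewrite expr0 mul1r w0z => h.
  have hz : m%:R * (a * z * b) = m%:R * z.
    by rewrite -[RHS]h !mulrA (commr_nat a m).
  by apply: (cj_id divD a0); apply: (mulDI divD mD hz).
exists (w j), (m - j).+1.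
have hd : cj (w j) a = a ^+ (m - j).+1.
  rewrite /cj; apply: (mulID divD wj0); rewrite (mulDVK divD) //.
  apply: (mulDI divD (expD_neq0 divD j a0)).
  rewrite !mulrA -exprD -wE addnS addnC subnK 1?ltnW // exprS am mulr1.
  by rewrite (mulDVK divD).
split=> //; rewrite hd; apply/eqP => h.
have : a ^+ (m - j) == 1.
  by apply/eqP; apply: (mulDI divD a0); rewrite -exprS h mulr1.
rewrite -(prim_order_dvd m_prim) => /dvdn_leq; rewrite subn_gt0 => /(_ jm).
by rewrite leqNgt ltn_subrL j0 m0.
Qed.

Section Torsion.
Variables (p : nat) (cp : p \in [pchar D]).

(** In characteristic [p], the elements that are algebraic over the prime
    field; unlike the roots of unity of which they consist (with 0), this form
    is visibly stable under the sums of commuting elements. *)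
Definition tor (x : D) := exists2 m, (0 < m)%N & x ^+ (p ^ m) = x.

Lemma tor_iter (x : D) m k : x ^+ (p ^ m) = x -> x ^+ (p ^ (m * k)) = x.
Proof.
move=> h; elim: k => [|k IHk]; first by rewrite muln0 expn0 expr1.
by rewrite mulnS expnD exprM h.
Qed.

Lemma tor_common x y : tor x -> tor y ->
  exists2 m, (0 < m)%N & x ^+ (p ^ m) = x /\ y ^+ (p ^ m) = y.
Proof.
move=> [m m0 hx] [k k0 hy]; exists (m * k)%N; first by rewrite muln_gt0 m0.
by split; [apply: tor_iter | rewrite mulnC; apply: tor_iter].
Qed.

Lemma exprD_pchar (x y : D) n : GRing.comm x y ->
  (x + y) ^+ (p ^ n) = x ^+ (p ^ n) + y ^+ (p ^ n).
Proof.
move=> cxy; elim: n => [|n IHn]; first by rewrite !expr1.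
rewrite expnSr exprM IHn -!(pFrobenius_autE cp) pFrobenius_autD_comm //.
  by rewrite !pFrobenius_autE -!exprM -expnSr.
by apply: commrX; apply: commr_sym; apply: commrX; apply: commr_sym.
Qed.

Lemma pchar_odd_exp n : (-1) ^+ (p ^ n) = -1 :> D.
Proof.
apply/eqP; rewrite -subr_eq0 opprK -[X in _ + X](expr1n D (p ^ n)) addrC.
rewrite -exprD_pchar ?subrr ?expr0n; last by apply: commrN1.
by rewrite expn_eq0 (gtn_eqF (prime_gt0 (pcharf_prime cp))).
Qed.

Lemma exprB_pchar (x y : D) n : GRing.comm x y ->
  (x - y) ^+ (p ^ n) = x ^+ (p ^ n) - y ^+ (p ^ n).
Proof.
move=> cxy; rewrite exprD_pchar; last exact: commrN.
by rewrite -mulN1r exprMn_comm ?pchar_odd_exp ?mulN1r //; apply: commr_sym; apply: commrN1.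
Qed.

Lemma torB (x y : D) : GRing.comm x y -> tor x -> tor y -> tor (x - y).
Proof.
move=> c tx ty; have [m m0 [hx hy]] := tor_common tx ty.
by exists m; rewrite ?exprB_pchar // hx hy.
Qed.
Lemma torM (x y : D) : GRing.comm x y -> tor x -> tor y -> tor (x * y).
Proof.
move=> c tx ty; have [m m0 [hx hy]] := tor_common tx ty.
by exists m; rewrite ?exprMn_comm // hx hy.
Qed.
Lemma torV x : tor x -> tor x^-1.
Proof. by move=> [m m0 hx]; exists m; rewrite // exprVn hx. Qed.
Lemma tor0 : tor 0.
Proof.
exists 1%N => //; rewrite expr0n expn_eq0.
by rewrite (gtn_eqF (prime_gt0 (pcharf_prime cp))).
Qed.
Lemma tor1 : tor 1. Proof. by exists 1%N; rewrite ?expr1n. Qed.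

Lemma tor_exp_eq1 x : x != 0 -> tor x ->
  exists n, [/\ (0 < n)%N, n%:R != 0 :> D & x ^+ n = 1].
Proof.
move=> x0 [m m0 hx]; have pp := pcharf_prime cp.
have pm : (1 < p ^ m)%N by rewrite -{1}(exp1n m) ltn_exp2r // prime_gt1.
exists (p ^ m).-1; rewrite -subn1 subn_gt0; split=> //.
  rewrite natrB 1?ltnW // natrX pcharf0 // expr0n (gtn_eqF m0) sub0r.
  by rewrite oppr_eq0 oner_eq0.
by apply: (mulDI divD x0); rewrite -exprS subn1 prednK 1?ltnW // mulr1.
Qed.

Lemma exp_eq1_tor (x : D) n : (0 < n)%N -> x ^+ n = 1 -> tor x.
Proof.
have pp := pcharf_prime cp; elim: n {-2}n (leqnn n) => [[]//|N IHN] n nN n0 xn.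
have [pn|npn] := boolP (p %| n)%N.
  have/dvdnP[k def_n] := pn; have k0 : (0 < k)%N by case: k def_n n0 => // ->.
  apply: (IHN k) => //.
    rewrite -ltnS; apply: leq_trans nN; rewrite def_n.
    by rewrite -{1}[k]muln1 ltn_pmul2l // prime_gt1.
  have : (x ^+ k - 1) ^+ (p ^ 1) = 0.
    rewrite exprB_pchar; last exact: commr1.
    by rewrite expn1 expr1n -exprM -def_n xn subrr.
  by move/(expD_eq0 divD)/eqP; rewrite subr_eq0 => /eqP.
exists (totient n); first by rewrite totient_gt0.
have cpn : coprime p n by rewrite prime_coprime.
have := Euler_exp_totient cpn; have [n1|n1] := leqP n 1.
  have n1' : n = 1%N by apply/eqP; rewrite eqn_leq n1.
  by rewrite n1' expr1 in xn; rewrite xn expr1n.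
rewrite (modn_small n1) => h.
by rewrite (divn_eq (p ^ totient n) n) h exprD mulnC exprM xn expr1n mul1r.
Qed.

Lemma tor_expP x n : (0 < n)%N -> tor (x ^+ n) -> tor x.
Proof.
move=> n0 tx; have [->|x0] := eqVneq x 0; first exact: tor0.
have [k [k0 _ hk]] := tor_exp_eq1 (expD_neq0 divD n x0) tx.
by apply: (@exp_eq1_tor x (n * k)); rewrite ?muln_gt0 ?n0 // exprM.
Qed.

Lemma tor_mulK (x y : D) : GRing.comm x y -> x != 0 -> tor x -> tor (x * y) -> tor y.
Proof.
move=> c x0 tx txy; rewrite -(mulKD divD y x0); apply: torM; last exact: txy.
  by apply: commrM; [apply: commr_sym; apply: commrV | apply: commr_sym; apply: commrV; apply: commr_sym].
exact: torV.
Qed.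

(** A torsion element cannot be conjugated to another of its powers by a
    torsion element: they would generate a finite noncommutative ring. *)
Lemma tor_normalize_comm a d i : a != 0 -> d != 0 -> tor a -> tor d ->
  cj d a = a ^+ i -> GRing.comm a d.
Proof.
move=> a0 d0 ta td hda.
have [n [n0 _ an]] := tor_exp_eq1 a0 ta; have [k [k0 _ dk]] := tor_exp_eq1 d0 td.
pose s := [seq a ^+ j | j <- iota 0 n].
have sP j : a ^+ j \in s.
  by rewrite -(expr_mod j an); apply: map_f; rewrite mem_iota add0n ltn_mod.
apply: (@finite_ext_comm D divD p cp s d k) => //.
- exact: (sP 0%N).
- by move=> x y /mapP[j _ ->] /mapP[l _ ->]; rewrite -exprD sP.
- by move=> x /mapP[j _ ->]; rewrite cjX // hda -exprM sP.
- exact: (sP 1%N).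
Qed.

(** Jacobson's theorem: an eigenvector of the conjugation by a torsion element
    would normalize the cyclic group of this element without centralizing it. *)
Lemma torsion_comm (E : D -> Prop) (dE : div_closed E) :
  (forall x, E x -> tor x) -> forall x y, E x -> E y -> GRing.comm x y.
Proof.
move=> tE a z Ea Ez; apply: contrapT => ncz.
have a0 : a != 0 by apply: contra_notN ncz => /eqP->; apply: commr_sym; apply: commr0.
have [n [n0 nD an]] := tor_exp_eq1 a0 (tE _ Ea).
have [d [i [Ed d0 hd /eqP nd]]] := root_unity_eigenvector dE Ea Ez n0 nD an ncz.
apply: nd; apply: cj_comm => //; apply: commr_sym.
by apply: (tor_normalize_comm a0 d0 _ _ hd); apply: tE.
Qed.

(** An eigenvector of the conjugation by [a] is not torsion, and neither are its
    powers, some of which commute with [a]. *)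
Lemma tor_centralizer_nontor a : tor a -> ~ is_central a ->
  exists2 v, GRing.comm a v & ~ tor v.
Proof.
move=> ta nca; have /existsNP[z ncz] := nca.
have a0 : a != 0 by apply: contra_notN ncz => /eqP->; apply: commr_sym; apply: commr0.
have [n [n0 nD an]] := tor_exp_eq1 a0 ta.
have dT : div_closed (fun _ : D => True) by split.
have [d [i [_ d0 hd /eqP nd]]] := root_unity_eigenvector dT I I n0 nD an ncz.
have cjm k : cj (d ^+ k) a = a ^+ (i ^ k).
  elim: k => [|k IHk]; first by rewrite cj_comm ?oner_eq0 ?expr1 //; apply: commr_sym; apply: commr1.
  by rewrite exprSr -(cj_cj divD) ?expD_neq0 // hd cjX ?expD_neq0 // IHk -exprM -expnSr.
have [k k0 hk] : exists2 k, (0 < k)%N & a ^+ (i ^ k) = a.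
  pose f (j : 'I_n.+1) : 'I_n := Ordinal (ltn_pmod (i ^ j) n0).
  have /injectivePn[x [y nxy fxy]] : ~~ injectiveb f.
    by apply/injectiveP => /leq_card; rewrite !card_ord ltnn.
  wlog xy : x y nxy fxy / (x < y)%N.
    move=> wl; have [|yx|/val_inj/eqP] := ltngtP x y; first exact: wl.
      by apply: (wl y x) => //; rewrite eq_sym.
    by rewrite (negPf nxy).
  exists (y - x)%N; first by rewrite subn_gt0.
  have h : cj (d ^+ y) a = cj (d ^+ x) a.
    rewrite !cjm -[LHS](expr_mod _ an) -[RHS](expr_mod _ an).
    by move/(congr1 val): fxy => /= ->.
  rewrite -cjm; move/(congr1 (cj (d ^+ x)^-1)): h.
  rewrite cjK ?expD_neq0 // => {2}<-.
  by rewrite -{2}(subnKC (ltnW xy)) exprD -(cj_cj divD) ?expD_neq0 // cjK ?expD_neq0.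
exists (d ^+ k); first by apply: commr_sym; apply: (cj_id divD); rewrite ?expD_neq0 // cjm.
move=> /(tor_expP k0) td; apply: nd; apply: cj_comm => //; apply: commr_sym.
exact: (tor_normalize_comm a0 d0 ta td hd).
Qed.

End Torsion.
End Eigen.

(** * Iterated commutators and abelian subnormal subgroups *)

(** Subnormality with the length of the series exposed, as most proofs are by
    induction on it. *)
Fixpoint subn (R : pzRingType) (r : nat) (H : R -> Prop) : Prop :=
  match r with
  | 0 => forall x, H x <-> unit_group x
  | r'.+1 => exists K, [/\ subn r' K, is_unit_subgroup H & is_normal_in H K]
  end.

Lemma subnormal_subn (R : pzRingType) (H : R -> Prop) :
  subnormal_in_units H -> exists r, subn r H.
Proof.
elim=> [|{}H K _ [r hr] hH hn]; first by exists 0%N.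
by exists r.+1, K.
Qed.

Section Periodic.
Variable L : fieldType.

Definition mdiff (u : nat -> L) (i : nat) := u i.+1 / u i.

Lemma mdiff_neq0 u : (forall i, u i != 0) -> forall i, mdiff u i != 0.
Proof. by move=> u0 i; rewrite mulf_neq0 ?invr_eq0. Qed.

(** For a periodic sequence in an abelian group, the cyclic shift [T]
    satisfies [(T - 1) (1 + T + ... + T^(k-1)) = 0], so [k (T - 1)] is a multiple
    of [(T - 1)^2], and [k^m (T - 1)] of [(T - 1)^(m+1)]. *)
Lemma periodic_mdiff (G : L -> Prop) (G1 : G 1)
    (GM : forall x y, G x -> G y -> G (x * y)) (GV : forall x, G x -> G x^-1)
    (m k : nat) (u : nat -> L) :
  (forall i, u i != 0) -> (forall i, u (i + k)%N = u i) ->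
  (forall i, G (iter m.+1 mdiff u i)) ->
  forall i, G (mdiff u i ^+ (k ^ m)).
Proof.
elim: m u => [|m IHm] u u0 uk hG i; first exact: hG.
have v0 := mdiff_neq0 u0; set v := mdiff u in v0 *.
have vk j : v (j + k)%N = v j by rewrite /v /mdiff -addSn !uk.
have hv j : G (mdiff v j ^+ (k ^ m)).
  by apply: IHm => // l; have := hG l; rewrite iterSr.
have hvj j : exists2 g, G g & v (i + j)%N ^+ (k ^ m) = g * v i ^+ (k ^ m).
  elim: j => [|j [g Gg hg]]; first by exists 1; rewrite // addn0 mul1r.
  exists (mdiff v (i + j) ^+ (k ^ m) * g); first exact: GM.
  rewrite -mulrA -hg -exprMn /mdiff addnS divfK //.
have hprod j : exists2 g, G g &
    (u (i + j)%N / u i) ^+ (k ^ m) = g * v i ^+ (k ^ m * j).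
  elim: j => [|j [g Gg hg]].
    by exists 1; rewrite // addn0 divff // expr1n muln0 expr0 mulr1.
  have [g' Gg' hg'] := hvj j; exists (g' * g); first exact: GM.
  rewrite mulnS exprD mulrACA -hg -hg' -exprMn /v /mdiff addnS mulrA divfK //.
have [g Gg] := hprod k; rewrite uk divff // expr1n expnSr => h.
have g0 : g != 0 by apply: contraTneq isT => g0; move/eqP: h; rewrite g0 mul0r oner_eq0.
suff -> : v i ^+ (k ^ m * k) = g^-1 by apply: GV.
by apply: (mulfI g0); rewrite -h mulfV.
Qed.

End Periodic.

Lemma inf_roots0 (L : fieldType) (P : {poly L}) (t : nat -> L) :
  injective t -> (forall i, P.[t i] = 0) -> P = 0.
Proof.
move=> inj_t hP; apply/eqP; apply: contraT => P0.
have := @max_poly_roots _ P (mkseq t (size P)) P0.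
rewrite size_mkseq ltnn mkseq_uniq // => -> //.
by apply/allP => x /mapP[i _ ->]; apply/eqP.
Qed.

Section Commutators.
Variables (D : unitRingType) (divD : GRing.field_axiom D).
Implicit Types (a b x y z : D) (H K : D -> Prop).

Lemma mutual_inversesD x y : mutual_inverses x y <-> x != 0 /\ y = x^-1.
Proof.
split=> [[xy yx]|[x0 ->]]; last by split; rewrite ?(mulDV divD) ?(mulVD divD).
by have x0 := mul1_neq0 xy; split=> //; apply: (invM1 divD x0).
Qed.

Lemma subg_neq0 H x : is_unit_subgroup H -> H x -> x != 0.
Proof. by case=> _ _ hV /hV[y _ [xy _]]; apply: mul1_neq0 xy. Qed.
Lemma subgV H x : is_unit_subgroup H -> H x -> H x^-1.
Proof. by case=> _ _ hV /hV[y Hy /mutual_inversesD[_ <-]]. Qed.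
Lemma subgM H x y : is_unit_subgroup H -> H x -> H y -> H (x * y).
Proof. by case=> _ hM _; apply: hM. Qed.
Lemma subg1 H : is_unit_subgroup H -> H 1. Proof. by case. Qed.
Lemma subg_comm H x y : is_unit_subgroup H -> H x -> H y -> H (cj x y * y^-1).
Proof.
move=> hH Hx Hy; apply: subgM => //; last exact: subgV.
by apply: subgM => //; [apply: subgM | apply: subgV].
Qed.
Lemma unit_subgroupD H : H 1 -> (forall x, H x -> x != 0) ->
  (forall x y, H x -> H y -> H (x * y)) -> (forall x, H x -> H x^-1) ->
  is_unit_subgroup H.
Proof.
move=> H1 H0 HM HV; split=> // x Hx; exists x^-1; first exact: HV.
by apply/mutual_inversesD; split=> //; apply: H0.
Qed.
Lemma normal_cj H K k h : is_normal_in H K -> K k -> k != 0 -> H h -> H (cj k h).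
Proof.
move=> [_ hn] Kk k0 Hh; apply: hn => //.
by apply/mutual_inversesD.
Qed.
Lemma normal_inD H K : (forall x, H x -> K x) ->
  (forall k h, K k -> k != 0 -> H h -> H (cj k h)) -> is_normal_in H K.
Proof.
move=> sHK hn; split=> // h k k' Hh Kk /mutual_inversesD[k0 ->].
exact: hn.
Qed.
Lemma normal_comm H K k h : is_unit_subgroup H -> is_normal_in H K ->
  K k -> k != 0 -> H h -> H (cj h k * k^-1).
Proof.
move=> hH hn Kk k0 Hh.
have -> : cj h k * k^-1 = h * cj k h^-1 by rewrite /cj !mulrA.
by apply: subgM => //; apply: (normal_cj hn) => //; apply: subgV.
Qed.
Lemma subn_subgroup r H : subn r H -> is_unit_subgroup H.
Proof.
case: r => [h|r [K []]] //=; apply: unit_subgroupD => [|x|x y|x].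
- by apply/h/(unit_groupD divD); apply: oner_neq0.
- by move=> /h/(unit_groupD divD).
- move=> /h/(unit_groupD divD) x0 /h/(unit_groupD divD) y0; apply/h.
  by apply/(unit_groupD divD); apply: mulD_neq0.
- move=> /h/(unit_groupD divD) x0; apply/h/(unit_groupD divD).
  by rewrite (invD_eq0 x).
Qed.
Lemma subn_neq0 r H x : subn r H -> H x -> x != 0.
Proof. by move=> /subn_subgroup; apply: subg_neq0. Qed.

(** [[a, [a, ... [a, y]]]] for the group commutator [a y a^-1 y^-1]. *)
Fixpoint itc a y (j : nat) : D :=
  if j is j'.+1 then cj a (itc a y j') * (itc a y j')^-1 else y.

(** Each commutator with [a] goes down one step of the series. *)
Lemma itc_subn r H a y : subn r H -> H a -> y != 0 -> H (itc a y r).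
Proof.
elim: r H => [|r IHr] H /=.
  by move=> h _ y0; apply/h/(unit_groupD divD).
move=> [K [sK hH hn]] Ha y0; have Ka : K a by case: hn => + _; apply.
have Kc := IHr K sK Ka y0.
by apply: (normal_comm hH hn Kc) => //; apply: (subn_neq0 sK).
Qed.

Lemma itc_comm r H a y : subn r H -> (forall x z, H x -> H z -> GRing.comm x z) ->
  H a -> y != 0 -> itc a y r.+1 = 1.
Proof.
move=> sH cH Ha y0 /=; have Hc := itc_subn sH Ha y0.
rewrite cj_comm ?(subn_neq0 sH Ha) //; last exact: cH.
by rewrite (mulDV divD) // (subn_neq0 sH Hc).
Qed.

(** Along a family of commuting elements that is shifted by the conjugation by
    [a], the iterated commutators are the iterated quotients. *)
Lemma itc_mdiff (S : D -> Prop) (comS : commuting S)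
    (Y : nat -> bfield divD comS) a j :
  a != 0 -> (forall i, Y i != 0) -> (forall i, cj a (bval (Y i)) = bval (Y i.+1)) ->
  forall i, itc a (bval (Y i)) j = bval (iter j (@mdiff _) Y i).
Proof.
move=> a0 Y0 hY.
have hm (u : nat -> bfield divD comS) i :
    bval (mdiff u i) = bval (u i.+1) * (bval (u i))^-1.
  by rewrite /mdiff bvalM bvalV.
have hc k i : cj a (bval (iter k (@mdiff _) Y i)) = bval (iter k (@mdiff _) Y i.+1).
  elim: k i => [|k IHk] i; first exact: hY.
  by rewrite !iterS !hm cjM // cjV // !IHk.
elim: j => [|j IHj] i //; rewrite iterS hm -hc /= IHj //.
Qed.

Definition finite_order x := exists2 n, (0 < n)%N & x ^+ n = 1.

Lemma infinite_order_inj x : x != 0 -> ~ finite_order x ->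
  injective (fun i => x ^+ i).
Proof.
move=> x0 nf i j; wlog ij : i j / (i <= j)%N.
  by move=> wl h; have [/wl->|/ltnW/wl] := leqP i j => // ->.
move=> /= h; have [->//|ne] := eqVneq i j; case: nf; exists (j - i)%N.
  by rewrite subn_gt0 ltn_neqAle ne.
apply: (mulDI divD (expD_neq0 divD i x0)).
by rewrite -exprD subnKC // mulr1 h.
Qed.

Section Heisenberg.
Variables (a b : D) (m : nat).
Hypotheses (a0 : a != 0) (b0 : b != 0).
Let l := cj a b * b^-1.
Hypotheses (cal : GRing.comm a l) (cbl : GRing.comm b l).
Hypothesis hm : forall y, y != 0 -> itc a y m.+1 = 1.

Let l0 : l != 0. Proof. by rewrite (mulD_neq0 divD) ?cj_neq0 ?invD_eq0. Qed.
Let cjb : cj a b = l * b. Proof. by rewrite /l (mulDVK divD). Qed.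
Let cjlb i : cj a (l ^+ i * b) = l ^+ i.+1 * b.
Proof.
rewrite cjM // cjX // cjb (cj_comm divD a0 cal) mulrA -exprSr //.
Qed.

(** With infinitely many commuting parameters [t], the iterated commutators of
    [a] with [t + b] are the values at [t] of rational functions with the zeros
    [- l ^+ i * b], and cannot all be 1 unless [l = 1]. *)
Lemma Heisenberg_param (t : nat -> D) :
  injective t -> (forall i, GRing.comm a (t i)) -> (forall i, GRing.comm b (t i)) ->
  (forall i j, GRing.comm (t i) (t j)) -> l = 1.
Proof.
move=> inj_t cat cbt ctt; apply: contrapT => /eqP l1.
have clt i : GRing.comm l (t i).
  apply: commr_sym; apply: commrM; last by apply: commrV; apply: commr_sym.
  by apply: commrM; [apply: commrM | apply: commrV]; apply: commr_sym.
pose S x := x = b \/ x = l \/ exists i, x = t i.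
have comS : commuting S.
  move=> x y [->|[->|[i ->]]] [->|[->|[j ->]]] //;
    by first [exact: cbl | exact: cbt | exact: clt | apply: commr_sym;
      first [exact: cbl | exact: cbt | exact: clt]].
pose L : fieldType := bfield divD comS.
have Sb : b \in bicent S by apply: mem_bfield; left.
have Sl : l \in bicent S by apply: mem_bfield; right; left.
have St i : t i \in bicent S by apply: mem_bfield; right; right; exists i.
pose B : L := BField divD comS Sb; pose Lm : L := BField divD comS Sl.
pose T i : L := BField divD comS (St i).
have B0 : B != 0 by rewrite -bval_eq0.
have L0 : Lm != 0 by rewrite -bval_eq0.
have L1 : Lm != 1 by rewrite -(inj_eq (@bval_inj _ _ _ _)).
have inj_T : injective T by move=> i j /(congr1 (@bval _ _ _ _)) /inj_t.
pose Y k i : L := T k + Lm ^+ i * B.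
have hY k i : cj a (bval (Y k i)) = bval (Y k i.+1).
  rewrite /Y !bvalD !bvalM !bvalX cjD /= cjlb.
  by rewrite (cj_comm divD a0 (cat k)).
have Y0 k i : Y k i != 0.
  apply: contra_neq L1 => /(congr1 (@bval _ _ _ _)) hy.
  have : bval (Y k i.+1) = bval (Y k i) by rewrite -hY hy cj0.
  move=> /bval_inj/addrI; rewrite exprS -mulrA => h.
  apply: (mulIf (mulf_neq0 (expf_neq0 i L0) B0)); rewrite h mul1r //.
have hit k i : iter m.+1 (@mdiff _) (Y k) i = 1.
  apply: bval_inj; rewrite -(itc_mdiff m.+1 a0 (Y0 k) (hY k)) hm // bval_eq0 //.
have [[n n0 ln]|nfl] := pselect (finite_order l).
  have Yn k i : Y k (i + n)%N = Y k i.
    by rewrite /Y exprD (_ : Lm ^+ n = 1) ?mulr1 //; apply: bval_inj; rewrite bvalX.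
  have hM k : mdiff (Y k) 0 ^+ (n ^ m) = 1.
    have GM (x y : L) : x = 1 -> y = 1 -> x * y = 1 by move=> -> ->; rewrite mulr1.
    have GV (x : L) : x = 1 -> x^-1 = 1 by move=> ->; rewrite invr1.
    exact: (@periodic_mdiff L (fun x : L => x = 1) erefl GM GV m n _ (Y0 k) (Yn k)
              (hit k) 0%N).
  pose P : {poly L} := ('X + (Lm * B)%:P) ^+ (n ^ m) - ('X + B%:P) ^+ (n ^ m).
  have P0 : P = 0.
    apply: (inf_roots0 inj_T) => k; rewrite /P !hornerE.
    have := hM k; rewrite /mdiff /Y expr1 expr0 mul1r expr_div_n => h.
    have y0 : (T k + B) ^+ (n ^ m) != 0.
      by rewrite expf_neq0 //; have := Y0 k 0%N; rewrite /Y expr0 mul1r.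
    by rewrite (canRL (divfK y0) h) mul1r subrr.
  have : P.[- B] = 0 by rewrite P0 horner0.
  rewrite /P !hornerE [- B + B]addNr expr0n expn_eq0 (gtn_eqF n0) /= subr0.
  move/eqP; rewrite expf_eq0 => /andP[_].
  by rewrite -[- B]mulN1r -mulrDl mulf_eq0 (negPf B0) orbF addrC subr_eq0 (negPf L1).
have injL i j : Lm ^+ i = Lm ^+ j -> i = j.
  move/(congr1 (@bval _ _ _ _)); rewrite !bvalX; exact: (infinite_order_inj l0 nfl).
pose PQ := fix PQ j : nat -> {poly L} * {poly L} := fun i =>
  if j is j'.+1 then ((PQ j' i.+1).1 * (PQ j' i).2, (PQ j' i.+1).2 * (PQ j' i).1)
  else ('X + (Lm ^+ i * B)%:P, 1).
have PQt j i k : [/\ (PQ j i).1.[T k] != 0, (PQ j i).2.[T k] != 0 &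
    iter j (@mdiff _) (Y k) i = (PQ j i).1.[T k] / (PQ j i).2.[T k]].
  elim: j i => [|j IHj] i /=.
    by rewrite !hornerE oner_neq0 invr1 mulr1; split=> //; apply: Y0.
  have [p1 q1 h1] := IHj i.+1; have [p2 q2 h2] := IHj i.
  rewrite !hornerM !mulf_neq0 // /mdiff h1 h2; split=> //.
  by rewrite invf_div mulf_div.
have root_ne i j : i <> j -> ('X + (Lm ^+ i * B)%:P).[- (Lm ^+ j * B)] != 0.
  move=> ij; rewrite !hornerE addrC subr_eq0.
  by apply/eqP => /(mulIf B0)/injL.
have PQr j i : (PQ j i).1.[- (Lm ^+ (i + j) * B)] = 0 /\
    (PQ j i).2.[- (Lm ^+ (i + j) * B)] != 0 /\
    forall k, (i + j < k)%N -> (PQ j i).1.[- (Lm ^+ k * B)] != 0 /\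
                               (PQ j i).2.[- (Lm ^+ k * B)] != 0.
  elim: j i => [|j IHj] i /=.
    rewrite addn0 hornerD hornerX hornerC addNr hornerC oner_neq0; do !split=> //.
      by apply: root_ne => ik; rewrite ik ltnn in H.
    by rewrite hornerC oner_neq0.
  have [p1 [q1 r1]] := IHj i.+1; have [p2 [q2 r2]] := IHj i.
  rewrite addSnnS in p1 q1 r1.
  have ij : (i + j < i + j.+1)%N by rewrite addnS.
  have [u1 u2] := r2 _ ij.
  rewrite !hornerM p1 mul0r mulf_neq0 //; do !split=> //;
    have [v1 v2] := r1 _ H; have [w1 w2] := r2 _ (ltn_trans ij H);
    by rewrite hornerM mulf_neq0.
have [p0 [q0 _]] := PQr m.+1 0%N.
have hPQ : (PQ m.+1 0%N).1 - (PQ m.+1 0%N).2 = 0.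
  apply: (inf_roots0 inj_T) => k; have [_ q1] := PQt m.+1 0%N k.
  rewrite hit => h.
  by rewrite hornerD hornerN -[X in X - _](divfK q1) -h mul1r subrr.
move/eqP: hPQ; rewrite subr_eq0 => /eqP hPQ.
by rewrite hPQ in p0; rewrite p0 eqxx in q0.
Qed.

(** The parameters are the powers of [l], or of powers of [a] or [b] when [l] has
    finite order, or the integers; if all of these are finite in number, then
    [a] normalizes a finite commutative group that contains [b]. *)
Lemma Heisenberg_commute : GRing.comm a b.
Proof.
suff l1 : l = 1.
  by apply: (cj_id divD a0); rewrite cjb l1 mul1r.
have cXX (x : D) i j : GRing.comm (x ^+ i) (x ^+ j).
  by apply: commr_sym; apply: commrX; apply: commr_sym; apply: commrX.
have [[k k0 lk]|nfl] := pselect (finite_order l); last first.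
  by apply: (Heisenberg_param (infinite_order_inj l0 nfl)) => [i|i|i j] /=;
     [apply: commrX | apply: commrX | apply: cXX].
have cjak i : cj (a ^+ i) b = l ^+ i * b.
  elim: i => [|i IHi]; first by rewrite cj_comm ?oner_eq0 ?mul1r //; apply: commr_sym; apply: commr1.
  by rewrite exprS -(cj_cj divD) ?expD_neq0 // IHi cjlb.
have cjbk i : cj a (b ^+ i) = l ^+ i * b ^+ i.
  by rewrite cjX // cjb exprMn_comm //; apply: commr_sym.
have ca : GRing.comm b (a ^+ k).
  apply: commr_sym; apply: (cj_id divD (expD_neq0 divD k a0)).
  by rewrite cjak lk mul1r.
have cb : GRing.comm a (b ^+ k).
  by apply: (cj_id divD a0); rewrite cjbk lk mul1r.
have fok x : finite_order (x ^+ k) -> finite_order x.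
  by move=> [n n0 h]; exists (k * n)%N; rewrite ?muln_gt0 ?k0 // exprM.
have [[u u0 au]|nfa] := pselect (finite_order a); last first.
  apply: (@Heisenberg_param (fun i => (a ^+ k) ^+ i)) => [|i|i|i j] /=.
  - by apply: infinite_order_inj; [apply: expD_neq0 | move=> /fok].
  - by do 2!apply: commrX.
  - exact: commrX.
  - exact: cXX.
have [[v v0 bv]|nfb] := pselect (finite_order b); last first.
  apply: (@Heisenberg_param (fun i => (b ^+ k) ^+ i)) => [|i|i|i j] /=.
  - by apply: infinite_order_inj; [apply: expD_neq0 | move=> /fok].
  - exact: commrX.
  - by do 2!apply: commrX.
  - exact: cXX.
have [[p cp]|ncp] := pselect (exists p, p \in [pchar D]); last first.
  apply: (@Heisenberg_param (fun i => i%:R)) => [i j|i|i|i j]; try exact: commr_nat.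
  wlog ij : i j / (i <= j)%N.
    by move=> wl h; have [/wl->|/ltnW/wl] := leqP i j => // ->.
  move/eqP; rewrite eq_sym -subr_eq0 -natrB // => /eqP h.
  apply/eqP; rewrite eqn_leq ij -subn_eq0; apply/eqP.
  have [//|n0] := posnP (j - i)%N.
  by case: ncp; apply: (natr0_pchar divD n0 h).
pose s := [seq l ^+ i * b ^+ j | i <- iota 0 k, j <- iota 0 v].
have sP i j : l ^+ i * b ^+ j \in s.
  rewrite -(expr_mod i lk) -(expr_mod j bv).
  by apply: allpairs_f; rewrite mem_iota add0n ltn_mod.
suff cba : GRing.comm b a.
  by rewrite /l cj_comm // (mulDV divD).
apply: (@finite_ext_comm D divD p cp s a u) => //.
- by have := sP 0%N 0%N; rewrite !expr0 mulr1.
- move=> x y /allpairsP[[i j] /= [_ _ ->]] /allpairsP[[i' j'] /= [_ _ ->]].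
  have h : GRing.comm (b ^+ j) (l ^+ i') by apply: commrX; apply: commr_sym; apply: commrX; apply: commr_sym.
  by rewrite -mulrA (mulrA (b ^+ j)) h -!mulrA -exprD !mulrA -exprD.
- move=> x /allpairsP[[i j] /= [_ _ ->]].
  rewrite cjM // cjX // (cj_comm divD a0 cal) cjbk mulrA -exprD; exact: sP.
- by have := sP 0%N 1%N; rewrite expr0 mul1r expr1.
Qed.
End Heisenberg.
End Commutators.

(** * Additive maps and polynomials over a division ring *)

Section IterAdd.
Variables (V : zmodType) (f g : V -> V).
Hypotheses (fD : {morph f : x y / x + y}) (gD : {morph g : x y / x + y}).
Hypothesis fg : forall x, f (g x) = g (f x).

Lemma add_map0 (h : V -> V) : {morph h : x y / x + y} -> h 0 = 0.
Proof. by move=> hD; apply: (addrI (h 0)); rewrite -hD !addr0. Qed.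
Lemma add_mapMn (h : V -> V) n : {morph h : x y / x + y} -> {morph h : x / x *+ n}.
Proof.
move=> hD x; elim: n => [|n IHn]; first by rewrite (add_map0 hD).
by rewrite !mulrS hD IHn.
Qed.
Lemma iter_add_map (h : V -> V) n :
  {morph h : x y / x + y} -> {morph iter n h : x y / x + y}.
Proof. by move=> hD; elim: n => // n IHn x y; rewrite !iterS IHn hD. Qed.
Lemma iter_comm_map n x : f (iter n g x) = iter n g (f x).
Proof. by elim: n x => //= n IHn x; rewrite fg IHn. Qed.

Lemma iter_addE n x :
  iter n (fun y => f y + g y) x
  = \sum_(i < n.+1) iter (n - i) f (iter i g x) *+ 'C(n, i).
Proof.
elim: n => [|n IHn]; first by rewrite big_ord_recl big_ord0 addr0.
rewrite iterS {}IHn (big_morph f fD (add_map0 fD)) (big_morph g gD (add_map0 gD)).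
rewrite [X in X + _]big_ord_recl [X in _ + X]big_ord_recr.
rewrite [RHS]big_ord_recl [X in _ = _ + X]big_ord_recr /=.
rewrite !subn0 !bin0 !binn !subnn !mulr1n /= -addrA; congr (_ + _).
rewrite addrA -big_split; congr (_ + _); apply: eq_bigr => i _ /=.
rewrite (add_mapMn _ fD) (add_mapMn _ gD) /bump /= add1n.
rewrite -!iterS -subSn ?(valP i) // subSS binS mulrnDr; congr (_ + _ *+ _).
have {}gi (k : nat) y : g (iter k f y) = iter k f (g y).
  by elim: k y => //= k IHk y; rewrite -fg IHk.
by rewrite gi.
Qed.

Lemma iter_add_prime p x : prime p -> (forall y : V, y *+ p = 0) ->
  iter p (fun y => f y + g y) x = iter p f x + iter p g x.
Proof.
case: p => [|p] // pp pV.
rewrite iter_addE big_ord_recl big_ord_recr /= ?subn0 ?add0n ?bin0 ?subnn ?binn !mulr1n.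
congr (_ + _); rewrite big1 ?add0r // => i _; rewrite /bump /= add1n.
have /dvdnP[k ->] : (p.+1 %| 'C(p.+1, i.+1))%N.
  by apply: prime_dvd_bin => //=; rewrite ltnS.
by rewrite mulrnA pV.
Qed.
End IterAdd.

Lemma iter_iterM (T : Type) (f : T -> T) m n x : iter (m * n) f x = iter m (iter n f) x.
Proof. by elim: m => //= m IHm; rewrite mulSn iterD IHm. Qed.

(** The Frobenius identity for commuting operators, by iteration of the binomial
    formula at a prime. *)
Lemma iter_add_prime_exp (V : zmodType) (f g : V -> V) p e x :
  {morph f : x y / x + y} -> {morph g : x y / x + y} ->
  (forall x, f (g x) = g (f x)) -> prime p -> (forall y : V, y *+ p = 0) ->
  iter (p ^ e) (fun y => f y + g y) x = iter (p ^ e) f x + iter (p ^ e) g x.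
Proof.
move=> fD gD fg pp pV; elim: e x => [|e IHe] x; first by [].
have hfg y : iter (p ^ e) f (iter (p ^ e) g y) = iter (p ^ e) g (iter (p ^ e) f y).
  have {}fg m : forall z, iter m f (iter (p ^ e) g z) = iter (p ^ e) g (iter m f z).
    by elim: m => //= m IHm z; rewrite IHm (iter_comm_map fg).
  exact: fg.
rewrite expnS !iter_iterM (eq_iter IHe).
by rewrite iter_add_prime //; apply: iter_add_map.
Qed.

Section PolyD.
Variables (D : unitRingType) (divD : GRing.field_axiom D).
Implicit Types (P Q S T : {poly D}) (E : D -> Prop) (t : D).

Lemma polyD_mul_eq0 P Q : P * Q = 0 -> P != 0 -> Q = 0.
Proof.
move=> PQ0 P0; apply/eqP; apply: contraTT isT => Q0.
have l0 : lead_coef P * lead_coef Q != 0 by rewrite (mulD_neq0 divD) ?lead_coef_eq0.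
by move: (lead_coef_proper_mul l0); rewrite PQ0 lead_coef0 => /eqP; rewrite eq_sym (negPf l0).
Qed.
Lemma polyD_mul_neq0 P Q : P != 0 -> Q != 0 -> P * Q != 0.
Proof. by move=> P0 Q0; apply: contra_neq Q0 => /polyD_mul_eq0; apply. Qed.

Lemma inf_rootsD P (t : nat -> D) : injective t ->
  (forall i j, GRing.comm (t i) (t j)) -> (forall i, P.[t i] = 0) -> P = 0.
Proof.
move=> inj_t ct hP; apply/eqP; apply: contraT => P0.
have := @max_ring_poly_roots _ P (mkseq t (size P)) P0.
rewrite size_mkseq ltnn => -> //.
  by apply/allP => x /mapP[i _ ->]; apply/eqP.
rewrite /mkseq; elim: (iota 0 (size P)) (iota_uniq 0 (size P)) => //= i s IHs.
move=> /andP[nis us]; rewrite IHs // andbT; apply/allP => _ /mapP[j sj ->].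
rewrite /diff_roots ct eqxx divD // subr_eq0; apply/eqP => /inj_t ji.
by rewrite -ji sj in nis.
Qed.

Definition pcoefs E P := forall i, E P`_i.

Section Closed.
Variables (E : D -> Prop) (dE : div_closed E).
Lemma pcB P Q : pcoefs E P -> pcoefs E Q -> pcoefs E (P - Q).
Proof. by move=> hP hQ i; rewrite coefB; apply: (dcB dE). Qed.
Lemma pcD P Q : pcoefs E P -> pcoefs E Q -> pcoefs E (P + Q).
Proof. by move=> hP hQ i; rewrite coefD; apply: (dcD dE). Qed.
Lemma pcM P Q : pcoefs E P -> pcoefs E Q -> pcoefs E (P * Q).
Proof. by move=> hP hQ i; rewrite coefM; apply: (dc_sum dE) => j _; apply: (dcM dE). Qed.
Lemma pcC c : E c -> pcoefs E c%:P.
Proof. by move=> Ec i; rewrite coefC; case: eqP => // _; apply: (dc0 dE). Qed.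
Lemma pcXn n : pcoefs E 'X^n.
Proof. by move=> i; rewrite coefXn; case: eqP => _; [apply: (dc1 dE)|apply: (dc0 dE)]. Qed.
Lemma pcX : pcoefs E 'X. Proof. by have := @pcXn 1; rewrite expr1. Qed.
End Closed.

Lemma comm_coefs E P t : pcoefs E P -> (forall e, E e -> GRing.comm e t) -> comm_poly P t.
Proof. by move=> hP ht; apply: comm_coef_poly => i; exact: ht (hP i). Qed.
Lemma hornerM_coefs E P Q t : pcoefs E Q -> (forall e, E e -> GRing.comm e t) ->
  (P * Q).[t] = P.[t] * Q.[t].
Proof. by move=> hQ ht; apply: hornerM_comm; apply: comm_coefs hQ ht. Qed.

(** Euclidean division shows that [D[X]] has the Ore property. *)
Lemma Ore E (dE : div_closed E) P Q : pcoefs E P -> pcoefs E Q ->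
  exists S T, [/\ pcoefs E S, pcoefs E T, (S != 0) || (T != 0) & P * T = Q * S].
Proof.
have [n] := ubnP (size P + size Q).
elim: n P Q => [|n IHn] // P Q; rewrite ltnS => sPQ EP EQ.
wlog sQP : P Q sPQ EP EQ / (size Q <= size P)%N.
  move=> wl; have [|/ltnW sPQ'] := leqP (size Q) (size P); first exact: wl.
  rewrite addnC in sPQ.
  have [S [T [ES ET ST0 h]]] := wl _ _ sPQ EQ EP sPQ'.
  by exists T, S; rewrite orbC.
have [->|Q0] := eqVneq Q 0.
  exists 1, 0; rewrite oner_neq0 mulr0 mul0r; split=> //.
  - exact: (pcC dE (dc1 dE)).
  - by move=> i; rewrite coef0; apply: (dc0 dE).
have P0 : P != 0 by rewrite -size_poly_gt0; apply: leq_trans sQP; rewrite size_poly_gt0.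
have lQ : lead_coef Q != 0 by rewrite lead_coef_eq0.
pose c := (lead_coef Q)^-1 * lead_coef P; pose q := c%:P * 'X^(size P - size Q).
have Eq : pcoefs E q.
  apply: (pcM dE); last exact: pcXn.
  by apply: (pcC dE); apply: (dcM dE); [apply: (dcV dE)|]; rewrite lead_coefE.
have sz : (size (P - Q * q)%R < size P)%N.
  rewrite -(prednK (_ : (0 < size P)%N)) ?size_poly_gt0 // ltnS; apply/leq_sizeP => j hj.
  have [jP|Pj] := ltnP j (size P).
    have -> : j = (size P).-1 by apply/eqP; rewrite eqn_leq hj -ltnS prednK ?size_poly_gt0 // jP.
    rewrite coefB /q mulrA coefMXn coefMC -lead_coefE.
    have -> : ((size P).-1 < size P - size Q)%N = false.
      by apply/negbTE; rewrite -leqNgt -subn1 leq_sub2l // size_poly_gt0.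
    rewrite (_ : ((size P).-1 - (size P - size Q) = (size Q).-1)%N); last first.
      by rewrite -subn1 subnAC subKn // subn1.
    by rewrite -lead_coefE /c (mulVKD divD) // subrr.
  rewrite coefB nth_default // /q mulrA coefMXn coefMC; case: ltnP => _; rewrite ?subr0 //.
  rewrite [Q`__]nth_default ?mul0r ?subr0 //.
  by rewrite -{1}(subKn sQP) leq_sub2r.
have EPq : pcoefs E (P - Q * q) by apply: (pcB dE) => //; apply: (pcM dE).
have [|S [T [ES ET ST0 h]]] := IHn (P - Q * q) Q _ EPq EQ.
  by apply: leq_trans sPQ; rewrite ltn_add2r.
exists (q * T + S), T; split=> //.
- by apply: (pcD dE) => //; apply: (pcM dE).
- have [T0|] := eqVneq T 0; last by rewrite orbT.
  by move: ST0; rewrite T0 eqxx orbF mulr0 add0r => ->.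
- by move: h; rewrite mulrBl mulrDr !mulrA => /eqP; rewrite subr_eq addrC => /eqP.
Qed.

(** A common right multiple can be normalized by cancelling powers of [X]. *)
Lemma Ore1 E (dE : div_closed E) P Q : pcoefs E P -> pcoefs E Q ->
  P`_0 = 1 -> Q`_0 = 1 ->
  exists S T, [/\ pcoefs E S, pcoefs E T, S`_0 = 1, T`_0 = 1 & P * T = Q * S].
Proof.
move=> EP EQ P1 Q1; have P0 : P != 0.
  by apply: contraTneq isT => P0; move/eqP: P1; rewrite P0 coef0 eq_sym oner_eq0.
have Q0 : Q != 0.
  by apply: contraTneq isT => Q0; move/eqP: Q1; rewrite Q0 coef0 eq_sym oner_eq0.
have [S [T [ES ET ST0 h]]] := Ore dE EP EQ.
have {ST0} T0 : T != 0.
  case/orP: ST0 => // S0; have := polyD_mul_neq0 Q0 S0; rewrite -h.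
  by apply: contra_neq => ->; rewrite mulr0.
have [n] := ubnP (size T); elim: n S T ES ET h T0 => // n IHn S T ES ET h T0 sT.
have ST : S`_0 = T`_0.
  by have /(congr1 (fun P : {poly D} => P`_0)) := h; rewrite !coef0M P1 Q1 !mul1r.
have [T00|T00] := eqVneq T`_0 0.
  pose dX (R : {poly D}) := \poly_(i < (size R).-1) R`_i.+1.
  have dXE (R : {poly D}) : R`_0 = 0 -> R = dX R * 'X.
    move=> R0; apply/polyP => i; rewrite coefMX coef_poly; case: i => [|i] //=.
    case: ltnP => // hi; rewrite nth_default //; case: (size R) hi => //.
  have EdX (R : {poly D}) : pcoefs E R -> pcoefs E (dX R).
    by move=> ER i; rewrite coef_poly; case: ltnP => _; [apply: ER | apply: (dc0 dE)].
  have hT := dXE T T00; have hS := dXE S (etrans ST T00).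
  have XI (A B : {poly D}) : A * 'X = B * 'X -> A = B.
    by move=> hAB; apply/polyP=> i; have := coefMX A i.+1; rewrite hAB coefMX.
  apply: (IHn (dX S) (dX T)); try exact: EdX.
  - by apply: XI; rewrite -!mulrA -hT -hS.
  - by apply: contra_neq T0 => dT0; rewrite hT dT0 mul0r.
  - apply: leq_ltn_trans (size_poly _ _) _.
    by move: sT; rewrite -(prednK (_ : (0 < size T)%N)) ?size_poly_gt0.
pose c := (T`_0)^-1; have Ec : E c by apply: (dcV dE).
exists (S * c%:P), (T * c%:P); rewrite !coefMC ST (mulDV divD) // !mulrA h.
by split=> //; apply: (pcM dE) => //; apply: (pcC dE).
Qed.

Definition pcj (a : D) P : {poly D} := a%:P * P * (a^-1)%:P.
Lemma coef_pcj a P i : (pcj a P)`_i = cj a P`_i.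
Proof. by rewrite coefMC coefCM. Qed.
Lemma pcj_coefs E (dE : div_closed E) a P : E a -> pcoefs E P -> pcoefs E (pcj a P).
Proof. by move=> Ea EP i; rewrite coef_pcj; apply: (dc_cj dE). Qed.
Lemma horner_pcj a P t : GRing.comm a t -> (pcj a P).[t] = cj a P.[t].
Proof.
move=> cat; rewrite /pcj hornerM_comm; last first.
  by rewrite /comm_poly hornerC; apply: commrV; apply: commr_sym.
by rewrite hornerCM hornerC.
Qed.
Lemma coefM1 P Q : (P * Q)`_1 = P`_0 * Q`_1 + P`_1 * Q`_0.
Proof. by rewrite coefM !big_ord_recl big_ord0 addr0. Qed.

Definition dcj (a x : D) := cj a x - x.

(** The iterated commutators of [p] with [1 + z t], for a parameter [t] that
    commutes with everything in sight, are the values at [t] of fractions of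
    polynomials whose expansion at 0 is [1 + (Ad p - 1)^j z t + ...]. *)
Lemma itc_fraction E (dE : div_closed E) p z j : p != 0 -> E p -> E z ->
  exists P Q B, [/\ [/\ pcoefs E P, pcoefs E Q & pcoefs E B],
    B != 0, P`_0 = 1 /\ Q`_0 = 1, P`_1 - Q`_1 = iter j (dcj p) z
  & forall t, (forall e, E e -> GRing.comm e t) -> B.[t] != 0 ->
      [/\ 1 + z * t != 0, P.[t] != 0, Q.[t] != 0 &
          itc p (1 + z * t) j = P.[t] * (Q.[t])^-1]].
Proof.
move=> p0 Ep Ez; elim: j => [|j [P [Q [B [[EP EQ EB] B0 [P1 Q1] hPQ ht]]]]].
  have EX : pcoefs E (1 + z%:P * 'X).
    apply: (pcD dE); first exact: (pcC dE (dc1 dE)).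
    by apply: (pcM dE); [apply: (pcC dE) | apply: (pcX dE)].
  have c0 : (1 + z%:P * 'X)`_0 = 1 by rewrite coefD coefMX coef1 addr0.
  exists (1 + z%:P * 'X), 1, (1 + z%:P * 'X); split=> //.
  - by split=> //; exact: (pcC dE (dc1 dE)).
  - apply: contraTneq isT => h; move: c0; rewrite h coef0 => /eqP.
    by rewrite eq_sym oner_eq0.
  - by rewrite c0 coef1.
  - by rewrite coefD coefMX coefC !coef1 /= add0r subr0.
  - move=> t ct; rewrite hornerD hornerMX !hornerC => h.
    by split=> //; rewrite ?oner_neq0 ?invr1 ?mulr1.
have hcj R : pcoefs E R -> R`_0 = 1 -> exists R' : {poly D},
    [/\ pcoefs E R', R'`_0 = 1, R'`_1 = cj p R`_1
      & forall t, GRing.comm p t -> R'.[t] = cj p R.[t]].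
  move=> ER R1; exists (pcj p R); rewrite !coef_pcj R1 cj1 //.
  by split=> // [|t]; [exact: pcj_coefs | exact: horner_pcj].
have [Pp [EPp Pp1 hPp htP]] := hcj P EP P1.
have [Qp [EQp Qp1 hQp htQ]] := hcj Q EQ Q1.
have [S [T [ES ET S1 T1 hST]]] := Ore1 dE EQ EQp Q1 Qp1.
have S0 : S != 0.
  by apply: contraTneq isT => h; move/eqP: S1; rewrite h coef0 eq_sym oner_eq0.
have T0 : T != 0.
  by apply: contraTneq isT => h; move/eqP: T1; rewrite h coef0 eq_sym oner_eq0.
have EST := pcM dE ES ET.
exists (Pp * S), (P * T), (B * (S * T)); split.
- by split; [exact: (pcM dE) | exact: (pcM dE) | exact: (pcM dE)].
- by apply: polyD_mul_neq0 => //; apply: polyD_mul_neq0.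
- by rewrite !coef0M Pp1 P1 S1 T1 mulr1.
- have := congr1 (fun R : {poly D} => R`_1) hST.
  rewrite !coefM1 hPp hQp P1 Q1 Pp1 Qp1 S1 T1 !mulr1 !mul1r iterS -hPQ /dcj => h.
  rewrite cjB; have -> : S`_1 = T`_1 + Q`_1 - cj p Q`_1 by rewrite h addrK.
  by ncr.
- move=> t ct; have cpt := ct _ Ep.
  rewrite (hornerM_coefs B EST ct) (hornerM_coefs S ET ct) (hornerM_coefs Pp ES ct).
  rewrite (hornerM_coefs P ET ct) !(mulD_eq0 divD) !negb_or.
  move=> /andP[Bt /andP[St Tt]]; have [z0 Pt Qt hj] := ht t ct Bt.
  have cPt : cj p P.[t] != 0 by rewrite cj_neq0.
  have cQt : cj p Q.[t] != 0 by rewrite cj_neq0.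
  rewrite htP // cPt Pt St Tt; split=> //=.
  have iQt : (Q.[t])^-1 != 0 by rewrite (invD_eq0 Q.[t]).
  rewrite hj cjM // cjV // (invMD divD Pt Tt) (invMD divD Pt iQt) invrK.
  have : Q.[t] * T.[t] = cj p Q.[t] * S.[t].
    by rewrite -(hornerM_coefs Q ET ct) hST (hornerM_coefs Qp ES ct) htQ.
  move: (cj p P.[t]) (cj p Q.[t]) cPt cQt => cP cQ cPt cQt h.
  rewrite -!mulrA; congr (_ * _).
  apply: (mulDI divD cQt); rewrite (mulVKD divD) // mulrA -h -mulrA.
  by rewrite (mulVKD divD).
Qed.

End PolyD.

(** * Commuting subnormal subgroups *)

Lemma infinite_sequence (T : choiceType) (Z : T -> Prop) :
  (exists s : seq T, forall x, Z x -> x \in s) \/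
  (exists2 t : nat -> T, injective t & forall i, Z (t i)).
Proof.
have [|nfin] := pselect (exists s : seq T, forall x, Z x -> x \in s); first by left.
right; have hg (s : seq T) : {x | Z x & x \notin s}.
  apply: cid2; apply: contrapT => h; apply: nfin; exists s => x Zx.
  by apply/negPn/negP => xs; apply: h; exists x.
pose g s := s2val (hg s); pose l := fix l n := if n is n'.+1 then g (l n') :: l n' else [::].
have lg m n : (m < n)%N -> g (l m) \in l n.
  elim: n => // n IHn; rewrite ltnS leq_eqVlt inE => /orP[/eqP->|/IHn->].
    by rewrite eqxx.
  by rewrite orbT.
exists (fun n => g (l n)) => [m n|n]; last exact: (s2valP (hg (l n))).
have ng n' : g (l n') \notin l n' by apply: (s2valP' (hg (l n'))).
wlog mn : m n / (m <= n)%N.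
  by move=> wl h; have [/wl->|/ltnW/wl] := leqP m n => // ->.
move=> h; apply/eqP; move: mn; rewrite leq_eqVlt => /orP[//|/lg].
by rewrite h (negPf (ng n)).
Qed.

Section Pairs.
Variables (D : unitRingType) (divD : GRing.field_axiom D).
Implicit Types (a b x y z u v w : D) (H K E : D -> Prop).

Lemma nat_inj_pchar :
  (exists p, p \in [pchar D]) \/ injective (fun n => n%:R : D).
Proof.
have [|ncp] := pselect (exists p, p \in [pchar D]); first by left.
right=> i j; wlog ij : i j / (i <= j)%N.
  by move=> wl h; have [/wl->|/ltnW/wl] := leqP i j => // ->.
move/eqP; rewrite eq_sym -subr_eq0 -natrB // => /eqP h.
apply/eqP; rewrite eqn_leq ij -subn_eq0; apply/eqP.
have [//|n0] := posnP (j - i)%N.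
by case: ncp; apply: (natr0_pchar divD n0 h).
Qed.

Lemma dcjD p x y : dcj p (x + y) = dcj p x + dcj p y.
Proof. by rewrite /dcj cjD opprD addrACA. Qed.

Lemma iter_dcj_prime_exp l e p x : l \in [pchar D] -> p != 0 ->
  iter (l ^ e) (dcj p) x = cj (p ^+ (l ^ e)) x - x.
Proof.
move=> cl p0; have pl := pcharf_prime cl.
have h := @iter_add_prime_exp D (cj p) (fun y => - y) l e x.
have -> : iter (l ^ e) (dcj p) x = iter (l ^ e) (fun y => cj p y - y) x by [].
rewrite h //; first last.
- by move=> y; rewrite (mulrn_pchar cl).
- by move=> y; rewrite cjN.
- by move=> y z; rewrite opprD.
- by move=> y z; rewrite cjD.
congr (_ + _).
  elim: (l ^ e)%N => [|n IHn]; first by rewrite cj_comm ?oner_neq0 //; apply: commr_sym; apply: commr1.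
  by rewrite iterS IHn (cj_cj divD) ?expD_neq0 // -exprS.
have odd1 : (-1) ^+ (l ^ e) = -1 :> D by apply: (pchar_odd_exp cl).
have -> n : iter n (fun y => - y) x = (-1) ^+ n * x.
  by elim: n => [|n IHn]; rewrite ?mul1r // iterS IHn exprS mulN1r mulNr.
by rewrite odd1 mulN1r.
Qed.

(** The quotient of the last two vectors of a Jordan chain of [Ad p]. *)
Lemma translated_element E (dE : div_closed E) p u n : p != 0 -> E p -> E u ->
  dcj p u != 0 -> iter n (dcj p) u = 0 -> exists2 x, E x & cj p x = x + 1.
Proof.
move=> p0 Ep; elim: n u => [|n IHn] u Eu du hn.
  by move: du; rewrite [u]hn /dcj cj0 subrr eqxx.
have Ed : E (dcj p u) by apply: (dcB dE) => //; apply: (dc_cj dE).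
have [d2|d2] := eqVneq (dcj p (dcj p u)) 0; last first.
  by apply: (IHn (dcj p u)); rewrite // -iterSr.
exists (u * (dcj p u)^-1); first by apply: (dcM dE) => //; apply: (dcV dE).
rewrite cjM // cjV //.
have -> : cj p (dcj p u) = dcj p u by apply/eqP; rewrite -subr_eq0; apply/eqP.
have -> : cj p u = u + dcj p u by rewrite /dcj addrC subrK.
by rewrite mulrDl (mulDV divD).
Qed.

(** If [Ad p] translates [x] by 1 and [(Ad p - 1)^(m+1)] vanishes, then the
    Leibniz rule reads
    [0 = (Ad p - 1)^(m+1) (x g) = (m + 1) Ad p ((Ad p - 1)^m g)]. *)
Lemma unipotent_pchar E (dE : div_closed E) p n : p != 0 -> E p ->
  (forall u, E u -> iter n (dcj p) u = 0) -> (exists2 u, E u & dcj p u != 0) ->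
  exists l, l \in [pchar D].
Proof.
move=> p0 Ep hn [u Eu du].
have [x Ex hx] := translated_element dE p0 Ep Eu du (hn u Eu).
have [m [hm [g Eg gm]]] : exists m, (forall u, E u -> iter m.+1 (dcj p) u = 0) /\
    exists2 g, E g & iter m (dcj p) g != 0.
  elim: n hn => [|n IHn] hn; first by move: du; rewrite [u](hn u Eu) /dcj cj0 subrr eqxx.
  have [h|h] := pselect (forall u, E u -> iter n (dcj p) u = 0); first exact: IHn.
  exists n; split=> //; apply: contrapT => h'; apply: h => v Ev.
  by apply/eqP/negPn/negP => hv; apply: h'; exists v.
have hj j : iter j.+1 (dcj p) (x * g)
            = x * iter j.+1 (dcj p) g + cj p (iter j (dcj p) g) *+ j.+1.
  elim: j => [|j IHj].
    by rewrite /= /dcj cjM // hx; ncr.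
  rewrite iterS IHj dcjD [in RHS]iterS.
  set A := iter j.+1 _ g; set B := iter j _ g.
  have -> : dcj p (x * A) = x * dcj p A + cj p A by rewrite /dcj cjM // hx; ncr.
  have -> : dcj p (cj p B *+ j.+1) = cj p A *+ j.+1.
    rewrite /A iterS -/B; elim: (j.+1) => [|k IHk]; first by rewrite !mulr0n /dcj cj0 subrr.
    by rewrite !mulrS dcjD IHk; congr (_ + _); rewrite /dcj cjB.
  by rewrite [in RHS]mulrS addrA.
have := hj m; rewrite !hm //; last exact: (dcM dE).
rewrite mulr0 add0r -mulr_natl => /eqP; rewrite eq_sym (mulD_eq0 divD).
rewrite (negPf (cj_neq0 divD p0 gm)) orbF => /eqP h.
exact: (natr0_pchar divD _ h).
Qed.

(** If [v^(l^e)] is central, then [Ad v - 1] is nilpotent, so [v] translates some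
    [x] by 1, hence also [x^(l^e)], which is central too. *)
Lemma central_exponent_comm E (dE : div_closed E) l e : l \in [pchar D] ->
  (forall x y, E x -> E y -> GRing.comm (x ^+ (l ^ e)) y) ->
  forall x y, E x -> E y -> GRing.comm x y.
Proof.
move=> cl hE v w Ev Ew.
have [->|v0] := eqVneq v 0; first by apply: commr_sym; apply: commr0.
have [h|dw] := eqVneq (dcj v w) 0.
  by apply: (cj_id divD v0); apply/eqP; rewrite -subr_eq0; apply/eqP.
have hn : iter (l ^ e) (dcj v) w = 0.
  rewrite iter_dcj_prime_exp // cj_comm ?expD_neq0 ?subrr //; exact: hE.
have [x Ex hx] := translated_element dE v0 Ev Ew dw hn.
have := hE x v Ex Ev; move/(commr_sym)/(cj_comm divD v0).
rewrite cjX // hx (exprD_pchar cl); last exact: commr1.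
rewrite expr1n => /eqP; rewrite -subr_eq0 addrC addKr.
by rewrite oner_eq0.
Qed.

Section Transcendental.
Variables (E1 E2 : D -> Prop) (dE1 : div_closed E1) (dE2 : div_closed E2).
Hypothesis cE21 : forall x, E2 x <-> centr E1 x.
Variables (s : seq D) (hs : forall x, E1 x /\ E2 x -> x \in s).

(** The minimal polynomial over [E1] of an element of [E2] has its coefficients
    in the common center of [E1] and [E2]; if this center is finite, then the
    element has finitely many powers. *)
Lemma transcendental_of_finite_center v (P : {poly D}) : E2 v -> v != 0 ->
  ~ finite_order v -> pcoefs E1 P -> P.[v] = 0 -> P = 0.
Proof.
move=> Ev v0 nfv EP Pv; apply: contrapT => /eqP P0.
pose A n := `[< exists Q, [/\ pcoefs E1 Q, Q.[v] = 0, Q != 0 & size Q = n] >].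
have exA : exists n, A n by exists (size P); apply/asboolP; exists P.
case: (ex_minnP exA) => {exA P EP Pv P0}n /asboolP[P [EP Pv P0 sP]] minP.
have cv e : E1 e -> GRing.comm e v by move=> Ee; apply: (iffLR (cE21 v) Ev).
wlog lP : P EP Pv P0 sP / lead_coef P = 1.
  move=> wl; have l0 : lead_coef P != 0 by rewrite lead_coef_eq0.
  have li0 : (lead_coef P)^-1 != 0 by rewrite (invD_eq0 (lead_coef P)).
  have El : E1 (lead_coef P)^-1 by rewrite lead_coefE; apply: (dcV dE1).
  have sz : size ((lead_coef P)^-1%:P * P) = size P.
    rewrite size_proper_mul ?size_polyC ?li0 //.
    by rewrite lead_coefC (mulVD divD) ?oner_neq0.
  apply: (wl ((lead_coef P)^-1%:P * P)).
  - by apply: (pcM dE1) => //; apply: (pcC dE1).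
  - by rewrite hornerCM Pv mulr0.
  - by rewrite -size_poly_eq0 sz size_poly_eq0.
  - by rewrite sz.
  - by rewrite lead_coefE sz coefCM -lead_coefE (mulVD divD).
have cP i : E2 P`_i.
  apply/cE21 => e Ee; apply: contrapT => ne.
  pose Q := e%:P * P - P * e%:P.
  have cQ j : Q`_j = e * P`_j - P`_j * e by rewrite coefB coefCM coefMC.
  have Q0 : Q != 0.
    apply: contra_notN ne => /eqP Q0; apply/eqP; rewrite -subr_eq0 -cQ Q0 coef0 //.
  have EQ : pcoefs E1 Q.
    by apply: (pcB dE1); apply: (pcM dE1) => //; apply: (pcC dE1).
  have Qv : Q.[v] = 0.
    rewrite hornerD hornerN hornerCM Pv mulr0.
    by rewrite (hornerM_coefs P (pcC dE1 Ee) cv) Pv mul0r subrr.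
  have : (size Q < n)%N.
    rewrite -sP -(prednK (_ : (0 < size P)%N)) ?size_poly_gt0 // ltnS.
    apply/leq_sizeP => j hj; rewrite cQ; have [jP|Pj] := ltnP j (size P).
      have -> : j = (size P).-1.
        by apply/eqP; rewrite eqn_leq hj -ltnS prednK ?size_poly_gt0 // jP.
      by rewrite -lead_coefE lP mulr1 mul1r subrr.
    by rewrite nth_default // mulr0 mul0r subrr.
  rewrite ltnNge => /negP; apply; apply: minP; apply/asboolP.
  by exists Q.
have n1 : (1 < n)%N.
  rewrite -sP ltnNge; apply/negP => /size1_polyC hP; move: Pv P0.
  by rewrite hP hornerC => ->; rewrite polyC0 eqxx.
pose d := n.-1; have d0 : (0 < d)%N by rewrite /d -ltnS prednK // ltnW.
pose Z x := E1 x /\ E2 x.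
have dZ : div_closed Z.
  split=> [|x y [? ?] [? ?]|x y [? ?] [? ?]|x [? ?]]; split.
  - exact: (dc1 dE1). - exact: (dc1 dE2).
  - exact: (dcB dE1). - exact: (dcB dE2).
  - exact: (dcM dE1). - exact: (dcM dE2).
  - exact: (dcV dE1). - exact: (dcV dE2).
have ZP i : Z P`_i by split.
have vd : v ^+ d = - \sum_(i < d) P`_i * v ^+ i.
  apply/eqP; rewrite -addr_eq0 addrC -[X in _ + X]mul1r -lP lead_coefE sP -/d.
  have := Pv; rewrite horner_coef sP -(prednK (ltnW n1)) big_ord_recr /= => /eqP.
  by [].
have hW k : exists c : nat -> D, (forall i, Z (c i)) /\ v ^+ k = \sum_(i < d) c i * v ^+ i.
  elim: k => [|k [c [Zc hk]]].
    exists (fun i => (i == 0)%N%:R); split=> [i|].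
      by case: eqP => _; [apply: (dc1 dZ)|apply: (dc0 dZ)].
    rewrite -(prednK d0) big_ord_recl /= mul1r expr0 big1 ?addr0 // => i _.
    by rewrite mul0r.
  exists (fun i => (if i is i'.+1 then c i' else 0) - c d.-1 * P`_i); split=> [i|].
    apply: (dcB dZ); last exact: (dcM dZ).
    by case: i => [|i]; [apply: (dc0 dZ)|].
  under eq_bigr do rewrite mulrBl.
  rewrite big_split /= sumrN.
  under [X in _ - X]eq_bigr do rewrite -mulrA.
  rewrite -mulr_sumr -mulrN -vd exprSr hk mulr_suml -(prednK d0) big_ord_recr.
  rewrite [X in _ = X + _]big_ord_recl /= mul0r add0r; congr (_ + _).
    by apply: eq_bigr => i _; rewrite /bump /= add1n -mulrA -exprSr.
  by rewrite -mulrA -exprSr.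
apply: nfv; have [c hc] := choice hW.
pose f (k : 'I_(#|{ffun 'I_d -> 'I_(size s).+1}|.+1)) : {ffun 'I_d -> 'I_(size s).+1} :=
  [ffun i : 'I_d => inord (index (c k i) s)].
have /injectivePn[k [m nkm fkm]] : ~~ injectiveb f.
  by apply/injectiveP => /leq_card; rewrite card_ord ltnn.
have hkm : v ^+ k = v ^+ m.
  rewrite (hc k).2 (hc m).2; apply: eq_bigr => i _; congr (_ * _).
  have /(congr1 (@nat_of_ord _)) := congr1 (fun g : {ffun _ -> _} => g i) fkm.
  rewrite !ffunE !inordK ?ltnS ?index_size // => h.
  have ck := hs ((hc k).1 i); have cm := hs ((hc m).1 i).
  by rewrite -(nth_index 0 ck) h nth_index.
apply: contrapT => nf; have := infinite_order_inj divD v0 nf hkm.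
by move/val_inj => h; rewrite h eqxx in nkm.
Qed.
End Transcendental.

(** The iterated commutators of [p] with arbitrary units lie in [H], hence
    commute with [centr H]. Applied to [1 + z t] for a parameter [t], this makes
    [Ad p - 1] nilpotent on the double centralizer of [H]; so the characteristic
    is some [l] and [p] translates some [x] by 1. Applied to [t + x] for [t] in
    [centr H], it makes the powers of [t] with a fixed exponent [l^r] central in
    [centr H]. *)
Lemma subnormal_centralizer_comm r H p u v w : subn r H -> H p -> H u ->
  ~ GRing.comm p u -> centr H v -> centr H w -> GRing.comm v w.
Proof.
move=> sH Hp Hu npu Cv Cw; apply: contrapT => nvw.
pose E2 := centr H; pose E1 := centr E2.
have dE1 : div_closed E1 := centr_div_closed _.
have dE2 : div_closed E2 := centr_div_closed _.
have HE x : H x -> E1 x by apply: sub_centr2.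
have p0 : p != 0 := subn_neq0 divD sH Hp.
have cE12 e f : E1 e -> E2 f -> GRing.comm e f.
  by move=> Ee Ef; apply: commr_sym; apply: (Ee f Ef).
have E1p := HE p Hp; have E1u := HE u Hu.
have cE2 : forall e, E2 e <-> centr E1 e.
  by move=> e; split=> h; [move=> x Ex; apply: cE12 | move=> x /HE/h].
have du : dcj p u != 0.
  apply/negP; rewrite subr_eq0 => /eqP h; apply: npu; exact: (cj_id divD p0).
(* the first order terms of the iterated commutators with 1 + u v *)
have unip z : E1 z -> iter r (dcj p) z = 0.
  move=> Ez.
  have [[s hs]|[t inj_t Zt]] := infinite_sequence (fun x => E1 x /\ E2 x); last first.
    pose E := centr (fun x => exists i, x = t i).
    have dE : div_closed E := centr_div_closed _.
    have EE1 x : E1 x -> E x.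
      by move=> Ex _ [i ->]; apply: commr_sym; apply: cE12 => //; case: (Zt i).
    have EE2 x : E2 x -> E x.
      by move=> Ex _ [i ->]; apply: cE12 => //; case: (Zt i).
    have cEt i e : E e -> GRing.comm e (t i).
      by move=> Ee; apply: commr_sym; apply: Ee; exists i.
    have ctt i j : GRing.comm (t i) (t j).
      by apply: cE12; [case: (Zt i) | case: (Zt j)].
    have w0 : w != 0.
      by apply: contra_notN nvw => /eqP->; apply: commr0.
    have Ezv : E (z * v) by apply: (dcM dE); [apply: EE1 | apply: EE2].
    have [P [Q [B [[EP EQ EB] B0 [P1 Q1] hPQ ht]]]] :=
      itc_fraction divD dE r p0 (EE1 _ E1p) Ezv.
    have EQw := pcj_coefs dE (EE2 _ Cw) EQ.
    have Qw1 : (pcj w Q)`_0 = 1 by rewrite coef_pcj Q1 cj1.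
    have [S [T [ES ET S1 T1 hST]]] := Ore1 divD dE EQ EQw Q1 Qw1.
    have hG : pcj w P * S - P * T = 0.
      apply: (polyD_mul_eq0 divD (_ : B * _ = 0) B0).
      have EG : pcoefs E (pcj w P * S - P * T).
        apply: (pcB dE); apply: (pcM dE) => //.
        exact: (pcj_coefs dE (EE2 _ Cw) EP).
      apply: (inf_rootsD divD inj_t ctt) => i.
      rewrite (hornerM_coefs B EG (cEt i)).
      have [->|Bt] := eqVneq B.[t i] 0; first by rewrite mul0r.
      have [z0 Pt Qt hr] := ht _ (cEt i) Bt.
      have cwt : GRing.comm w (t i) by apply: cEt; apply: EE2.
      have Hr := itc_subn divD sH Hp z0.
      have cw : cj w (P.[t i] * (Q.[t i])^-1) = P.[t i] * (Q.[t i])^-1.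
        by rewrite -hr; apply: (cj_comm divD w0); apply: commr_sym; apply: Cw.
      rewrite hornerD hornerN (hornerM_coefs _ ES (cEt i)) (hornerM_coefs _ ET (cEt i)).
      rewrite horner_pcj //; suff -> : cj w P.[t i] * S.[t i] = P.[t i] * T.[t i].
        by rewrite subrr mulr0.
      have hq : Q.[t i] * T.[t i] = cj w Q.[t i] * S.[t i].
        by rewrite -(hornerM_coefs _ ET (cEt i)) hST (hornerM_coefs _ ES (cEt i)) horner_pcj.
      have -> : P.[t i] * T.[t i] = P.[t i] * (Q.[t i])^-1 * (Q.[t i] * T.[t i]).
        by rewrite mulrA (mulDVK divD).
      rewrite hq -cw cjM // cjV // mulrA (mulDVK divD) //.
      exact: cj_neq0.
    move/eqP: hG; rewrite subr_eq0 => /eqP hG.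
    have hS : (P * T)`_1 = cj w P`_1 + S`_1.
      by rewrite -hG coefM1 !coef_pcj P1 cj1 // S1 mulr1 mul1r addrC.
    have hT : (Q * T)`_1 = cj w Q`_1 + S`_1.
      by rewrite hST coefM1 !coef_pcj Q1 cj1 // S1 mulr1 mul1r addrC.
    move: hS hT; rewrite !coefM1 P1 Q1 T1 !mulr1 !mul1r => hS hT.
    have hw : cj w (P`_1 - Q`_1) = P`_1 - Q`_1.
      have -> : cj w (P`_1 - Q`_1) = (cj w P`_1 + S`_1) - (cj w Q`_1 + S`_1).
        by rewrite cjB; ncr.
      by rewrite -hS -hT; ncr.
    have hzv : iter r (dcj p) (z * v) = iter r (dcj p) z * v.
      elim: r {sH ht hPQ} => // k IHk; rewrite !iterS IHk.
      rewrite {1}/dcj cjM // (cj_comm divD p0 (_ : GRing.comm p v)) -?mulrBl //.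
      exact: cE12.
    have Ed : E1 (iter r (dcj p) z).
      elim: r {sH ht hPQ hzv} => // k IHk; apply: (dcB dE1) => //; exact: (dc_cj dE1).
    move: hw; rewrite hPQ hzv => /(cj_id divD w0); set d := iter r _ z => hd.
    apply/eqP; apply: contraT => d0; case: nvw.
    have cdw : d * w = w * d := cE12 _ _ Ed Cw.
    have {}hd : w * (d * v) = d * v * w := hd.
    by apply: (mulDI divD d0); rewrite mulrA -hd mulrA -cdw mulrA.
  have [l cl] : exists l, l \in [pchar D].
    have [//|inj_nat] := nat_inj_pchar.
    have sub : {subset mkseq (fun n => n%:R : D) (size s).+1 <= s}.
      move=> y /mapP[n _ ->]; apply: hs.
      by split; [apply: (dc_nat dE1) | apply: (dc_nat dE2)].
    by have := uniq_leq_size (mkseq_uniq _ inj_nat) sub; rewrite size_mkseq ltnn.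
  have [t Et nt] : exists2 t, E2 t & ~ tor l t.
    apply: contrapT => h; apply: nvw; apply: (torsion_comm divD cl dE2) => // x Ex.
    by apply: contrapT => nx; apply: h; exists x.
  have t0 : t != 0 by apply: contra_notN nt => /eqP->; apply: (tor0 cl).
  have nft : ~ finite_order t by move=> [n n0 /(exp_eq1_tor divD cl n0)].
  have trans := transcendental_of_finite_center dE1 dE2 cE2 hs Et t0 nft.
  have ct e : E1 e -> GRing.comm e t by move=> Ee; apply: cE12.
  have [P [Q [B [[EP EQ EB] B0 [P1 Q1] hPQ ht]]]] := itc_fraction divD dE1 r p0 E1p Ez.
  have Bt : B.[t] != 0 by apply: contra_neq B0; apply: trans.
  have [z0 Pt Qt hr] := ht t ct Bt.
  have Ek := HE _ (itc_subn divD sH Hp z0); move: (itc _ _ _) Ek hr => k Ek hr.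
  have hk : P - k%:P * Q = 0.
    apply: trans; first by apply: (pcB dE1) => //; apply: (pcM dE1) => //; apply: (pcC dE1).
    by rewrite hornerD hornerN hornerCM hr (mulDVK divD) // subrr.
  have hki i : P`_i = k * Q`_i.
    by apply/eqP; rewrite -subr_eq0 -coefCM -coefB hk coef0.
  have k1 : k = 1 by have := hki 0%N; rewrite P1 Q1 mulr1.
  by rewrite -hPQ hki k1 mul1r subrr.
have [l cl] : exists l, l \in [pchar D].
  by apply: (unipotent_pchar dE1 p0 E1p unip); exists u.
have [x Ex hx] := translated_element dE1 p0 E1p E1u du (unip u E1u).
apply: nvw; apply: (central_exponent_comm dE2 (e := r) cl _ Cv Cw) => {v w Cv Cw} t e Et Ee.
(* the iterated commutators with t + x stay in a field on which p acts with order l *)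
have cE2E1 f : E1 f -> GRing.comm f e by move=> Ef; apply: cE12.
have ctx : GRing.comm t x by apply: commr_sym; apply: cE12.
pose S y := y = t \/ y = x.
have comS : commuting S by move=> _ _ [->|->] [->|->] //; apply: commr_sym.
pose L : fieldType := bfield divD comS.
have St : t \in bicent S by apply: mem_bfield; left.
have Sx : x \in bicent S by apply: mem_bfield; right.
pose T : L := BField divD comS St; pose X : L := BField divD comS Sx.
pose Y i : L := T + X + i%:R.
have hY i : cj p (bval (Y i)) = bval (Y i.+1).
  rewrite /Y !bvalD !bval_nat !cjD /= hx.
  rewrite (cj_comm divD p0 (cE12 _ _ E1p Et)) (cj_comm divD p0 (commr_nat _ _)).
  by rewrite -natr1; ncr.
have [[i Yi]|Y0] := pselect (exists i, Y i = 0).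
  have -> : t = - (x + i%:R).
    move/(congr1 (@bval _ _ _ _)): Yi; rewrite /Y !bvalD bval_nat bval0 /= => h.
    by apply/eqP; rewrite -addr_eq0 addrA h.
  apply: cE2E1; apply: (dcX dE1); apply: (dcN dE1); apply: (dcD dE1) => //.
  exact: (dc_nat dE1).
have {}Y0 i : Y i != 0 by apply: contra_notN Y0 => /eqP h; exists i.
pose G (y : L) := GRing.comm (bval y) e.
have G1 : G 1 by rewrite /G bval1; apply: commr_sym; apply: commr1.
have GM (y z : L) : G y -> G z -> G (y * z).
  by rewrite /G bvalM => hy hz; apply: commr_sym; apply: commrM; apply: commr_sym.
have GV (y : L) : G y -> G y^-1.
  by rewrite /G bvalV => hy; apply: commr_sym; apply: commrV; apply: commr_sym.
have Yl i : Y (i + l)%N = Y i.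
  by apply: bval_inj; rewrite /Y !bvalD !bval_nat natrD (pcharf0 cl) addr0.
have hG i : G (iter r.+1 (@mdiff _) Y i).
  have y0 : bval (Y i) != 0 by rewrite bval_eq0.
  rewrite /G -(itc_mdiff r.+1 p0 Y0 hY) /=; apply: cE2E1; apply: HE.
  have hH := subn_subgroup divD sH; have Hc := itc_subn divD sH Hp y0.
  by apply: (subg_comm divD hH).
have := periodic_mdiff G1 GM GV Y0 Yl hG 0%N.
have -> : mdiff Y 0 = 1 + (Y 0%N)^-1.
  have -> : 1 = Y 0%N / Y 0%N by rewrite divff.
  rewrite -[X in _ + X]mul1r -mulrDl /mdiff; congr (_ / _).
  by rewrite /Y -(natr1 0) addrA.
rewrite /G bvalX bvalD bval1 (exprD_pchar cl); last by apply: commr_sym; apply: commr1.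
rewrite expr1n bvalV exprVn => h.
have {}h : GRing.comm (bval (Y 0%N) ^+ (l ^ r)) e.
  rewrite -[X in GRing.comm X _]invrK; apply: commr_sym; apply: commrV.
  have -> : (bval (Y 0%N) ^+ (l ^ r))^-1 = 1 + (bval (Y 0%N) ^+ (l ^ r))^-1 - 1.
    by rewrite addrC addKr.
  by apply: commrB; [apply: commr_sym | apply: commr1].
move: h; rewrite /Y addr0 bvalD /= (exprD_pchar cl) // => h.
have -> : t ^+ (l ^ r) = t ^+ (l ^ r) + x ^+ (l ^ r) - x ^+ (l ^ r) by rewrite addrK.
apply: commr_sym; apply: commrB; first exact: commr_sym.
by apply: commr_sym; apply: cE2E1; apply: (dcX dE1).
Qed.
End Pairs.

(** * Noncentral subnormal subgroups of a division ring *)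

(** The commutation up to a central factor. *)
Definition qcomm (R : pzRingType) (s x : R) :=
  exists2 z, is_central z & s * x = z * (x * s).

Section Subnormal.
Variables (D : unitRingType) (divD : GRing.field_axiom D).
Implicit Types (a b x y z u v w : D) (H K L E S : D -> Prop).

Lemma central_div_closed : div_closed (fun z : D => is_central z).
Proof.
split=> [y|x y cx cy z|x y cx cy z|x cx z].
- by apply: commr_sym; apply: commr1.
- by apply: commr_sym; apply: commrB; apply: commr_sym; [apply: cx | apply: cy].
- by apply: commr_sym; apply: commrM; apply: commr_sym; [apply: cx | apply: cy].
- by apply: commr_sym; apply: commrV; apply: commr_sym; apply: cx.
Qed.

Lemma centr_cj S k x : k != 0 -> (forall y, S y -> S (cj k^-1 y)) ->
  centr S x -> centr S (cj k x).
Proof.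
move=> k0 hS cx y Sy; rewrite -(cjVK divD y k0).
by apply: (comm_cj divD) => //; apply: cx; apply: hS.
Qed.

Lemma centr2_cj S k x : k != 0 -> (forall y, S y -> S (cj k y)) ->
  (forall y, S y -> S (cj k^-1 y)) ->
  centr (centr S) x -> centr (centr S) (cj k x).
Proof.
move=> k0 hS hS'; apply: centr_cj => // y cy.
by apply: centr_cj; rewrite ?(invD_eq0 k) ?invrK.
Qed.

Lemma subn_normal_cj r H K k x : subn r K -> is_normal_in H K -> K k -> H x ->
  H (cj k x).
Proof. by move=> sK nH Kk; apply: (normal_cj divD nH Kk); apply: (subn_neq0 divD sK Kk). Qed.

Lemma subnV r H x : subn r H -> H x -> H x^-1.
Proof. by move=> sH; apply: (subgV divD); apply: (subn_subgroup divD sH). Qed.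

(** The conjugations that permute [S] also permute its double centralizer. *)
Lemma centr2_normal r K L S : subn r L -> is_normal_in K L -> is_unit_subgroup K ->
  (forall k y, L k -> S y -> S (cj k y)) ->
  subn r.+1 (fun z => K z /\ centr (centr S) z).
Proof.
move=> sL nK hK hS; have dC := centr_div_closed (centr S).
exists L; split=> //.
  apply: (unit_subgroupD divD).
  - by split; [apply: subg1 | apply: (dc1 dC)].
  - by move=> x [Kx _]; apply: subg_neq0 Kx.
  - by move=> x y [Kx Cx] [Ky Cy]; split; [apply: subgM | apply: (dcM dC)].
  - by move=> x [Kx Cx]; split; [apply: (subgV divD) | apply: (dcV dC)].
apply: (normal_inD divD) => [x [Kx _]|k x Lk k0 [Kx Cx]]; first by case: nK => + _; apply.
split; first exact: (normal_cj divD nK).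
apply: centr2_cj => // y Sy; apply: hS => //.
exact: (subnV sL).
Qed.

(** The conjugates [b] of [a] by [x] and [c] of [a] by [1 + x] satisfy
    [(b - c) x = c - a]; if [b <> c], then [x] is in the field that they
    generate with [a]. *)
Lemma abelian_normal_central a S : S a ->
  (forall x y, x != 0 -> S y -> S (cj x y)) ->
  (forall x y, S x -> S y -> GRing.comm x y) -> is_central a.
Proof.
move=> Sa hS cS x.
have [->|x0] := eqVneq x 0; first exact: commr0.
have [x1|x1] := eqVneq (1 + x) 0.
  rewrite (_ : x = -1); first exact: commrN1.
  by apply/eqP; rewrite -addr_eq0 addrC x1.
have S1 := hS _ _ x0 Sa; have S2 := hS _ _ x1 Sa.
have h : (cj x a - cj (1 + x) a) * x = cj (1 + x) a - a.
  have := cjE divD a x1; have := cjE divD a x0.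
  move: (cj x a) (cj (1 + x) a) => b c hb hc.
  have -> : (b - c) * x = b * x + c - c * (1 + x) by ncr.
  by rewrite hb hc; ncr.
have [e|ne] := eqVneq (cj x a - cj (1 + x) a) 0.
  move: h; rewrite e mul0r => /esym/eqP; rewrite subr_eq0 => /eqP h2.
  apply: commr_sym; apply: (cj_id divD x0).
  by move/eqP: e; rewrite subr_eq0 h2 => /eqP.
have -> : x = (cj x a - cj (1 + x) a)^-1 * (cj (1 + x) a - a).
  by rewrite -h (mulKD divD).
by apply: commrM; [apply: commrV|]; apply: commrB; apply: cS.
Qed.

(** The normal closure of an abelian subnormal subgroup one level up is abelian,
    for otherwise two conjugates would contain elements generating a Heisenberg
    group. *)
Lemma abelian_subn_central r H : subn r H ->
  (forall x y, H x -> H y -> GRing.comm x y) -> forall x, H x -> is_central x.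
Proof.
elim: r H => [|r IHr] H.
  move=> h cH x Hx y; have [->|y0] := eqVneq y 0; first exact: commr0.
  by apply: cH => //; apply/h/(unit_groupD divD).
move=> [K [sK hH nH]] cH x Hx.
case: r sK IHr => [|r] sK IHr.
  apply: (abelian_normal_central Hx) cH => k y k0.
  by apply: (normal_cj divD nH) => //; apply/sK/(unit_groupD divD).
have {}sK : subn r.+1 K := sK.
have [L [sL hK nK]] : exists L,
  [/\ subn r L, is_unit_subgroup K & is_normal_in K L] := sK.
have L0 y : L y -> y != 0 := subn_neq0 divD sL (x := y).
have [hc|] := pselect (forall y h h', L y -> H h -> H h' -> GRing.comm h (cj y h')).
  pose S z := exists y h, [/\ L y, H h & z = cj y h].
  have cS z z' : S z -> S z' -> GRing.comm z z'.
    move=> [y [h [Ly Hh ->]]] [y' [h' [Ly' Hh' ->]]].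
    have y0 := L0 y Ly; have y0' := L0 y' Ly'.
    rewrite -(cjVK divD (cj y' h') y0); apply: (comm_cj divD y0).
    rewrite (cj_cj divD) ?invD_eq0 //; apply: hc => //.
    by apply: (subgM (subn_subgroup divD sL)) => //; apply: (subnV sL).
  have LS k z : L k -> S z -> S (cj k z).
    move=> Lk [y [h [Ly Hh ->]]]; exists (k * y), h.
    rewrite (cj_cj divD) ?L0 //; split=> //.
    exact: (subgM (subn_subgroup divD sL)).
  have sT := centr2_normal sL nK hK LS.
  have SC z : centr (centr S) z -> centr S z.
    by apply: centr_sub => y Sy t St; apply: cS.
  apply: (IHr _ sT) => [y z [_ Cy] [_ Cz]|].
    by apply: Cz; apply: SC.
  split; first by case: nH => + _; apply.
  apply: sub_centr2; exists 1, x; rewrite cj_comm ?oner_neq0 //; last by apply: commr_sym; apply: commr1.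
  by split=> //; apply: (subg1 (subn_subgroup divD sL)).
move=> hn; have {hn} [y [a [a' [Ly Ha Ha' nab]]]] :
    exists y a a', [/\ L y, H a, H a' & ~ GRing.comm a (cj y a')].
  apply: contrapT => h; apply: hn => y a a' Ly Ha Ha'.
  by apply: contrapT => hc; apply: h; exists y, a, a'.
exfalso; apply: nab; have y0 := L0 y Ly; set b := cj y a'.
have Ka : K a by case: nH => + _; apply.
have Kb : K b by apply: (subn_normal_cj sL nK) => //; case: nH => + _; apply.
have a0 := subn_neq0 divD sK Ka; have b0 := subn_neq0 divD sK Kb.
have sH : subn r.+2 H by exists K.
apply: (@Heisenberg_commute D divD a b r.+2) => //.
- apply: cH => //; exact: (normal_comm divD hH nH).
- rewrite -(cjVK divD (cj a b * b^-1) y0); apply: (comm_cj divD) => //.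
  apply: cH => //; rewrite cjM ?invD_eq0 // cjV ?invD_eq0 //.
  rewrite /b cjK // (cj_cj divD) ?invD_eq0 //.
  have -> : cj (y^-1 * a) (cj y a') = cj (cj y^-1 a) a'.
    have yi : y^-1 * a != 0 by rewrite (mulD_neq0 divD) ?(invD_eq0 y).
    by rewrite (cj_cj divD) //; congr (cj _ a'); rewrite /cj invrK.
  have Kc : K (cj y^-1 a) by apply: (subn_normal_cj sL nK) => //; apply: (subnV sL).
  by apply: (subgM hH); [apply: (subn_normal_cj sK nH) | apply: (subgV divD hH)].
- by move=> z z0; apply: (itc_comm divD sH).
Qed.

(** Comparing the factors for [x] and [1 + x] shows that they are 1 or that [x] is
    central. *)
Lemma qcomm_units_central s : (forall x, x != 0 -> qcomm s x) -> is_central s.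
Proof.
move=> hs x; have [->|x0] := eqVneq x 0; first exact: commr0.
have [x1|x1] := eqVneq (1 + x) 0.
  rewrite (_ : x = -1); first exact: commrN1.
  by apply/eqP; rewrite -addr_eq0 addrC x1.
have [->|s0] := eqVneq s 0; first by apply: commr_sym; apply: commr0.
have [z cz hz] := hs x x0; have [t ct ht] := hs (1 + x) x1.
have h : (1 - t) = (t - z) * x.
  apply: (mulID divD s0).
  have -> : (1 - t) * s = s * (1 + x) - s * x - t * s by ncr.
  by rewrite ht hz; ncr.
have [e|ne] := eqVneq (t - z) 0.
  move: h; rewrite e mul0r => /eqP; rewrite subr_eq0 => /eqP t1.
  by move/eqP: e; rewrite subr_eq0 -t1 => /eqP z1; rewrite /GRing.comm hz -z1 mul1r.
have -> : x = (t - z)^-1 * (1 - t) by rewrite h (mulKD divD).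
have dZ := central_div_closed.
apply: commr_sym.
by apply: (dcM dZ); [apply: (dcV dZ); apply: (dcB dZ) | apply: (dcB dZ) => //; apply: (dc1 dZ)].
Qed.

Lemma qcomm_cj s x : s != 0 -> qcomm s x <-> exists2 z, is_central z & cj s x = z * x.
Proof.
move=> s0; split=> [[z cz h]|[z cz h]]; exists z => //.
  by rewrite /cj h -!mulrA (mulDV divD) // mulr1.
by rewrite -(cjE divD x s0) h mulrA.
Qed.

(** Let [B] be the set of the elements that commute up to central factors with
    [K]. The part of [K] that centralizes [B] is normal one level up and contains
    the commutators of [K]. If it is central, then [K] is nilpotent of class 2
    and has noncentral abelian normal subgroups. *)
Lemma qcomm_centralizer r :
  (forall H, subn r H -> (exists2 x, H x & ~ is_central x) ->
     forall s, centr H s -> is_central s) ->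
  forall K, subn r K -> (exists2 x, K x & ~ is_central x) ->
  forall s, (forall x, K x -> qcomm s x) -> is_central s.
Proof.
case: r => [|r] IH K sK [a0 Ka0 na0] s hs.
  apply: qcomm_units_central => x x0; apply: hs.
  by apply/sK/(unit_groupD divD).
have [N [sN hK nK]] := sK.
have K0 x : K x -> x != 0 := subn_neq0 divD sK (x := x).
pose B t := t != 0 /\ forall x, K x -> qcomm t x.
have NB k t : N k -> B t -> B (cj k t).
  move=> Nk [t0 ht]; have k0 := subn_neq0 divD sN Nk.
  have kt0 : cj k t != 0 by apply: cj_neq0.
  split=> // x Kx; apply/qcomm_cj => //.
  have Kx' : K (cj k^-1 x) by apply: (subn_normal_cj sN nK) => //; apply: (subnV sN).
  have /(qcomm_cj _ t0)[z cz hz] := ht _ Kx'; exists z => //.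
  have -> : cj (cj k t) x = cj k (cj t (cj k^-1 x)).
    rewrite !(cj_cj divD) ?(mulD_neq0 divD) ?invD_eq0 //.
  rewrite hz cjM // cjVK // cj_comm //; exact/commr_sym/cz.
have sKB : subn r.+1 (fun x => K x /\ centr B x).
  have dC := centr_div_closed B.
  exists N; split=> //.
    apply: (unit_subgroupD divD).
    - by split; [apply: subg1 | apply: (dc1 dC)].
    - by move=> x [Kx _]; apply: subg_neq0 Kx.
    - by move=> x y [Kx Cx] [Ky Cy]; split; [apply: subgM | apply: (dcM dC)].
    - by move=> x [Kx Cx]; split; [apply: (subgV divD) | apply: (dcV dC)].
  apply: (normal_inD divD) => [x [Kx _]|k x Nk k0 [Kx Cx]].
    by case: nK => + _; apply.
  split; first exact: (normal_cj divD nK).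
  by apply: centr_cj => // y By; apply: NB => //; apply: (subnV sN).
have [s0|s0] := eqVneq s 0; first by rewrite s0 => x; apply: commr_sym; apply: commr0.
have Bs : B s by split.
have [nc|cKB] := pselect (exists2 x, K x /\ centr B x & ~ is_central x).
  by apply: (IH _ sKB nc) => x [_ Cx]; apply: commr_sym; apply: Cx.
have cK x y : K x -> K y -> is_central (cj x y * y^-1).
  move=> Kx Ky; apply: contrapT => nc; apply: cKB; exists (cj x y * y^-1) => //.
  split; first exact: (subg_comm divD).
  move=> t [t0 ht]; apply: (cj_id divD t0).
  have [x0 y0] := (K0 x Kx, K0 y Ky).
  have /(qcomm_cj _ t0)[z cz hz] := ht x Kx; have /(qcomm_cj _ t0)[z' cz' hz'] := ht y Ky.
  have z0 : z != 0.
    by apply: contraTneq (cj_neq0 divD t0 x0) => z0; rewrite hz z0 mul0r eqxx.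
  have z0' : z' != 0.
    by apply: contraTneq (cj_neq0 divD t0 y0) => z0'; rewrite hz' z0' mul0r eqxx.
  have h1 : cj t (cj x y) = z' * cj x y.
    rewrite {2}/cj !cjM // cjV // hz hz' invMD //.
    have -> : z * x * (z' * y) * (x^-1 * z^-1) = z' * (x * y * x^-1) * (z * z^-1).
      rewrite !mulrA; have -> : z * x * z' = z' * x * z by rewrite -(cz' (z * x)) (cz x) mulrA.
      rewrite -!mulrA; congr (_ * (_ * _)); rewrite (mulrA z) (cz y) -mulrA; congr (_ * _).
      by rewrite (mulrA z) (cz x^-1) -mulrA.
    by rewrite (mulDV divD) // mulr1.
  rewrite cjM // h1 cjV // hz' invMD //; move: (cj x y) => c.
  rewrite (cz' c) -!mulrA; congr (_ * _).
  by rewrite mulrA (cz' y^-1) -mulrA (mulDV divD) // mulr1.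
case: na0; pose S x := x = a0; have dS := centr_div_closed (centr S).
have sA : subn r.+2 (fun z => K z /\ centr (centr S) z).
  exists K; split=> //.
    apply: (unit_subgroupD divD).
    - by split; [apply: subg1 | apply: (dc1 dS)].
    - by move=> x [Kx _]; apply: subg_neq0 Kx.
    - by move=> x y [Kx Cx] [Ky Cy]; split; [apply: subgM | apply: (dcM dS)].
    - by move=> x [Kx Cx]; split; [apply: (subgV divD) | apply: (dcV dS)].
  apply: (normal_inD divD) => [x []//|k x Kk k0 [Kx Cx]].
  split; first by apply: (subgM hK); [apply: (subgM hK) | apply: (subgV divD hK)].
  apply: centr_cj => // w Cw _ ->; have Ki : K k^-1 by apply: (subnV sK).
  have kV0 : k^-1 != 0 by rewrite (invD_eq0 k).
  rewrite -(cjK divD a0 k0); apply: (comm_cj divD kV0).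
  rewrite -(mulDVK divD (cj k a0) (K0 _ Ka0)); apply: commr_sym.
  apply: commrM; last by apply: commr_sym; apply: Cw.
  by apply: commr_sym; apply: cK.
apply: (abelian_subn_central sA) => [x y [_ Cx] [_ Cy]|].
  by apply: Cy => _ ->; apply: Cx => _ ->.
by split=> //; apply: sub_centr2.
Qed.

Lemma centr_normal H K k s : is_normal_in H K -> K k -> K k^-1 -> k != 0 ->
  centr H s -> centr H (cj k s).
Proof.
move=> nH Kk Ki k0; apply: centr_cj => // y; apply: (normal_cj divD nH Ki).
by rewrite (invD_eq0 k).
Qed.

(** If the centralizer [C] of [H] meets the group [K] above [H] only in the center,
    then the commutators of [C] with [K] are central at each level of the series
    and [C] is central by [qcomm_centralizer]. Otherwise [C] and [H] contain
    noncentral subnormal subgroups that commute with each other. *)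
Theorem subn_centralizer r H : subn r H -> (exists2 x, H x & ~ is_central x) ->
  forall s, centr H s -> is_central s.
Proof.
elim: r H => [|r IHr] H.
  move=> h _ s Cs x; have [->|x0] := eqVneq x 0; first exact: commr0.
  by apply: commr_sym; apply: Cs; apply/h/(unit_groupD divD).
move=> sH [h0 Hh0 nh0] s Cs; have [K [sK hH nH]] := sH.
have HK x : H x -> K x by case: nH => + _; apply.
have hK := subn_subgroup divD sK.
have K0 k : K k -> k != 0 := subn_neq0 divD sK (x := k).
have qK : forall t, (forall x, K x -> qcomm t x) -> is_central t.
  by apply: (qcomm_centralizer IHr sK); exists h0 => //; apply: HK.
have dC := centr_div_closed H.
have [cCK|nCK] := pselect (forall x, centr H x -> K x -> is_central x).
  have climb i N : subn i N -> (forall x, K x -> N x) ->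
      (forall x, centr H x -> N x -> is_central x) ->
      forall x, centr H x -> x != 0 -> is_central x.
    elim: i N => [|i IHi] N.
      by move=> h _ hN x Cx x0; apply: hN => //; apply/h/(unit_groupD divD).
    move=> [N' [sN' gN nN]] KN hN.
    have NN' x : N x -> N' x by case: nN => + _; apply.
    apply: (IHi N' sN') => [x /KN/NN'//|x Cx Nx]; apply: qK => k Kk.
    have x0 := subn_neq0 divD sN' Nx; have k0 := K0 k Kk.
    apply/qcomm_cj => //; exists (cj x k * k^-1); last by rewrite (mulDVK divD).
    apply: hN; last first.
      apply: (subgM gN); last by apply: (subgV divD gN); apply: KN.
      by apply: (normal_cj divD nN) => //; apply: KN.
    have -> : cj x k * k^-1 = x * cj k x^-1 by rewrite /cj !mulrA.
    apply: (dcM dC) => //; apply: (centr_normal nH) => //; first exact: (subgV divD hK).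
    exact: (dcV dC).
  have [->|s0] := eqVneq s 0; first by move=> x; apply: commr_sym; apply: commr0.
  exact: (climb r K sK).
have [b [Cb Kb nb]] : exists b, [/\ centr H b, K b & ~ is_central b].
  apply: contrapT => h; apply: nCK => x Cx Kx.
  by apply: contrapT => nx; apply: h; exists x.
have sB : subn r.+1 (fun x => centr H x /\ K x).
  exists K; split=> //.
    apply: (unit_subgroupD divD).
    - by split; [apply: (dc1 dC) | apply: subg1].
    - by move=> x [_ Kx]; apply: K0.
    - by move=> x y [Cx Kx] [Cy Ky]; split; [apply: (dcM dC) | apply: (subgM hK)].
    - by move=> x [Cx Kx]; split; [apply: (dcV dC) | apply: (subgV divD hK)].
  apply: (normal_inD divD) => [x []//|k x Kk k0 [Cx Kx]].
  split; last by apply: (subgM hK); [apply: (subgM hK) | apply: (subgV divD hK)].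
  by apply: (centr_normal nH) => //; apply: (subgV divD hK).
have [[v [w [[Cv _] [Cw _] nvw]]]|cB] := pselect (exists v w,
    [/\ centr H v /\ K v, centr H w /\ K w & ~ GRing.comm v w]); last first.
  case: nb; apply: (abelian_subn_central sB) => // x y Bx By.
  by apply: contrapT => nxy; apply: cB; exists x, y.
have [[p [u [Hp Hu npu]]]|cH] := pselect (exists p u, [/\ H p, H u & ~ GRing.comm p u]).
  by case: nvw; apply: (subnormal_centralizer_comm divD sH Hp Hu npu).
case: nh0; apply: (abelian_subn_central sH) => // x y Hx Hy.
by apply: contrapT => nxy; apply: cH; exists x, y.
Qed.

Theorem subn_qcomm r H s : subn r H -> (exists2 x, H x & ~ is_central x) ->
  (forall x, H x -> qcomm s x) -> is_central s.
Proof. by move=> sH nH; apply: (qcomm_centralizer (@subn_centralizer r) sH). Qed.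

End Subnormal.

(** * Local Engel conditions in a division ring with involution *)

Definition br (R : pzRingType) (x y : R) : R := x * y - y * x.

Section Brackets.
Variable R : pzRingType.
Implicit Types x y z : R.
Lemma br_comm x y : br x y = 0 <-> GRing.comm x y.
Proof. by split=> [/eqP|h]; [rewrite subr_eq0 => /eqP | rewrite /br h subrr]. Qed.
Lemma brC x y : br x y = - br y x. Proof. by rewrite /br opprB. Qed.
Lemma brDr x y z : br x (y + z) = br x y + br x z. Proof. by rewrite /br; ncr. Qed.
Lemma brDl x y z : br (x + y) z = br x z + br y z. Proof. by rewrite /br; ncr. Qed.
Lemma brNr x y : br x (- y) = - br x y. Proof. by rewrite /br; ncr. Qed.
Lemma brBr x y z : br x (y - z) = br x y - br x z. Proof. by rewrite /br; ncr. Qed.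
Lemma brMr x y z : br x (y * z) = br x y * z + y * br x z. Proof. by rewrite /br; ncr. Qed.
Lemma brMl x y z : br (x * y) z = x * br y z + br x z * y. Proof. by rewrite /br; ncr. Qed.
Lemma brxx x : br x x = 0. Proof. by rewrite /br subrr. Qed.
Lemma inner_derE x y : inner_der x y = br y x. Proof. by []. Qed.
End Brackets.

(** The elements [x] for which the kernel of [ad x] is its generalized
    0-eigenspace. *)
Definition ad_reduced (D : pzRingType) (x : D) : Prop :=
  forall z, br x (br x z) = 0 -> br x z = 0.

Section Involution.
Variables (D : unitRingType) (divD : GRing.field_axiom D).
Variables (star : D -> D) (hstar : involution_first_kind star).
Implicit Types (a b c d e f g h s t u v w x y z : D).

Lemma starD x y : star (x + y) = star x + star y. Proof. by case: hstar => -[]. Qed.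
Lemma starM x y : star (x * y) = star y * star x. Proof. by case: hstar => -[]. Qed.
Lemma starK x : star (star x) = x. Proof. by case: hstar => -[]. Qed.
Lemma star_central z : is_central z -> star z = z. Proof. by case: hstar => _; apply. Qed.
Lemma star0 : star 0 = 0.
Proof. by apply: star_central => y; apply: commr_sym; apply: commr0. Qed.
Lemma star1 : star 1 = 1.
Proof. by apply: star_central => y; apply: commr_sym; apply: commr1. Qed.
Lemma starN x : star (- x) = - star x.
Proof. by apply/eqP; rewrite -addr_eq0 -starD addNr star0. Qed.
Lemma starB x y : star (x - y) = star x - star y. Proof. by rewrite starD starN. Qed.
Lemma starX x n : star (x ^+ n) = star x ^+ n.
Proof. by elim: n => [|n IHn]; [exact: star1 | rewrite exprS starM IHn exprSr]. Qed.
Lemma star_inj : injective star. Proof. exact: can_inj starK. Qed.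
Lemma star_eq0 x : (star x == 0) = (x == 0).
Proof. by rewrite -{1}star0 (inj_eq star_inj). Qed.
Lemma starV x : star x^-1 = (star x)^-1.
Proof.
have [->|x0] := eqVneq x 0; first by rewrite invr0 star0 invr0.
by apply: (invM1 divD); rewrite ?star_eq0 // -starM (mulVD divD) // star1.
Qed.
Lemma star_comm x y : GRing.comm x y -> GRing.comm (star x) (star y).
Proof. by move=> h; rewrite /GRing.comm -!starM h. Qed.
Lemma star_br x y : star (br x y) = br (star y) (star x).
Proof. by rewrite starB !starM. Qed.

Lemma ad_reduced_iter x z N : ad_reduced x -> iter N (inner_der x) z = 0 -> br x z = 0.
Proof.
move=> gx; case: N => [|N]; first by move=> /= ->; rewrite /br mulr0 mul0r subrr.
elim: N z => [|N IHN] z h; first by move: h; rewrite /= inner_derE brC => /eqP; rewrite oppr_eq0 => /eqP.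
apply: gx; move: h; rewrite iterSr => /IHN; rewrite inner_derE [br z x]brC brNr.
by move/eqP; rewrite oppr_eq0 => /eqP.
Qed.

Lemma ad_reducedPn x : ~ ad_reduced x -> x != 0 /\ exists z, br x z = x.
Proof.
move=> /existsNP[z0 /not_implyP[h1 h2]]; split.
  by apply: contra_notN h2 => /eqP->; rewrite /br mul0r mulr0 subrr.
set w := br x z0 in h1 h2; exists (z0 * w^-1 * x).
have w0 : w != 0 by apply/eqP.
have cw : br x w^-1 = 0 by apply/br_comm; apply: commrV; apply/br_comm.
by rewrite !brMr cw brxx !mulr0 addr0 addr0 -/w (mulDV divD) // mul1r.
Qed.

Lemma br_exp a b n : br a b = a -> br (a ^+ n) b = a ^+ n *+ n.
Proof.
move=> h; elim: n => [|n IHn]; first by rewrite mulr0n; apply/br_comm; apply: commr_sym; apply: commr1.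
by rewrite exprS brMl IHn h mulrnAr mulrSr.
Qed.

Lemma quad_split u v e ta rh f : v = ta + e -> u = rh + ta * e -> GRing.comm f e ->
  u + v * f + f * f = (ta + f) * (e + f) + rh.
Proof. by move=> -> -> cfe; rewrite [_ * (e + f)]mulrDl [f * (_ + _)]mulrDr cfe; ncr. Qed.

Lemma quad_expand a b u v c s ta f : GRing.comm f c -> GRing.comm f s ->
  a + b * f - (u + v * f + f * f) * c - (ta + f) * s
  = a - u * c - ta * s + (b - v * c - s) * f - c * f ^+ 2.
Proof.
move=> cc cs.
have -> : (u + v * f + f * f) * c = u * c + v * c * f + c * (f * f).
  by rewrite !mulrDl -!mulrA cc; congr (_ + _); rewrite !mulrA cc.
have -> : (ta + f) * s = ta * s + s * f by rewrite mulrDl cs.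
by ncr.
Qed.

Definition engel_at x := exists N, iter N (inner_der x) (star x) = 0.

(** [Nt] stands for the elements at which the Engel condition is known to hold:
    all the elements, or, in characteristic [p], those that are not algebraic
    over the prime field. The Engel condition is invariant under the
    multiplication by the symmetric elements that commute with everything in
    sight, whence [engel_scale]. *)
Variable Nt : D -> Prop.
Hypothesis engel_scale : forall u c, Nt c -> star c = c ->
  GRing.comm c u -> GRing.comm c (star u) -> engel_at u.
Hypothesis engel_nt : forall u, Nt u -> engel_at u.
Hypothesis nt_cj : forall g x, g != 0 -> Nt x -> Nt (cj g x).
Hypothesis nt_expp : forall p x, p \in [pchar D] -> Nt x -> Nt (x ^+ p).
Hypothesis nt_br : forall x z, x != 0 -> br x z = x -> Nt x.
Hypothesis engel_pchar0 : (forall p, p \notin [pchar D]) -> forall u, engel_at u.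
Variables (cs : seq D) (cs_uniq : uniq cs) (cs_size : (4 <= size cs)%N).
Hypothesis cs_central : forall f, f \in cs -> is_central f.

Lemma central_roots (P : {poly D}) (rs : seq D) : uniq rs -> {subset rs <= cs} ->
  (forall f, f \in rs -> P.[f] = 0) -> (size P <= size rs)%N -> P = 0.
Proof.
move=> urs sub hP sz; apply/eqP; apply: contraTT sz => P0; rewrite -ltnNge.
apply: max_ring_poly_roots => //; first by apply/allP => f /hP/eqP.
elim: rs urs sub {hP} => //= f rs IHrs /andP[nf urs] sub.
rewrite IHrs // ?andbT; last by move=> r rr; apply: sub; rewrite inE rr orbT.
apply/allP => r rr; rewrite /diff_roots.
rewrite (cs_central (sub f _)) ?inE ?eqxx //= divD // subr_eq0.
by apply: contraNneq nf => <-.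
Qed.

(** The Engel condition at the conjugates of a symmetric element [x] says that
    [h^-1 [x, h]] commutes with [x] for all the norms [h = g* g]. Replacing
    [g] by [g + f] for four central [f] yields [[x, g + g*] = 0]. *)
Lemma sym_reduced_comm_trace x g : star x = x -> ad_reduced x -> Nt x ->
  br x (g + star g) = 0.
Proof.
move=> sx gx nx; apply/eqP; apply: contraT => b0.
set T := g + star g in b0; set b := br x T in b0.
pose h := star g * g; pose a := br x h.
have br_quad (u v f : D) : br x f = 0 -> br x (u + v * f + f * f) = br x u + br x v * f.
  by move=> fx; rewrite !brDr !brMr fx !mulr0 mul0r !addr0.
have hf f : f \in cs -> exists2 k, a + b * f = (h + T * f + f * f) * k & br x k = 0.
  move=> /cs_central cf; have sf := star_central cf.
  have G0 : g + f != 0.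
    apply: contraNneq b0 => /eqP; rewrite addr_eq0 => /eqP gf.
    rewrite /b /T gf starN sf; apply/eqP/br_comm/commr_sym.
    by apply: commr_sym; apply: commrD; apply: commrN; apply: commr_sym; apply: cf.
  have hE : star (g + f) * (g + f) = h + T * f + f * f.
    by rewrite starD sf mulrDl !mulrDr (cf g) /h /T mulrDl; ncr.
  have H0 : h + T * f + f * f != 0.
    by rewrite -hE (mulD_neq0 divD) ?star_eq0.
  rewrite -hE in H0 *; set H := star (g + f) * (g + f) in hE H0 *.
  have ck : br x (cj H^-1 x) = 0.
    have [N hN] := engel_nt (nt_cj G0 nx).
    apply: (@ad_reduced_iter x _ N) => //.
    have cjder y z : cj (g + f)^-1 (inner_der (cj (g + f) y) z)
                     = inner_der y (cj (g + f)^-1 z).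
      rewrite /inner_der; move: (cjK divD y G0); move: (cj (g + f) y) => Y <-.
      by rewrite cjB !cjM ?(invD_eq0 (g + f)).
    have -> : cj H^-1 x = cj (g + f)^-1 (star (cj (g + f) x)).
      rewrite /cj /H !starM starV sx !invrK invMD ?star_eq0 //.
      by rewrite !mulrA.
    have -> : iter N (inner_der x) (cj (g + f)^-1 (star (cj (g + f) x)))
              = cj (g + f)^-1 (iter N (inner_der (cj (g + f) x)) (star (cj (g + f) x))).
      by elim: N {hN} => //= N ->; rewrite cjder.
    by rewrite hN cj0.
  have eH : br x H = a + b * f.
    by rewrite hE; apply: br_quad; apply/br_comm; apply: commr_sym; apply: cf.
  exists (cj H^-1 x - x); last by rewrite brBr ck brxx subrr.
  rewrite -eH /br /cj invrK mulrBr !mulrA (mulDV divD) // mul1r //.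
pose e := b^-1 * a; pose b' := br x b; pose a' := br x a.
pose c1 := b^-1 * b'; pose c0 := b^-1 * a'; pose si := c0 - e * c1.
pose ta := T - e; pose rh := h - ta * e.
pose r0 := a - h * c1 - ta * si; pose r1 := b - T * c1 - si.
have c1_0 : c1 != 0.
  rewrite (mulD_neq0 divD) ?(invD_eq0 b) //; apply: contraNneq b0 => h0.
  by apply/eqP; apply: gx.
have be : b * e = a by rewrite /e (mulVKD divD).
have hk f : f \in cs -> exists2 k, (e + f) * k = si & rh * k = r0 + r1 * f - c1 * f ^+ 2.
  move=> csf; have cf := cs_central csf; have [k hk bk] := hf f csf.
  have cfx : br x f = 0 by apply/br_comm; apply: commr_sym; apply: cf.
  have hk' : a' + b' * f = (a + b * f) * k.
    have := congr1 (br x) hk; rewrite brDr brMr cfx mulr0 addr0 -/a' -/b' => ->.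
    rewrite brMr bk mulr0 addr0; congr (_ * _).
    exact: br_quad.
  have hk1 : (e + f) * k = c0 + c1 * f.
    apply: (mulDI divD b0); rewrite mulrA mulrDr be -hk' mulrDr mulrA.
    by rewrite /c0 /c1 !(mulVKD divD).
  have hsi : (e + f) * (k - c1) = si.
    by rewrite mulrBr hk1 [(e + f) * c1]mulrDl (cf c1) /si opprD addrACA subrr addr0.
  exists (k - c1) => //.
  have -> : rh * (k - c1) = (h + T * f + f * f) * k - (h + T * f + f * f) * c1
                            - (ta + f) * ((e + f) * (k - c1)).
    have -> : h + T * f + f * f = (ta + f) * (e + f) + rh.
      by apply: quad_split; rewrite /rh /ta ?subrK //; apply: cf.
    by move: (ta + f) (e + f) => A B; ncr.
  by rewrite hsi -hk; apply: quad_expand; apply: cf.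
pose q : {poly D} := r0%:P + r1%:P * 'X - c1%:P * 'X^2.
have q2 : q`_2 = - c1.
  by rewrite coefB coefD coefMX coefCM coefXn !coefC /= mulr1 addr0 sub0r.
have qf f : q.[f] = r0 + r1 * f - c1 * f ^+ 2.
  by rewrite hornerD hornerN hornerD !hornerCM hornerC hornerX hornerXn.
have sq : (size q <= 3)%N.
  apply/leq_sizeP => j j3; rewrite coefB coefD coefMX coefCM !coefC coefXn.
  by case: j j3 => [|[|[|j]]] //= _; rewrite mulr0 subr0 addr0.
have q0 : q != 0.
  by apply: contraTneq c1_0 => q0; move: q2; rewrite q0 coef0 => /eqP; rewrite eq_sym oppr_eq0 => ->.
have {}sz3 rs : uniq rs -> {subset rs <= cs} -> (3 <= size rs)%N ->
    (forall f, f \in rs -> r0 + r1 * f - c1 * f ^+ 2 = 0) -> false.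
  move=> urs sub s3 hr; move/eqP: q0; case; apply: (central_roots urs sub).
    by move=> f /hr; rewrite qf.
  exact: leq_trans sq s3.
have [rh0|rh0] := eqVneq rh 0.
  apply: (sz3 cs) => //; first exact: ltnW.
  by move=> f /hk[k _ <-]; rewrite rh0 mul0r.
have [si0|si0] := eqVneq si 0.
  apply: (sz3 (rem (- e) cs)); first exact: rem_uniq.
  - exact: mem_rem.
  - have [h1|h1] := boolP (- e \in cs); last by rewrite rem_id // ltnW.
    by rewrite size_rem // -ltnS prednK // (leq_trans _ cs_size).
  - move=> f; rewrite mem_rem_uniq // inE => /andP[fe /hk[k]].
    rewrite si0 => /eqP; rewrite (mulD_eq0 divD) addrC addr_eq0 (negPf fe) /= => /eqP->.
    by rewrite mulr0.
pose Q : {poly D} := (e * rh^-1)%:P * q + rh^-1%:P * q * 'X - si%:P.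
have Q3 : Q`_3 = - (rh^-1 * c1).
  rewrite coefB coefD coefMX !coefCM coefC /= q2 mulrN.
  by rewrite [q`_3]nth_default // mulr0 add0r subr0.
have : Q = 0.
  apply: (central_roots cs_uniq) => // [f csf|].
    have cf := cs_central csf; have [k h1 h2] := hk f csf.
    rewrite hornerD hornerN hornerD hornerMX !hornerCM hornerC qf -h2.
    by rewrite -(mulrA e) !(mulKD divD) // -(cf k) -mulrDl h1 subrr.
  apply: leq_trans cs_size; apply/leq_sizeP => j j3.
  rewrite coefB coefD coefMX !coefCM coefC; case: j j3 => [|[|[|[|j]]]] //= _.
  by rewrite !nth_default ?mulr0 ?subr0 ?addr0 //; apply: leq_trans sq _.
move=> Q0; move: Q3; rewrite Q0 coef0 => /eqP; rewrite eq_sym oppr_eq0.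
by rewrite (mulD_eq0 divD) (invD_eq0 rh) (negPf rh0) (negPf c1_0).
Qed.

(** The trace of [y T] is [T^2 - [T, y]]. *)
Lemma reduced_trace_comm y : let T := y + star y in
  ad_reduced T -> Nt T -> br T y = 0.
Proof.
move=> T gT nT; have sT : star T = T by rewrite starD starK addrC.
have h := @sym_reduced_comm_trace T (y * T) sT gT nT.
apply: gT; move: h; rewrite starM sT.
have -> : star y = T - y by rewrite /T addrC addKr.
have -> : y * T + T * (T - y) = T * T - br T y by rewrite /br; ncr.
rewrite brBr => /eqP; have -> : br T (T * T) = 0 by rewrite /br mulrA subrr.
by rewrite sub0r oppr_eq0 => /eqP.
Qed.

(** Outside characteristic 2: if [[a, z] = a] with [a] symmetric, the skew part
    [b] of [z] satisfies [[a, b] = a], and [a + b] violates the Engel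
    condition. *)
Lemma sym_ad_reduced a : 2%:R != 0 :> D -> star a = a -> ad_reduced a.
Proof.
move=> n2 sa; apply: contrapT => /ad_reducedPn[a0 [z hz]].
pose b := 2%:R^-1 * (z - star z).
have c2 y : GRing.comm 2%:R^-1 y by apply: commr_sym; apply: commrV; apply: commr_nat.
have sz : br a (star z) = - a.
  by have := congr1 star hz; rewrite star_br sa brC => /eqP; rewrite eqr_oppLR => /eqP.
have hb : br a b = a.
  rewrite /b brMr brBr hz sz opprK (_ : br a _ = 0) ?mul0r ?add0r; last first.
    by apply/br_comm; apply: commr_sym; apply: c2.
  by rewrite -mulr2n -[a *+ 2]mulr_natl (mulKD divD).
have sb : star b = - b.
  rewrite /b starM starB starK starV (star_central (_ : is_central 2%:R)); last first.
    by move=> y; apply: commr_sym; apply: commr_nat.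
  by rewrite -(c2 (star z - z)) -mulrN opprB.
have su : star (a + b) = a - b by rewrite starD sa sb.
have [N hN] : engel_at (a + b).
  have [[p cp]|ncp] := pselect (exists p, p \in [pchar D]); last first.
    by apply: engel_pchar0 => p; apply/negP => cp; apply: ncp; exists p.
  have cab : GRing.comm (a ^+ p) b.
    by apply/br_comm; rewrite br_exp // (mulrn_pchar cp).
  have caa : GRing.comm (a ^+ p) a by apply: commr_sym; apply: commrX.
  apply: (@engel_scale _ (a ^+ p)); rewrite ?starX ?sa ?su //.
  - by apply: nt_expp => //; apply: nt_br hz.
  - exact: commrD.
  - exact: commrB.
have it n : iter n.+1 (inner_der (a + b)) (star (a + b)) = a *+ 2.
  elim: n => [|n IHn]; first by rewrite /= inner_derE su -{3}hb /br; ncr.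
  by rewrite iterS IHn inner_derE -[in RHS]hb /br; ncr.
have : a *+ 2 = 0 by rewrite -(it N) iterS hN inner_derE /br mul0r mulr0 subrr.
move/eqP; rewrite -[a *+ 2]mulr_natl (mulD_eq0 divD) (negPf n2) (negPf a0) //.
Qed.

Lemma br_infinite_order p s z : p \in [pchar D] -> s != 0 -> br s z = s ->
  ~ finite_order s.
Proof.
move=> cp s0 hs [n n0 /(exp_eq1_tor divD cp n0)[m m0 hm]].
have := br_exp (p ^ m) hs; rewrite hm hs -(prednK m0) expnS mulrnA.
by rewrite (mulrn_pchar cp) mul0rn => /eqP; rewrite (negPf s0).
Qed.

Section Char2.
Hypothesis ch2 : 2%N \in [pchar D].

Let opp2 x : - x = x. Proof. exact: (oppr_pchar2 ch2). Qed.
Let add2 x : x + x = 0. Proof. exact: (addrr_pchar2 ch2). Qed.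
Let brS x y : br x y = br y x. Proof. by rewrite brC opp2. Qed.
Let eq2 x y : x + y = 0 -> x = y.
Proof. by move/eqP; rewrite addr_eq0 opp2 => /eqP. Qed.

Section Derivation.
Variables (der : D -> D) (g : D).
Hypothesis derD : {morph der : x y / x + y}.
Hypothesis derM : forall x y, der (x * y) = x * der y + der x * y.
Hypothesis derg : der g = g + 1.
Definition der_sq_add e := der (der e) + der e.
Local Notation Der := der_sq_add.
Local Notation T := (fun e => g * der e).

Let der1 : der 1 = 0.
Proof. by have := derM 1 1; rewrite !mul1r mulr1 add2. Qed.
Let derg2 : der (g * g) = 0.
Proof. by rewrite derM derg mulrDr mulrDl mul1r mulr1 add2. Qed.

Lemma Der_gM e : Der (g * e) = g * Der e.
Proof.
rewrite /der_sq_add !derM !derD !derM derg derD derg der1.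
rewrite addr0; apply: eq2; set a := der e; set b := der a.
have -> : g * b + (g + 1) * a + ((g + 1) * a + (g + 1) * e) + (g * a + (g + 1) * e)
   + g * (b + a) = (g * b + g * b) + ((g + 1) * a + (g + 1) * a)
   + ((g + 1) * e + (g + 1) * e) + (g * a + g * a) by ncr.
by rewrite !add2 ?addr0.
Qed.

Lemma Der_gXM k e : Der (g ^+ k * e) = g ^+ k * Der e.
Proof.
elim: k => [|k IHk]; first by rewrite expr0 !mul1r.
by rewrite exprS -mulrA Der_gM IHk mulrA.
Qed.

Lemma iter_Der_g2M n e : iter n (fun e => g * g * Der e) e = g ^+ (2 * n) * iter n Der e.
Proof.
elim: n => [|n IHn]; first by rewrite muln0 expr0 mul1r.
by rewrite !iterS IHn Der_gXM mulnS exprD expr2 !mulrA.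
Qed.

(** In characteristic 2, [T^2 = T + g^2 Der], where [T] commutes with
    [g^2 Der]; hence the powers of [T] with exponents [2^k]. *)
Lemma iter_twisted_der k e :
  iter (2 ^ k) T e = T e + \sum_(i < k) g ^+ (2 ^ i.+1) * iter (2 ^ i) Der e.
Proof.
elim: k e => [|k IHk] e; first by rewrite big_ord0 addr0.
have DerD : {morph Der : x y / x + y}.
  by move=> x y; rewrite /der_sq_add !derD addrACA.
have TT x : T (T x) = T x + g * g * Der x.
  rewrite /= /der_sq_add derM derg; apply: eq2; set a := der x; set b := der a.
  have -> : g * (g * b + (g + 1) * a) + (g * a + g * g * (b + a))
     = (g * g * b + g * g * b) + (g * g * a + g * g * a) + (g * a + g * a) by ncr.
  by rewrite !add2 ?addr0.
have cTU x : T (g * g * Der x) = g * g * Der (T x).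
  have Tg y : T (g * g * y) = g * g * T y.
    by rewrite /= derM derg2 mul0r addr0 !mulrA.
  have DT y : Der (T y) = T (Der y).
    by rewrite /= Der_gM /der_sq_add -derD.
  by rewrite Tg DT.
rewrite expnSr (mulnC _ 2) -[iter _ _ _]/(iter (2 * 2 ^ k) T e) mulnC iter_iterM.
have -> : iter (2 ^ k) (iter 2 T) e = iter (2 ^ k) (fun x => T x + g * g * Der x) e.
  by apply: eq_iter => x; rewrite -TT.
rewrite (@iter_add_prime_exp D T (fun x => g * g * Der x) 2 k e) //.
- rewrite IHk big_ord_recr /= -addrA; congr (_ + (_ + _)).
  by rewrite iter_Der_g2M expnS.
- by move=> x y; rewrite derD mulrDr.
- by move=> x y; rewrite DerD mulrDr.
Qed.
End Derivation.

(** In characteristic 2, if [[s, z] = s] with [s] symmetric, then the Engel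
    conditions at the elements [z + f z s], where [f] runs over the even powers
    of [s], are the values at infinitely many points of a polynomial with
    constant term [1 + z + z*]. *)
Lemma char2_translate s z : star s = s -> s != 0 -> br s z = s -> z + star z = 1.
Proof.
move=> ss s0 hs; have nfs := br_infinite_order ch2 s0 hs.
set c := z + star z; have sz : star z = z + c by rewrite /c addrA add2 add0r.
have hs' : br s (star z) = s.
  by have := congr1 star hs; rewrite star_br ss brS.
have csc : GRing.comm s c by apply/br_comm; rewrite brDr hs hs' add2.
have cs2z : GRing.comm (s ^+ 2) z by apply/br_comm; rewrite br_exp // mulr2n add2.
have nts2 : Nt (s ^+ 2) by apply: nt_expp => //; apply: nt_br hs.
have cs2 e : GRing.comm s e -> GRing.comm (s ^+ 2) e.
  by move=> h; apply: commr_sym; apply: commrX; apply: commr_sym.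
pose der := inner_der z; pose Der := der_sq_add (inner_der z).
have derD : {morph der : x y / x + y} by move=> x y; exact: brDl.
have derM x y : der (x * y) = x * der y + der x * y by exact: brMl.
have der_cs e : GRing.comm s e -> GRing.comm s (der e).
  move=> ce; apply/br_comm; rewrite /der inner_derE.
  have -> : br s (br e z) = br (br s e) z + br e (br s z) by rewrite /br; ncr.
  rewrite hs (iffRL (br_comm s e) ce) (iffRL (br_comm e s)) ?addr0; last exact: commr_sym.
  by rewrite /br mul0r mulr0 subrr.
have Der_cs e n : GRing.comm s e -> GRing.comm s (iter n Der e).
  move=> ce; elim: n => //= n IHn; apply: commrD; last exact: der_cs.
  by apply: (der_cs); apply: der_cs.
(* the Engel condition at z + f z s *)
have eng f : GRing.comm s f -> GRing.comm f z -> star f = f -> GRing.comm f c ->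
    let g := 1 + f * s in exists k0, forall k, (k0 <= k)%N ->
      g * (g * der c + (g + 1) * (1 + c)
           + \sum_(i < k) g ^+ (2 ^ i.+1) * iter (2 ^ i) Der c) = 0.
  move=> csf cfz sf cfc g; pose u := z + f * z * s.
  have hzs : z * s = s * z + s.
    by apply/eqP; rewrite addrC -subr_eq -{3}hs /br; apply/eqP; rewrite -[RHS]opp2; ncr.
  pose X := c + (g + 1) * (1 + c).
  have g1 : g + 1 = f * s by rewrite /g addrC addrA add2 add0r.
  have su : star u = u + X.
    rewrite /u starD !starM sf ss sz /X g1.
    have -> : s * ((z + c) * f) = f * (s * z) + f * s * c.
      rewrite mulrDl -cfz -cfc mulrDr !mulrA csf //.
    rewrite -(mulrA f z s) hzs; apply: eq2.
    have -> : z + c + (f * (s * z) + f * s * c)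
       + (z + f * (s * z + s) + (c + f * s * (1 + c)))
       = (z + z) + (c + c) + (f * s * z + f * s * z) + (f * s + f * s)
         + (f * s * c + f * s * c) by ncr.
    by rewrite !add2 ?addr0.
  have cgs : GRing.comm s g by apply: commrD; [apply: commr1 | apply: commrM].
  have hg : br g z = g + 1.
    rewrite g1 /g brDl (iffRL (br_comm 1 z)) ?add0r; last by apply: commr_sym; apply: commr1.
    by rewrite brMl hs (iffRL (br_comm f z)) // mul0r addr0.
  have Tu e : GRing.comm s e -> GRing.comm f e -> inner_der u e = g * der e.
    move=> cse cfe; rewrite inner_derE /u brDr.
    have -> : br e (f * z * s) = f * s * br e z.
      rewrite brMr (iffRL (br_comm e s)); last exact: commr_sym.
      rewrite mulr0 addr0 brMr (iffRL (br_comm e f)); last exact: commr_sym.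
      by rewrite mul0r add0r -!mulrA -(der_cs e cse).
    by rewrite /g mulrDl mul1r.
  have csX : GRing.comm s X.
    by rewrite /X g1; apply: commrD => //; do !apply: commrM => //; apply: commrD => //; apply: commr1.
  have cfX : GRing.comm f X.
    rewrite /X g1; apply: commrD => //; apply: commrM; last by apply: commrD => //; apply: commr1.
    by apply: commrM => //; apply: commr_sym.
  have cfder e : GRing.comm f e -> GRing.comm f (der e).
    move=> ce; apply: commrB; first by apply: commrM.
    by apply: commrM.
  have itu n : iter n (inner_der u) X = iter n (fun e => g * der e) X
       /\ GRing.comm s (iter n (fun e => g * der e) X)
       /\ GRing.comm f (iter n (fun e => g * der e) X).
    elim: n => [|n [IH [IH1 IH2]]]; first by [].
    rewrite !iterS IH Tu //; do !split=> //.
      by apply: commrM => //; apply: der_cs.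
    apply: commrM; last exact: cfder.
    by apply: commrD; [apply: commr1 | apply: commrM => //; apply: commr_sym].
  have cs2u : GRing.comm (s ^+ 2) u.
    by apply: commrD => //; apply: commrM; [apply: commrM => // | ]; apply: cs2.
  have [N hN] : engel_at u.
    apply: (@engel_scale _ (s ^+ 2)) => //; first by rewrite starX ss.
    by rewrite su; apply: commrD => //; apply: cs2.
  have hX n : (N < n)%N -> iter n (inner_der u) X = 0.
    have h0 : inner_der u 0 = 0 by rewrite inner_derE /br mul0r mulr0 subrr.
    have hX1 : iter N.+1 (inner_der u) X = 0.
      rewrite -[RHS]h0 -hN -iterS !iterSr; congr (iter _ _ _).
      by rewrite su [in RHS]inner_derE (brDl u X u) (brxx u) add0r.
    by move=> /subnK <-; rewrite iterD hX1; elim: (n - N.+1)%N => //= m ->.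
  exists N => k Nk; have /hX := leq_ltn_trans Nk (ltn_expl k (isT : (1 < 2)%N)).
  rewrite (itu _).1 (iter_twisted_der derD derM hg) => hX0; rewrite -[RHS]hX0.
  have hder1 e : der (1 + e) = der e.
    rewrite derD [der 1](iffRL (br_comm 1 z)) ?add0r //.
    by apply: commr_sym; apply: commr1.
  have derg1 : der (g + 1) = g + 1 by rewrite (addrC g 1) (hder1 g) (addrC 1 g); exact: hg.
  have hDer1 e : Der (1 + e) = Der e by rewrite /Der /der_sq_add -/der !hder1.
  have DerD x y : Der (x + y) = Der x + Der y.
    by rewrite /Der /der_sq_add -/der (derD x y) derD (addrACA (der (der x))) .
  have DerX : Der X = g * Der c.
    have -> : X = g * (1 + c) + 1.
      rewrite /X mulrDl mul1r; apply: eq2.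
      have -> : c + (g * (1 + c) + (1 + c)) + (g * (1 + c) + 1)
        = (c + c) + (g * (1 + c) + g * (1 + c)) + (1 + 1) by ncr.
      by rewrite !add2 ?addr0.
    rewrite (addrC (g * _)) (hDer1 (g * (1 + c))).
    by rewrite [Der (g * _)](Der_gM derD derM hg) -/(Der _) hDer1.
  have itDer n : iter n.+1 Der X = g * iter n.+1 Der c.
    elim: n => [|n IHn]; first exact: DerX.
    by rewrite iterS IHn; exact: (Der_gM derD derM hg).
  rewrite mulrDr; congr (_ + _).
    rewrite /X -/der; congr (_ * _).
    have -> : der (c + (g + 1) * (1 + c)) = der c + ((g + 1) * der c + (g + 1) * (1 + c)).
      by rewrite (derD c _) (derM (g + 1) _) hder1 derg1.
    apply: eq2; have -> : g * der c + (g + 1) * (1 + c)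
       + (der c + ((g + 1) * der c + (g + 1) * (1 + c)))
       = (g * der c + g * der c) + (der c + der c) + ((g + 1) * (1 + c) + (g + 1) * (1 + c)) by ncr.
    by rewrite !add2 ?addr0.
  rewrite mulr_sumr; apply: eq_bigr => i _.
  rewrite -[(2 ^ i)%N](prednK (_ : (0 < 2 ^ i)%N)) ?expn_gt0 // -/Der itDer !mulrA.
  by congr (_ * _); rewrite -exprSr -exprS.
have [k0 hk0] := eng 0 (commr0 _) (commr_sym (commr0 _)) star0 (commr_sym (commr0 _)).
have Der0 i : (k0 <= i)%N -> iter (2 ^ i) Der c = 0.
  move=> ki; have h1 := hk0 i ki; have := hk0 i.+1 (leqW ki).
  rewrite mul0r addr0 !mul1r big_ord_recr /= expr1n mul1r addrA.
  by move: h1; rewrite mul0r addr0 !mul1r => ->; rewrite add0r.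
pose g j := 1 + s ^+ (2 * j) * s.
have css j : GRing.comm s (s ^+ j) by apply: commrX.
have cgs j : GRing.comm s (g j) by apply: commrD; [apply: commr1 | apply: commrM].
pose P : {poly D} := (der c + (1 + c))%:P * 'X + (1 + c)%:P
   + \sum_(i < k0) (iter (2 ^ i) Der c)%:P * 'X^(2 ^ i.+1).
have gP j e n : GRing.comm s e -> g j ^+ n * e = e * g j ^+ n.
  move=> ce; apply: commr_sym; apply: commrX; apply: commrD; first exact: commr1.
  by apply: commrM; [rewrite /GRing.comm; apply: commrX|]; apply: commr_sym.
have P0 : P = 0.
  apply: (@inf_rootsD D divD P g) => [i j|i j|j].
  - move=> /addrI; rewrite -!exprSr => /(infinite_order_inj divD s0 nfs)/eqP.
    by rewrite eqSS eqn_mul2l => /eqP.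
  - apply: commrD; first exact: commr1.
    by rewrite -exprSr; apply: commrX; apply: commr_sym; apply: cgs.
  - have cf2 e : GRing.comm (s ^+ 2) e -> GRing.comm (s ^+ (2 * j)) e.
      by move=> h; rewrite exprM; apply: commr_sym; apply: commrX; apply: commr_sym.
    have g0 : g j != 0.
      apply: contra_notN nfs => /eqP/eq2 h; exists (2 * j).+1 => //.
      by rewrite exprSr -h.
    have [k1 hk1] := eng _ (css (2 * j)%N) (cf2 _ cs2z) (etrans (starX _ _) (congr1 (fun x => x ^+ _) ss)) (cf2 _ (cs2 _ csc)).
    have := hk1 (k0 + k1)%N (leq_addl _ _) => /eqP.
    rewrite -/(g j) (mulD_eq0 divD) (negPf g0) /= => /eqP.
    rewrite big_split_ord /= [X in _ + (_ + X)]big1 ?addr0 => [h|i _]; last first.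
      by rewrite Der0 ?mulr0 // leq_addr.
    rewrite /P hornerD hornerD hornerMX !hornerC horner_sum -[RHS]h; congr (_ + _).
      have h1 : GRing.comm s (1 + c) by apply: commrD => //; apply: commr1.
      have := gP j _ 1%N (der_cs _ csc); have := gP j _ 1%N h1; rewrite !expr1.
      move: (g j) (der c) (1 + c) => G dc e he hd.
      by rewrite !mulrDl he hd mul1r addrA.
    apply: eq_bigr => i _; rewrite hornerCM hornerXn gP //; exact: Der_cs.
have : P.[0] = 0 by rewrite P0 horner0.
rewrite /P !hornerD hornerMX mulr0 add0r hornerC horner_sum big1 ?addr0.
  by move/eq2 => h; rewrite -h.
by move=> i _; rewrite hornerCM hornerXn expr0n expn_eq0 mulr0.
Qed.

(** Both [z] and [z + e] have trace 1. *)
Lemma char2_centralizer_sym s e : star s = s -> ~ ad_reduced s ->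
  GRing.comm s e -> star e = e.
Proof.
move=> ss /ad_reducedPn[s0 [z hz]] ce.
have h1 := char2_translate ss s0 hz.
have h2 : z + e + star (z + e) = 1.
  by apply: (char2_translate ss s0); rewrite brDr hz (iffRL (br_comm s e)) ?addr0.
move: h2; rewrite starD addrACA h1 => /(canRL (addKr _)); rewrite addNr => /eq2 //.
Qed.

(** Otherwise the centralizer of [s^2] consists of symmetric elements, so it is
    commutative; but it contains both [s] and [z] with [[s, z] = s]. *)
Lemma char2_sq_reduced s : star s = s -> ~ ad_reduced s -> ad_reduced (s ^+ 2).
Proof.
move=> ss ns; have [s0 [z hz]] := ad_reducedPn ns.
apply: contrapT => ns2; have ss2 : star (s ^+ 2) = s ^+ 2 by rewrite starX ss.
have sC e : GRing.comm (s ^+ 2) e -> star e = e by apply: char2_centralizer_sym.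
have cs2 : GRing.comm (s ^+ 2) s by apply: commr_sym; apply: commrX.
have cz : GRing.comm (s ^+ 2) z by apply/br_comm; rewrite br_exp // mulr2n add2.
have : GRing.comm s z.
  by rewrite /GRing.comm -{1}(sC _ cs2) -{1}(sC _ cz) -starM sC //; apply: commrM.
by move/br_comm; rewrite hz => /eqP; rewrite (negPf s0).
Qed.

Lemma char2_der_sq (der : D -> D) l t :
  (forall u v, der (u + v) = der u + der v) ->
  (forall u v, der (u * v) = u * der v + der u * v) -> GRing.comm l t ->
  der t = l * t -> der l = l * l + l * t ->
  der (der t) = l * t ^+ 2 /\ der (der l) = l * t ^+ 2.
Proof.
move=> dD dM clt dt dl.
have -> : der (der t) = l * t ^+ 2.
  rewrite dt dM dt dl; apply: eq2.
  have -> : l * (l * t) + (l * l + l * t) * t + l * t ^+ 2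
    = (l * l * t + l * l * t) + (l * (t * t) + l * (t * t)) by ncr.
  by rewrite !add2 ?addr0.
split=> //; rewrite dl dD !dM dt dl; apply: eq2.
have -> : l * (l * l + l * t) + (l * l + l * t) * l + (l * (l * t) + (l * l + l * t) * t)
   + l * t ^+ 2 = (l * l * l + l * l * l) + (l * (l * t) + l * (t * l))
   + (l * (l * t) + l * (l * t)) + (l * (t * t) + l * (t * t)) by ncr.
by rewrite -clt !add2 ?addr0.
Qed.

(** If [e = [T, y]] is not 0, then the derivation [[_, y]] acts on [T] and on
    [la = e T^-1] by a closed formula, and its iterates send [T] to the nonzero
    elements [T^(2i) la]. *)
Lemma char2_trace_comm y : ~ ad_reduced (y + star y) -> br (y + star y) y = 0.
Proof.
set T := y + star y => nT; apply/eqP; apply: contrapT => /negP e0.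
have sT : star T = T by rewrite starD starK addrC.
have [T0 [z hz]] := ad_reducedPn nT.
have sy : star y = y + T by rewrite /T addrA add2 add0r.
have brT2 x : br (T ^+ 2) x = br T (br T x).
  rewrite expr2 /br; apply: eq2.
  have -> : T * T * x - x * (T * T) + (T * (T * x - x * T) - (T * x - x * T) * T)
     = (T * T * x + T * T * x) - (T * x * T + T * x * T) by ncr.
  by rewrite !add2 subr0.
have sT2 : star (T ^+ 2) = T ^+ 2 by rewrite starX sT.
have gT2 : ad_reduced (T ^+ 2) by apply: char2_sq_reduced.
have nT2 : Nt (T ^+ 2) by apply: nt_expp => //; apply: nt_br hz.
have T2y : br (T ^+ 2) y = 0.
  have h := @sym_reduced_comm_trace (T ^+ 2) (y * T ^+ 2) sT2 gT2 nT2.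
  apply: gT2; move: h; rewrite starM sT2 sy.
  have -> : y * T ^+ 2 + T ^+ 2 * (y + T) = br (T ^+ 2) y + T ^+ 3.
    by rewrite /br mulrDr -exprSr (opp2 (y * _)) addrA; congr (_ + _); exact: addrC.
  rewrite brDr (iffRL (br_comm (T ^+ 2) (T ^+ 3))) ?addr0 //.
  by rewrite /GRing.comm -!exprD.
have hT2 := T2y; rewrite brT2 in hT2.
set e := br T y in e0 hT2; have ceT : GRing.comm T e by apply/br_comm.
have sC x : GRing.comm T x -> star x = x by apply: char2_centralizer_sym.
pose mu := e^-1 * T; pose la := e * T^-1.
have cTm : GRing.comm T mu by apply: commrM => //; apply: commrV.
have hTz : br T (y * mu) = T.
  by rewrite brMr (iffRL (br_comm T mu)) // mulr0 addr0 /mu (mulVKD divD).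
have h1 := char2_translate sT T0 hTz.
have hmu : br mu y = 1 + mu * T.
  move: h1; rewrite starM (sC _ cTm) sy mulrDr; move: mu {hTz cTm} => m h1.
  apply: eq2; rewrite /br opp2 -h1.
  have -> : m * y + y * m + (y * m + (m * y + m * T) + m * T)
    = (m * y + m * y) + (y * m + y * m) + (m * T + m * T) by ncr.
  by rewrite !add2 ?addr0.
have la0 : la != 0 by rewrite (mulD_neq0 divD) ?(invD_eq0 T).
have cla : GRing.comm la T.
  by apply: commr_sym; apply: commrM => //; apply: commrV.
have mula : mu * la = 1.
  by rewrite /mu /la mulrA -(mulrA e^-1) ceT (mulKD divD) // (mulDV divD).
have lamu : la * mu = 1.
  have mu0 : mu != 0 by apply: mul1_neq0 mula.
  by rewrite (invM1 divD mu0 mula) (mulVD divD).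
have hla : br la y = la * la + la * T.
  have := brMl la mu y; rewrite lamu (iffRL (br_comm 1 y)); last first.
    by apply: commr_sym; apply: commr1.
  move/esym/eq2; rewrite hmu; clear h1 hTz cTm hmu; move: la mu (br la y) lamu mula cla {la0} => l m d hlm hml clT h.
  rewrite -[LHS]mulr1 -hml mulrA -h mulrDr mulr1 mulrDl mulrA hlm mul1r.
  by rewrite clT.
have hTy : br T y = la * T by rewrite /la (mulDVK divD).
pose der := inner_der y.
have derD u v : der (u + v) = der u + der v by exact: brDl.
have derM u v : der (u * v) = u * der v + der u * v by exact: brMl.
have derT : der T = la * T by [].
have derla : der la = la * la + la * T by [].
have [der2T der2la] := char2_der_sq derD derM cla hTy hla.
have derT2 u : der (T ^+ 2 * u) = T ^+ 2 * der u.
  by rewrite derM [der (T ^+ 2)]T2y mul0r addr0.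
have itT i : iter (2 * i.+1) der T = T ^+ 2 ^+ i.+1 * la.
  elim: i => [|i IHi].
    by rewrite expr1 /= der2T; exact: (commrX 2 cla).
  rewrite mulnS iterD IHi.
  have derTX k u : der (T ^+ 2 ^+ k * u) = T ^+ 2 ^+ k * der u.
    by elim: k => [|k IHk]; [rewrite !mul1r | rewrite (exprS (T ^+ 2) k) -!(mulrA (T ^+ 2)) derT2 IHk].
  by rewrite [LHS]/= (derTX i.+1 la) derTX der2la (commrX 2 cla) mulrA -exprSr.
have [N hN] : engel_at y.
  apply: (@engel_scale _ (T ^+ 2)) => //; first exact/br_comm.
  rewrite sy; apply: commrD; first exact/br_comm.
  by apply: commr_sym; apply: commrX.
have it0 n : iter n der 0 = 0.
  by elim: n => //= n ->; rewrite /der inner_derE /br mul0r mulr0 subrr.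
have : iter N.+1 der T = 0.
  rewrite iterSr -(it0 1%N) /= -[in RHS]hN -[RHS]/(iter N.+1 der (star y)) iterSr sy derD.
  by rewrite [der y]brxx add0r.
move=> hz0; have : iter (N.+1 + N.+1) der T = 0 by rewrite iterD hz0 it0.
rewrite addnn -mul2n itT => /eqP; rewrite (mulD_eq0 divD) (negPf la0) orbF.
by apply/negP; rewrite !(expD_neq0 divD).
Qed.
End Char2.

Lemma trace_comm y : let T := y + star y in
  (ad_reduced T -> Nt T) -> br T y = 0.
Proof.
move=> T hT; have sT : star T = T by rewrite /T starD starK addrC.
have [gT|gT] := EM (ad_reduced T); first exact: reduced_trace_comm (gT) (hT gT).
have [n2|n2] := boolP (2%:R == 0 :> D); last by case: gT; apply: sym_ad_reduced.
by apply: char2_trace_comm => //; rewrite inE /= n2.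
Qed.

End Involution.

(** * Conjugates of a radical element of a field *)

Lemma irreducible_factor (K : fieldType) (q : {poly K}) : (1 < size q)%N ->
  exists2 r, irreducible_poly r & r %| q.
Proof.
have [n] := ubnP (size q); elim: n q => // n IHn q; rewrite ltnS => qn q1.
have [irr|nirr] := EM (irreducible_poly q); first by exists q.
have [r [r1 rq nr]] : exists r : {poly K}, [/\ size r != 1%N, r %| q & ~~ (r %= q)].
  apply: contrapT => h; case: nirr; split=> // r r1 rq.
  by apply: contrapT => /negP nr; case: h; exists r.
have q0 : q != 0 by rewrite -size_poly_gt0 (ltn_trans _ q1).
have r0 : r != 0 by apply: contraNneq q0 => r0; move: rq; rewrite r0 dvd0p.
have sr : (size r < size q)%N.
  by rewrite ltn_neqAle dvdp_leq // andbT; apply: contraNneq nr => /eqP; rewrite dvdp_size_eqp.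
have [||s irrs sr'] := IHn r; first exact: leq_trans sr qn.
  by rewrite ltn_neqAle eq_sym r1 size_poly_gt0.
by exists s => //; apply: dvdp_trans rq.
Qed.

Lemma root_in_extension (K : fieldType) (q : {poly K}) : (1 < size q)%N ->
  exists (K' : fieldType) (f : {rmorphism K -> K'}) y, root (map_poly f q) y.
Proof.
move=> /irreducible_factor[r /irredp_FAdjoin[K' _ [y ry _]] rq].
exists K', (GRing.in_alg K'), y.
by apply: root_dvdp ry; rewrite dvdp_map.
Qed.

Section FieldConjugate.
Variables (K : fieldType) (E : K -> Prop) (dE : div_closed E).
Variables (X : K) (N : nat).
Hypotheses (N0 : N%:R != 0 :> K) (nEX : ~ E X) (EXN : E (X ^+ N)).

(** As the exponent [N] is invertible, [X] is separable over the subfield [E]; as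
    [X] is not in [E], its minimal polynomial over [E] has another root in some
    extension. *)
Lemma radical_conjugate :
  exists (K' : fieldType) (f : {rmorphism K -> K'}) y, y != f X /\
    forall c n, E c -> E ((X + c) ^+ n) -> (y + f c) ^+ n = f (X + c) ^+ n.
Proof.
pose van P := [/\ pcoefs E P, P != 0 & P.[X] = 0].
have [g [vg gmin]] : exists g, van g /\ forall h, van h -> (size g <= size h)%N.
  have vN : van ('X^N - (X ^+ N)%:P).
    split; first by apply: (pcB dE); [exact: (pcXn dE) | exact: (pcC dE)].
      rewrite -size_poly_gt0 size_XnsubC // lt0n.
      by apply: contraNneq N0 => ->.
    by rewrite !hornerE ?hornerXn subrr.
  have [n] := ubnP (size ('X^N - (X ^+ N)%:P : {poly K})).
  elim: n (_ - _) vN => // n IHn h vh; rewrite ltnS => hn.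
  have [[h' [vh' lt]]|h0] := EM (exists h', van h' /\ (size h' < size h)%N).
    exact: IHn vh' (leq_trans lt hn).
  exists h; split=> // h' vh'; rewrite leqNgt; apply/negP => lt; apply: h0.
  by exists h'.
have [Eg g0 gX] := vg.
have div P : pcoefs E P -> P.[X] = 0 -> g %| P.
  have [n] := ubnP (size P); elim: n P => // n IHn P; rewrite ltnS => Pn EP PX.
  have [->|P0] := eqVneq P 0; first exact: dvdp0.
  have gP : (size g <= size P)%N by apply: gmin.
  pose q := (lead_coef P / lead_coef g)%:P * 'X^(size P - size g).
  have Eq : pcoefs E q.
    apply: (pcM dE); last exact: (pcXn dE).
    by apply: (pcC dE); apply: (dcM dE); [rewrite lead_coefE | apply: (dcV dE); rewrite lead_coefE].
  have sz : (size (P - q * g)%R < size P)%N.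
    have P1 : (0 < size P)%N by rewrite size_poly_gt0.
    have g1 : (0 < size g)%N by rewrite size_poly_gt0.
    rewrite -(ltn_predK P1) ltnS; apply/leq_sizeP => j; rewrite leq_eqVlt.
    have gE k : (q * g)`_k = (lead_coef P / lead_coef g) *
        (if (k < size P - size g)%N then 0 else g`_(k - (size P - size g))).
      by rewrite /q -mulrA coefCM [_ * g]mulrC coefMXn.
    rewrite coefB gE => /orP[/eqP<-|]; last rewrite (ltn_predK P1) => jP.
      rewrite ifN -?leqNgt; last by lia.
      have -> : ((size P).-1 - (size P - size g))%N = (size g).-1 by lia.
      by rewrite -!lead_coefE mulfVK ?lead_coef_eq0 // subrr.
    rewrite nth_default ?ifN -?leqNgt; last first.
    - exact: jP.
    - exact: leq_trans (leq_subr _ _) jP.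
    rewrite nth_default ?mulr0 ?subr0 //.
    by rewrite leq_subRL ?subnK // (leq_trans (leq_subr _ _) jP).
  have -> : P = (P - q * g) + q * g by rewrite subrK.
  apply: dvdp_add; last exact: dvdp_mull.
  apply: IHn; first exact: leq_trans sz Pn.
    by apply: (pcB dE) => //; apply: (pcM dE).
  by rewrite hornerD hornerN hornerM gX PX mulr0 subr0.
have /factor_theorem[q gq] : root g X by apply/eqP.
have q0 : q != 0 by apply: contraNneq g0 => q0; rewrite gq q0 mul0r.
have q1 : (1 < size q)%N.
  rewrite ltnNge; apply/negP => /size1_polyC qc; apply: nEX.
  have c0 : q`_0 != 0 by apply: contraNneq q0 => h; rewrite qc h.
  have gE i : g`_i = q`_0 * ('X - X%:P)`_i by rewrite gq {1}qc mul_polyC coefZ.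
  have -> : X = - (g`_0 / g`_1).
    rewrite !gE !coefB !coefX !coefC /= subr0 sub0r mulr1.
    by rewrite mulrN mulNr opprK mulrAC mulfV ?mul1r.
  by apply: (dcN dE); apply: (dcM dE) => //; apply: (dcV dE).
have qX : q.[X] != 0.
  have /dvdpP[h hE] : g %| 'X^N - (X ^+ N)%:P.
    apply: div; last by rewrite !hornerE ?hornerXn subrr.
    by apply: (pcB dE); [exact: (pcXn dE) | exact: (pcC dE)].
  have X0 : X != 0 by apply: contra_notN nEX => /eqP->; apply: (dc0 dE).
  have := congr1 (fun P => (deriv P).[X]) hE; rewrite gq derivB derivC subr0.
  rewrite derivXn !derivM derivXsubC !hornerE hornerMn hornerXn !subrr !mulr0 !add0r.
  rewrite /= mulr0 add0r => h1; apply: contra_eqN h1 => /eqP->.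
  by rewrite mulr0 -mulr_natl mulf_neq0 // expf_neq0.
have [K' [f [y ry]]] := root_in_extension q1.
exists K', f, y; split.
  by apply: contraNneq qX => yE; move: ry; rewrite yE mapf_root.
move=> c n Ec En; apply/eqP; rewrite -subr_eq0 -rmorphXn.
have : g %| ('X + c%:P) ^+ n - ((X + c) ^+ n)%:P.
  apply: div; last by rewrite !hornerE ?horner_exp ?hornerE subrr.
  apply: (pcB dE); last exact: (pcC dE).
  have EXc : pcoefs E ('X + c%:P) by apply: (pcD dE); [exact: (pcX dE) | exact: (pcC dE)].
  elim: n {En} => [|n IHn]; first by rewrite expr0; apply: (pcC dE); exact: (dc1 dE).
  by rewrite exprS; apply: (pcM dE).
rewrite gq -(dvdp_map f) => /(dvdp_trans _) h.
have := h (map_poly f q); rewrite rmorphM dvdp_mulr // => /(_ isT) /root_dvdp /(_ ry).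
have -> : map_poly f (('X + c%:P) ^+ n - ((X + c) ^+ n)%:P)
  = ('X + (f c)%:P) ^+ n - (f ((X + c) ^+ n))%:P.
  have -> : (f c)%:P = map_poly f c%:P by rewrite map_polyC.
  have -> : 'X = map_poly f 'X by rewrite map_polyX.
  by rewrite -rmorphD -rmorphXn -map_polyC -rmorphB.
by rewrite /root !hornerE ?horner_exp ?hornerE.
Qed.
End FieldConjugate.

(** Three translates of two distinct elements with quotients [r0], [r1], [rc]
    are tied by an identity in which only the translation length occurs. *)
Lemma translate_ratios (K : fieldType) (X y c : K) :
  X != 0 -> X + 1 != 0 -> X + c != 0 ->
  (y / X - (y + c) / (X + c)) * ((y + 1) / (X + 1) - 1)
  = c * (y / X - (y + 1) / (X + 1)) * ((y + c) / (X + c) - 1).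
Proof. by move=> h0 h1 hc; field; rewrite h0 h1 hc. Qed.

Lemma ratio_inj (K : fieldType) (X y c e : K) : y != X -> c != e ->
  X + c != 0 -> X + e != 0 -> (y + c) / (X + c) != (y + e) / (X + e).
Proof.
move=> yX ce hc he; apply: contra_neq ce => h.
have h1 : (y + c) * (X + e) = (y + e) * (X + c).
  by move/eqP: h; rewrite eqr_div // => /eqP.
have : (c - e) * (X - y) = 0.
  by rewrite -(subrr ((y + c) * (X + e))) {2}h1; ring.
move=> /eqP; rewrite mulf_eq0 !subr_eq0 => /orP[/eqP//|/eqP h2].
by rewrite h2 eqxx in yX.
Qed.

Section CharZero.
Variable K : fieldType.
Hypothesis ch0 : forall n, (0 < n)%N -> n%:R != 0 :> K.
Local Notation integral := (integralOver (intr : int -> K)).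

Lemma integral_sum (I : Type) (r : seq I) (P : pred I) (F : I -> K) :
  (forall i, P i -> integral (F i)) -> integral (\sum_(i <- r | P i) F i).
Proof.
move=> hF; apply: big_ind => //; first exact: integral0.
by move=> x y; apply: integral_add.
Qed.

Lemma integralX (x : K) n : integral x -> integral (x ^+ n).
Proof.
move=> hx; elim: n => [|n IHn]; first by rewrite expr0; apply: integral1.
by rewrite exprS; apply: integral_mul.
Qed.

Lemma root_unity_integral (u : K) n : (0 < n)%N -> u ^+ n = 1 -> integral u.
Proof.
move=> n0 un; exists ('X^n - 1%:P); first exact: monicXnsubC.
by rewrite rmorphB /= map_polyXn map_polyC /root !hornerE /= un subrr.
Qed.

(** A power of [u] has prime order [l], and [l] is the sum of the [1 - u^(k i)]. *)
Lemma root_unity_dvd_prime (u : K) n : (0 < n)%N -> u ^+ n = 1 -> u != 1 ->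
  exists2 l, prime l & exists2 A, integral A & (1 - u) * A = l%:R.
Proof.
elim: n {-2}n (leqnn n) => [[]//|N IHN] n nN n0 un u1.
have n1 : (1 < n)%N.
  by rewrite ltn_neqAle n0 andbT; apply: contraNneq u1 => n1; rewrite -[u]expr1 n1 un.
have pl := pdiv_prime n1; pose l := pdiv n; pose k := (n %/ l)%N.
have kl : (k * l = n)%N by rewrite divnK ?pdiv_dvd.
have [uk|uk] := eqVneq (u ^+ k) 1.
  have k0 : (0 < k)%N by rewrite lt0n; apply: contraTneq n0 => k0; rewrite -kl k0.
  apply: IHN uk u1 => //; rewrite -ltnS; apply: leq_trans nN.
  by rewrite ltn_Pdiv // prime_gt1.
exists l => //; have iu := root_unity_integral n0 un.
exists (\sum_(i < l) \sum_(j < k * i) u ^+ j).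
  by do 2!apply: integral_sum => ? _; apply: integralX.
have s0 : \sum_(i < l) (u ^+ k) ^+ i = 0.
  have := subrX1 (u ^+ k) l; rewrite -exprM kl un subrr => /esym/eqP.
  by rewrite mulf_eq0 subr_eq0 (negPf uk) => /eqP.
have -> : l%:R = \sum_(i < l) (1 - (u ^+ k) ^+ i).
  by rewrite sumrB s0 subr0 sumr_const card_ord.
rewrite mulr_sumr.
apply: eq_bigr => i _; rewrite -exprM.
by apply: oppr_inj; rewrite -mulNr !opprB subrX1.
Qed.

(** Clear the denominators in a monic equation of [m / 2]. *)
Lemma half_odd_not_integral (b : K) m : odd m -> 2%:R * b = m%:R -> ~ integral b.
Proof.
move=> om hb [P mP /eqP rP].
have [k sP] : exists k, size P = k.+1.
  by exists (size P).-1; rewrite prednK // size_poly_gt0 monic_neq0.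
pose S : int := \sum_(i < k.+1) P`_i * 2 ^+ (k - i) * m%:Z ^+ i.
have S0 : S = 0.
  have : S%:~R = 0 :> K.
    rewrite -(mulr0 (2%:R ^+ k)) -rP horner_coef.
    rewrite size_map_poly_id0; last by rewrite (monicP mP) oner_eq0.
    rewrite sP mulr_sumr rmorph_sum /=; apply: eq_bigr => i _.
    rewrite coef_map /= !rmorphM !rmorphXn /= -[(m%:Z)%:~R]/(m%:R) -hb exprMn_comm; last exact: mulrC.
    have ik : (i <= k)%N by rewrite -ltnS.
    have -> : 2%:R ^+ k = 2%:R ^+ (k - i) * 2%:R ^+ i :> K by rewrite -exprD subnK.
    by ring.
  case: S => n; rewrite ?NegzE ?mulrNz -?pmulrn.
    by case: n => // n /eqP; rewrite (negPf (ch0 _)).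
  by move=> /eqP; rewrite oppr_eq0 (negPf (ch0 _)).
have : (2 %| S)%Z by rewrite S0 dvdz0.
rewrite /S big_ord_recr /= rpredDl; last first.
  apply: rpred_sum => i _; rewrite -(subnSK (ltn_ord i)) exprS.
  by apply/dvdzP; exists (P`_i * 2 ^+ (k - i.+1) * m%:Z ^+ i); ring.
have -> : P`_k = 1 by rewrite -[k]/(k.+1.-1) -sP -lead_coefE (monicP mP).
by rewrite subnn expr0 !mul1r dvdzE abszX /= dvdn2 oddX om orbT.
Qed.

(** In the identity [translate_ratios] with [c = 8], the left hand side is up to a
    root of unity a product of two factors [1 - u], each of which divides a prime
    number; so 8 would divide a product of two primes in the ring of algebraic
    integers. *)
Lemma root_unity_translates (X y : K) : y != X -> X != 0 -> X + 1 != 0 -> X + 8%:R != 0 ->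
  (exists2 n, (0 < n)%N & y ^+ n = X ^+ n) ->
  (exists2 n, (0 < n)%N & (y + 1) ^+ n = (X + 1) ^+ n) ->
  (exists2 n, (0 < n)%N & (y + 8%:R) ^+ n = (X + 8%:R) ^+ n) -> False.
Proof.
move=> yX X0 X1 X8 h0 h1 h8.
have hr (z w : K) : w != 0 -> (exists2 n, (0 < n)%N & z ^+ n = w ^+ n) ->
    exists2 n, (0 < n)%N & (z / w) ^+ n = 1.
  by move=> w0 [n n0 hn]; exists n; rewrite // expr_div_n hn mulfV ?expf_neq0.
have [n0 n0p r0n] := hr _ _ X0 h0; have [n1 n1p r1n] := hr _ _ X1 h1.
have [n8 n8p r8n] := hr _ _ X8 h8.
have id := translate_ratios y X0 X1 X8.
have r08 : y / X != (y + 8%:R) / (X + 8%:R).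
  by have := @ratio_inj K X y 0 8%:R yX; rewrite !addr0; apply; rewrite // eq_sym ch0.
have r11 : (y + 1) / (X + 1) != 1.
  apply: contra_neq yX => h; apply: (addIr 1).
  by rewrite -[y + 1](mulfVK X1) h mul1r.
set r0 := y / X in r0n id r08; set r1 := _ / _ in r1n id r11.
set r8 := _ / _ in r8n id r08.
have r00 : r0 != 0 by apply: contra_eq_neq r0n => ->; rewrite expr0n gtn_eqF // eq_sym oner_neq0.
have ui : (r8 / r0) ^+ (n0 * n8) = 1.
  by rewrite exprMn exprVn (exprM r0) r0n expr1n invr1 mulr1 mulnC exprM r8n expr1n.
have u1 : r8 / r0 != 1.
  by apply: contra_neq r08 => h; rewrite -[r8](mulfVK r00) h mul1r.
have nn0 : (0 < n0 * n8)%N by rewrite muln_gt0 n0p.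
have [q pq [A iA hA]] := root_unity_dvd_prime nn0 ui u1.
have [q' pq' [B iB hB]] := root_unity_dvd_prime n1p r1n r11.
pose al := - ((r0 - r1) * (r8 - 1) * r0^-1 * (A * B)).
have ial : integral al.
  have i0 := root_unity_integral n0p r0n; have i1 := root_unity_integral n1p r1n.
  have i8 := root_unity_integral n8p r8n.
  apply: integral_opp; do 3?apply: integral_mul => //.
  - exact: integral_sub.
  - by apply: integral_sub => //; apply: integral1.
  - by apply: (root_unity_integral n0p); rewrite exprVn r0n invr1.
have hal : 8%:R * al = (q * q')%:R.
  rewrite natrM -hA -hB /al.
  have -> : 8%:R * - ((r0 - r1) * (r8 - 1) * r0^-1 * (A * B))
          = - (8%:R * (r0 - r1) * (r8 - 1)) * r0^-1 * (A * B) by ring.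
  by rewrite -id; field.
have imul k : integral (k%:R * al) by apply: integral_mul => //; apply: integral_nat.
have [oq|eq] := boolP (odd q); have [oq'|eq'] := boolP (odd q').
- apply: (@half_odd_not_integral (4%:R * al) (q * q')); rewrite ?oddM ?oq //.
  by rewrite -hal; ring.
- case/even_prime: pq' hal => [->|]; last by rewrite (negPf eq').
  rewrite natrM => hal; apply: (@half_odd_not_integral (2%:R * al) q) => //.
  by apply: (mulIf (ch0 (isT : (0 < 2)%N))); rewrite -hal; ring.
- case/even_prime: pq hal => [->|]; last by rewrite (negPf eq).
  rewrite natrM => hal; apply: (@half_odd_not_integral (2%:R * al) q') => //.
  by apply: (mulfI (ch0 (isT : (0 < 2)%N))); rewrite -hal; ring.
- case/even_prime: pq hal => [->|]; last by rewrite (negPf eq).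
  case/even_prime: pq' => [->|]; last by rewrite (negPf eq').
  move=> hal; apply: (@half_odd_not_integral al 1) => //.
  by apply: (mulfI (ch0 (isT : (0 < 4)%N))); rewrite mulr1 -[RHS]hal; ring.
Qed.
End CharZero.

Section FieldRadical.
Variables (K : fieldType) (E : K -> Prop) (dE : div_closed E) (X : K).

Lemma radical_char0 : (forall n, (0 < n)%N -> n%:R != 0 :> K) ->
  (forall m, exists2 n, (0 < n)%N & E ((X + m%:R) ^+ n)) -> E X.
Proof.
move=> ch0 hX; apply: contrapT => nEX.
have [N N0 hN] := hX 0%N; rewrite addr0 in hN.
have [K' [f [y [yX hy]]]] := radical_conjugate dE (ch0 N N0) nEX hN.
have nz m : f X + m%:R != 0.
  rewrite -(rmorph_nat f) -rmorphD fmorph_eq0 addr_eq0; apply: contra_notN nEX => /eqP->.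
  by apply: (dcN dE); apply: (dc_nat dE).
have hm m : exists2 n, (0 < n)%N & (y + m%:R) ^+ n = (f X + m%:R) ^+ n.
  have [n n0 En] := hX m; exists n => //.
  by rewrite -(rmorph_nat f m) hy ?rmorphD //; apply: (dc_nat dE).
have ch0' n : (0 < n)%N -> n%:R != 0 :> K' by move=> /ch0; rewrite -(rmorph_nat f) fmorph_eq0.
apply: (@root_unity_translates K' ch0' (f X) y yX) => //.
- by have := nz 0%N; rewrite addr0.
- exact: nz 1%N.
- by have := hm 0%N; rewrite !addr0.
- exact: hm 1%N.
Qed.

(** If [X] has a conjugate, then the quotients of their translates are roots of
    unity, and both [X] and the translation lengths are rational functions of
    these by [translate_ratios]. *)
Lemma radical_pchar p N (C : K -> Prop) : p \in [pchar K] -> C 0 -> C 1 ->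
  (forall c, C c -> E c) ->
  (0 < N)%N -> N%:R != 0 :> K -> E (X ^+ N) ->
  (forall c, C c -> exists2 n, (0 < n)%N & E ((X + c) ^+ n)) ->
  E X \/ (tor p X /\ forall c, C c -> tor p c).
Proof.
move=> cp C0 C1 CE N0 nN hN hX; have [EX|nEX] := EM (E X); [by left | right].
have [K' [f [y [yX hy]]]] := radical_conjugate dE nN nEX hN.
have cp' : p \in [pchar K'] by rewrite (fmorph_pchar f).
have divK' : GRing.field_axiom K' by move=> x; rewrite unitfE.
have torf c : tor p (f c) -> tor p c.
  by move=> [m m0]; rewrite -rmorphXn => /fmorph_inj h; exists m.
have nz c : C c -> f X + f c != 0.
  move=> Cc; rewrite -rmorphD fmorph_eq0 addr_eq0; apply: contra_notN nEX => /eqP->.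
  by apply: (dcN dE); apply: CE.
have tr c : C c -> tor p ((y + f c) / (f X + f c)).
  move=> Cc; have [n n0 En] := hX c Cc; apply: (exp_eq1_tor divK' cp' n0).
  by rewrite exprMn exprVn hy ?rmorphD ?mulfV ?expf_neq0 ?nz //; apply: CE.
have X0 : f X != 0 by have := nz _ C0; rewrite rmorph0 addr0.
have X1 : f X + 1 != 0 by have := nz _ C1; rewrite rmorph1.
have t0 : tor p (y / f X) by have := tr _ C0; rewrite rmorph0 !addr0.
have t1 : tor p ((y + 1) / (f X + 1)) by have := tr _ C1; rewrite rmorph1.
have tc c : C c -> tor p c.
  move=> Cc; apply: torf; have hc := nz _ Cc.
  have id := translate_ratios y X0 X1 hc.
  have [c0|c0] := eqVneq (f c) 0; first by rewrite c0; apply: (tor0 cp').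
  have r01 : y / f X != (y + 1) / (f X + 1).
    by have := @ratio_inj K' (f X) y 0 1 yX; rewrite !addr0; apply; rewrite // eq_sym oner_eq0.
  have rc1 : (y + f c) / (f X + f c) != 1.
    apply: contra_neq yX => h; apply: (addIr (f c)).
    by rewrite -[y + f c](mulfVK hc) h mul1r.
  have -> : f c = (y / f X - (y + f c) / (f X + f c)) * ((y + 1) / (f X + 1) - 1)
     * ((y / f X - (y + 1) / (f X + 1)) * ((y + f c) / (f X + f c) - 1))^-1.
    by rewrite id -(mulrA (f c)) mulfK // mulf_neq0 // subr_eq0.
  by do !first [exact: t0 | exact: t1 | exact: tr | exact: tor1 | apply: torM; [exact: mulrC | |]
     | apply: torV | apply: (torB cp'); [exact: mulrC | |]].
split=> //; apply: torf.
have hX1 : f X = (1 - (y + 1) / (f X + 1)) / ((y + 1) / (f X + 1) - y / f X).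
  have r01 : (y + 1) / (f X + 1) != y / f X.
    by have := @ratio_inj K' (f X) y 1 0 yX; rewrite !addr0; apply; rewrite // oner_eq0.
  apply: (mulIf (_ : (y + 1) / (f X + 1) - y / f X != 0)); first by rewrite subr_eq0.
  rewrite mulfVK ?subr_eq0 //; move: X0 X1 => X0 X1.
  by field; rewrite X0 X1.
rewrite hX1.
by do !first [exact: t0 | exact: t1 | exact: tr | exact: tor1 | apply: torM; [exact: mulrC | |]
     | apply: torV | apply: (torB cp'); [exact: mulrC | |]].
Qed.
End FieldRadical.

(** * The Engel and power conditions in a division ring *)

(** An element is torsion if its trace and norm are, because the Frobenius map
    permutes the roots of its quadratic equation. *)
Lemma quad_tor (D : unitRingType) (divD : GRing.field_axiom D) p :
  p \in [pchar D] -> forall v w : D, GRing.comm v w ->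
  tor p (v + w) -> tor p (v * w) -> tor p v.
Proof.
move=> cp v w cvw tt tn; have [m m0 [ht hn]] := tor_common tt tn.
set q := (p ^ m)%N in ht hn.
have cvq : GRing.comm v (v ^+ q) by apply: commrX.
have cwq : GRing.comm w (v ^+ q) by apply: commrX; apply: commr_sym.
have hq : v ^+ q + w ^+ q = v + w by rewrite -(exprD_pchar cp) ?ht.
have hq2 : v ^+ q * w ^+ q = v * w by rewrite -exprMn_comm ?hn.
have cwq2 : GRing.comm (v ^+ q) (w ^+ q).
  by apply: commr_sym; apply: commrX; apply: commr_sym; apply: commrX.
have : (v ^+ q - v) * (v ^+ q - w) = 0.
  have -> : (v ^+ q - v) * (v ^+ q - w) = v ^+ q * v ^+ q - (v + w) * v ^+ q + v * w.
    by rewrite mulrBr !mulrBl mulrDl -cwq; ncr.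
  by rewrite -hq -hq2 mulrDl -cwq2; ncr.
move/eqP; rewrite (mulD_eq0 divD) !subr_eq0 => /orP[/eqP h|/eqP h]; first by exists m.
exists (m + m)%N; first by rewrite addn_gt0 m0.
rewrite expnD exprM -/q h; apply: (addrI (v ^+ q)).
by rewrite hq h addrC.
Qed.

Section DivisionInvolution.
Variables (D : unitRingType) (divD : GRing.field_axiom D).
Variables (star : D -> D) (hstar : involution_first_kind star).
Variables (cs : seq D) (cs_uniq : uniq cs) (cs_size : (4 <= size cs)%N).
Hypothesis cs_central : forall f, f \in cs -> is_central f.

Let sD := starD hstar.
Let sM := starM hstar.
Let sK := starK hstar.

Lemma br_trace_comm y : br (y + star y) y = 0 -> star y * y = y * star y.
Proof.
by move/br_comm; rewrite /GRing.comm mulrDl mulrDr => /addrI.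
Qed.

Lemma engel_commuting : (forall x, engel_at star x) -> star_commuting star.
Proof.
move=> eng y; apply: br_trace_comm.
by apply: (@trace_comm D divD star hstar (fun=> True) _ _ _ _ _ _ cs).
Qed.

Lemma inner_der_pchar p e (x y : D) : p \in [pchar D] ->
  iter (p ^ e) (inner_der x) y = inner_der (x ^+ (p ^ e)) y.
Proof.
move=> cp.
rewrite (_ : inner_der x = fun y => y * x + - x * y); last first.
  by apply/funext => z; rewrite /inner_der mulNr.
rewrite (@iter_add_prime_exp D (fun z => z * x) (fun z => - x * z) p).
- rewrite /inner_der; congr (_ + _); first by elim: (p ^ e)%N => [|n IHn]; rewrite ?mulr1 //= IHn -mulrA exprSr.
  rewrite -mulNr -mulN1r -(pchar_odd_exp cp e) -exprMn_comm; last by apply: commr_sym; apply: commrN1.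
  by rewrite mulN1r; elim: (p ^ e)%N => [|n IHn]; rewrite ?mul1r //= IHn mulrA exprS.
- by move=> u v; rewrite mulrDl.
- by move=> u v; rewrite mulrDr.
- by move=> u; rewrite mulrA.
- exact: pcharf_prime cp.
- by move=> u; apply: mulrn_pchar.
Qed.

Lemma pcomm_engel p e x : p \in [pchar D] ->
  GRing.comm (x ^+ (p ^ e)) (star x) -> engel_at star x.
Proof.
move=> cp h; exists (p ^ e)%N; rewrite inner_der_pchar // inner_derE.
by apply/br_comm; apply: commr_sym.
Qed.

Lemma tor_cj p g (x : D) : g != 0 -> tor p (cj g x) -> tor p x.
Proof.
move=> g0 [m m0]; rewrite -(cjX divD) // => /(congr1 (cj g^-1)).
by rewrite !(cjK divD) // => h; exists m.
Qed.

(** If a power with exponent [p^e] of every element outside the torsion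
    commutes with its image, then the Engel condition holds outside the
    torsion. A noncentral torsion trace [T] of [y] commutes with a symmetric
    nontorsion [v]; then [v] commutes with [y], and [v T] is the trace of [y v]. *)
Lemma nontor_commuting p : p \in [pchar D] ->
  (forall x, ~ tor p x -> exists e, GRing.comm (x ^+ (p ^ e)) (star x)) ->
  star_commuting star.
Proof.
move=> cp hpc.
pose Nt (x : D) := ~ tor p x.
have nt0 x : Nt x -> x != 0 by move=> nx; apply: contra_notN nx => /eqP->; apply: tor0.
have engel_nt u : Nt u -> engel_at star u.
  by move=> /hpc[e]; apply: pcomm_engel.
have engel_scale u c : Nt c -> star c = c -> GRing.comm c u ->
    GRing.comm c (star u) -> engel_at star u.
  move=> nc sc cu csu; have [tu|] := EM (tor p u); last exact: engel_nt.
  have [->|u0] := eqVneq u 0; first by exists 0%N; rewrite (star0 hstar).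
  have [N hN] : engel_at star (u * c).
    apply: engel_nt => tuc; apply: nc.
    by apply: (@tor_mulK D divD p u) => //; apply: commr_sym.
  exists N; have itE n : iter n (inner_der (u * c)) (star (u * c))
      = c ^+ n.+1 * iter n (inner_der u) (star u)
      /\ GRing.comm c (iter n (inner_der u) (star u)).
    elim: n => [|n [IH1 IH2]]; first by rewrite sM sc expr1.
    have c2 : GRing.comm c (inner_der u (iter n (inner_der u) (star u))).
      by apply: commrB; apply: commrM.
    split=> //; rewrite !iterS IH1; move: (iter n _ _) IH2 => z cz.
    have cX m : c ^+ m * u = u * c ^+ m.
      by apply: commr_sym; apply: commrX; apply: commr_sym.
    rewrite /inner_der mulrBr; congr (_ - _).
      by rewrite -cu (mulrA _ c u) -(mulrA _ z c) -cz (mulrA _ c z) -exprSr -mulrA.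
    by rewrite [u * c * _]mulrA -(mulrA u c (c ^+ n.+1)) -(exprS c n.+1) -cX -mulrA.
  have := hN; rewrite (itE N).1 => /eqP; rewrite (mulD_eq0 divD) => /orP[|/eqP//].
  by rewrite (negPf (expD_neq0 divD _ (nt0 _ nc))).
have nt_cj g x : g != 0 -> Nt x -> Nt (cj g x).
  by move=> g0 nx; move/(tor_cj g0).
have nt_expp q x : q \in [pchar D] -> Nt x -> Nt (x ^+ q).
  move=> cq nx /(tor_expP divD cp) h; apply: nx; apply: h.
  by rewrite prime_gt0 // (pcharf_prime cq).
have nt_br x z : x != 0 -> br x z = x -> Nt x.
  move=> x0 hxz /(tor_exp_eq1 divD cp x0)[n [n0 _ hn]].
  by apply: (br_infinite_order divD cp x0 hxz); exists n.
have e0 : (forall q, q \notin [pchar D]) -> forall u, engel_at star u.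
  by move=> /(_ p); rewrite cp.
have tc := @trace_comm D divD star hstar Nt engel_scale engel_nt nt_cj nt_expp nt_br e0
  cs cs_uniq cs_size cs_central.
have key := @sym_reduced_comm_trace D divD star hstar Nt engel_nt nt_cj
  cs cs_uniq cs_size cs_central.
have sar := @sym_ad_reduced D divD star hstar Nt engel_scale nt_expp nt_br e0.
move=> y; apply: br_trace_comm; set T := y + star y.
have [ntT|tT] := EM (Nt T); first exact: tc.
have {}tT : tor p T by apply: contrapT.
have [zT|nzT] := EM (is_central T); first by apply/br_comm; apply: zT.
have sT : star T = T by rewrite /T sD sK addrC.
have T0 : T != 0 by apply: contra_notN nzT => /eqP-> z; apply: commr_sym; apply: commr0.
have [w cTw nw] := tor_centralizer_nontor divD cp tT nzT.
(* a symmetric nontorsion element that commutes with T *)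
have [v [cTv nv sv rv]] : exists v, [/\ GRing.comm T v, Nt v, star v = v & ad_reduced v].
  have [v [cTv nv sv]] : exists v, [/\ GRing.comm T v, Nt v & star v = v].
    have [e he] := hpc w nw; set w' := w ^+ (p ^ e).
    have nw' : Nt w'.
      by move/(tor_expP divD cp) => h; apply: nw; apply: h; rewrite expn_gt0 prime_gt0 ?(pcharf_prime cp).
    have cTw' : GRing.comm T w' by apply: commrX.
    have cTsw' : GRing.comm T (star w') by rewrite -sT; apply: (star_comm hstar).
    have cw' : GRing.comm w' (star w') by rewrite (starX hstar); apply: commrX.
    have [t1|n1] := EM (tor p (w' + star w')); last first.
      by exists (w' + star w'); split=> //; [apply: commrD | rewrite sD sK addrC].
    have [t2|n2] := EM (tor p (w' * star w')); last first.
      by exists (w' * star w'); split=> //; [apply: commrM | rewrite sM sK].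
    by case: nw'; apply: (quad_tor divD cp cw').
  have [rv|nrv] := EM (ad_reduced v); first by exists v.
  exists (v ^+ 2); split; [exact: commrX| |by rewrite (starX hstar) sv|].
    by move/(tor_expP divD cp) => h; apply: nv; apply: h.
  have [n2|n2] := boolP (2%:R == 0 :> D); last by case: nrv; apply: sar.
  have ch2 : 2%N \in [pchar D] by rewrite inE n2.
  exact: (@char2_sq_reduced D divD star hstar Nt engel_scale nt_expp nt_br).
have cvy : br v y = 0.
  have := key v (y * v) sv rv nv; rewrite sM sv.
  have -> : y * v + v * star y = v * T - br v y by rewrite /T /br; ncr.
  rewrite brBr brMr brxx mul0r add0r (iffRL (br_comm v T)); last exact: commr_sym.
  rewrite mulr0 add0r => /eqP; rewrite oppr_eq0 => /eqP; exact: rv.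
have hvT : y * v + star (y * v) = v * T.
  rewrite sM sv; have /br_comm := cvy => h; rewrite /GRing.comm in h.
  by rewrite -h -mulrDr.
have ntvT : Nt (v * T).
  move=> h; apply: nv; apply: (@tor_mulK D divD p T) => //.
  by rewrite cTv.
have := tc (y * v); rewrite hvT => /(_ (fun=> ntvT)).
have -> : br (v * T) (y * v) = v * v * br T y.
  rewrite brMl (brMr v) cvy brxx mul0r mulr0 addr0 mul0r addr0 brMr.
  rewrite (iffRL (br_comm T v) cTv) mulr0 addr0 -mulrA; congr (_ * _).
  have /br_comm cvy' := cvy.
  by apply/commr_sym/commrB; apply: commrM => //; apply: commr_sym.
move/eqP; rewrite !(mulD_eq0 divD) orbb => /orP[/eqP v0|/eqP//].
by move: (nt0 _ nv); rewrite v0 eqxx.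
Qed.

End DivisionInvolution.

Section PowerCommuting.
Variables (D : unitRingType) (divD : GRing.field_axiom D).
Variables (star : D -> D) (hstar : involution_first_kind star).
Variables (cs : seq D) (cs_uniq : uniq cs) (cs_size : (4 <= size cs)%N).
Hypothesis cs_central : forall f, f \in cs -> is_central f.
Hypothesis hpow : star_power_commuting star.

Lemma star_add_central x d : is_central d -> star (x + d) = star x + d.
Proof. by move=> cd; rewrite (starD hstar) (star_central hstar cd). Qed.

Lemma central_nat n : is_central (n%:R : D).
Proof. by move=> y; apply: commr_sym; apply: commr_nat. Qed.

Lemma power_comm_translate x d : is_central d ->
  exists2 n, (0 < n)%N & GRing.comm (star x) ((x + d) ^+ n).
Proof.
move=> cd; have [n n0] := hpow (x + d); rewrite star_add_central // => h.
exists n => //; have cdn : d * (x + d) ^+ n = (x + d) ^+ n * d by apply: cd.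
by move: h; rewrite mulrDl mulrDr cdn => /addIr.
Qed.

Section One.
Variable x : D.
Lemma eq_commuting : commuting (fun z => z = x).
Proof. by move=> ? ? -> ->. Qed.
Local Notation L := (bfield divD eq_commuting).
Definition bfield_gen : L := BField divD eq_commuting (@mem_bfield _ _ x erefl).
Definition star_centr (z : L) := GRing.comm (star x) (bval z).

Lemma star_centr_div_closed : div_closed star_centr.
Proof.
split=> [|u v hu hv|u v hu hv|u hu]; rewrite /star_centr.
- exact: commr1.
- by rewrite bvalB; apply: commrB.
- by rewrite bvalM; apply: commrM.
- by rewrite bvalV; apply: commrV.
Qed.
End One.

Lemma power_commuting_char0 : (forall p, p \notin [pchar D]) -> star_commuting star.
Proof.
move=> ch0 x; pose L : fieldType := bfield divD (@eq_commuting x).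
suff: star_centr (bfield_gen x) by [].
apply: (@radical_char0 L _ (star_centr_div_closed x)) => [n n0|m].
  apply/eqP => hn; have [//|p cp] := @natr0_pchar D divD n n0.
    by rewrite -[RHS]/(bval (0 : L)) -hn bval_nat.
  by move: (ch0 p); rewrite cp.
have [n n0 hn] := power_comm_translate x (central_nat m).
by exists n => //; rewrite /star_centr bvalX bvalD bval_nat.
Qed.

(** Write the exponent at [x] as [N' p^q] with [N'] prime to [p], and consider the
    radical [x^(p^q)]. *)
Lemma power_commuting_pchar p x : p \in [pchar D] ->
  (exists e, GRing.comm (x ^+ (p ^ e)) (star x)) \/
  (tor p x /\ forall d : D, is_central d -> tor p d).
Proof.
move=> cp; pose L : fieldType := bfield divD (@eq_commuting x).
have pp := pcharf_prime cp.
have cpL : p \in [pchar L].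
  rewrite inE pp /=; apply/eqP/bval_inj; rewrite bval_nat.
  by apply/eqP; case/andP: cp.
have [N N0 hN] := power_comm_translate x (central_nat 0); rewrite addr0 in hN.
have [N' copN NE] := pfactor_coprime pp N0; set q := logn p N in NE.
have q0 : (0 < p ^ q)%N by rewrite expn_gt0 prime_gt0.
pose C (c : L) := exists2 d, is_central d & bval c = d ^+ (p ^ q).
have CE c : C c -> star_centr c.
  by move=> [d cd]; rewrite /star_centr => ->; apply: commrX; apply: commr_sym; apply: cd.
have torL (z : L) : tor p z -> tor p (bval z).
  by move=> [m m0 hm]; exists m; rewrite // -bvalX hm.
have memd d : is_central d -> d \in bicent (fun z => z = x).
  by move=> cd; apply/bicentP => z _; apply: commr_sym; apply: cd.
case: (@radical_pchar L _ (star_centr_div_closed x) (bfield_gen x ^+ (p ^ q)) p N' C).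
- exact: cpL.
- by exists 0; [exact: (central_nat 0) | rewrite expr0n gtn_eqF].
- by exists 1; [exact: (central_nat 1) | rewrite expr1n].
- exact: CE.
- by move: N0; rewrite NE muln_gt0 => /andP[].
- by rewrite -(dvdn_pcharf cpL) -prime_coprime.
- by rewrite -exprM mulnC -NE /star_centr bvalX.
- move=> c [d cd hc]; have [n n0 hn] := power_comm_translate x cd.
  exists n => //; rewrite /star_centr bvalX bvalD bvalX hc -(exprD_pchar cp); last first.
    by apply: commr_sym; apply: cd.
  by rewrite exprAC; apply: commrX.
- by rewrite /star_centr bvalX => h; left; exists q; apply: commr_sym.
move=> [tx tC]; right; split.
  by apply: (tor_expP divD cp q0); move: (torL _ tx); rewrite bvalX.
move=> d cd; apply: (tor_expP divD cp q0).
pose d' : L := BField divD (@eq_commuting x) (memd d cd).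
have /torL : tor p (d' ^+ (p ^ q)) by apply: tC; exists d; rewrite // bvalX.
by rewrite bvalX.
Qed.

Lemma power_commuting : star_commuting star.
Proof.
have [[p cp]|ch0] := EM (exists p, p \in [pchar D]); last first.
  by apply: power_commuting_char0 => p; apply/negP => cp; apply: ch0; exists p.
have [tZ|ntZ] := EM (forall d : D, is_central d -> tor p d).
  apply: (nontor_commuting divD hstar cs_uniq cs_size cs_central cp) => x nx.
  by have [//|[/nx]] := power_commuting_pchar x cp.
apply: (engel_commuting divD hstar cs_uniq cs_size cs_central) => x.
by have [[e he]|[_ /ntZ//]] := power_commuting_pchar x cp; apply: pcomm_engel he.
Qed.
End PowerCommuting.

(** * Central traces and norms *)

Section CentralTraces.
Variables (R : pzRingType) (star : R -> R) (hstar : is_involution star).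
Implicit Types x y : R.

Let sD : {morph star : x y / x + y}. Proof. by case: hstar. Qed.
Let sM : {morph star : x y / x * y >-> y * x}. Proof. by case: hstar. Qed.
Let s1 : star 1 = 1.
Proof.
case: hstar => _ _ sK; have := sM (star 1) 1.
by rewrite mulr1 !sK mulr1.
Qed.

(** The trace of [x y], after the elimination of [x*] and [y*], commutes with
    [x]. *)
Lemma central_traces_quadratic x y : central_traces star ->
  br x (x * y + y * x - (x + star x) * y) = 0.
Proof.
move=> tr; set s := x + star x.
have cs := tr x; have ct := tr y; rewrite -/s in cs; set t := y + star y in ct.
have c1 : is_central (x * y + star (x * y)) := tr (x * y).
have sx : star x = s - x by rewrite /s addrC addKr.
have sy : star y = t - y by rewrite /t addrC addKr.
have -> : x * y + y * x - s * y = (x * y + star (x * y)) - t * (s - x).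
  by rewrite sM sx sy (cs y); move: t s {cs ct c1 sx sy} => t s; ncr.
apply/br_comm; apply: commrB; first exact: commr_sym (c1 _).
apply: commrM; first exact: commr_sym (ct _).
by apply: commrB => //; exact: commr_sym (cs _).
Qed.

Lemma central_norms_of_traces : central_traces star -> central_norms star.
Proof.
move=> tr x y; have h := central_traces_quadratic x y tr.
have cs := tr x; set s := x + star x in cs h.
have sx : star x = s - x by rewrite /s addrC addKr.
apply/br_comm; rewrite sx; move: h; rewrite /br.
have e : s * y * x = y * x * s by rewrite -mulrA (cs (y * x)).
move: s {cs sx} e => s e h.
have -> : x * (s - x) * y - y * (x * (s - x)) = (s * y * x - y * x * s)
   - (x * (x * y + y * x - s * y) - (x * y + y * x - s * y) * x) by ncr.
by rewrite h e subrr subr0.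
Qed.

Lemma central_traces_of_norms : central_norms star -> central_traces star.
Proof.
move=> nm x; have -> : x + star x = (1 + x) * star (1 + x) - x * star x - 1.
  by rewrite sD s1; ncr.
move=> y; apply: commr_sym; apply: commrB; last exact: commr1.
by apply: commrB; apply: commr_sym; apply: nm.
Qed.

Lemma commuting_of_traces : central_traces star -> star_commuting star.
Proof.
move=> tr x; have cs := tr x; set s := x + star x in cs.
have -> : star x = s - x by rewrite /s addrC addKr.
by rewrite mulrBl mulrBr (cs x).
Qed.

Lemma engel_of_commuting : star_commuting star -> star_engel star.
Proof. by move=> h x; exists 1%N; rewrite //= /inner_der h subrr. Qed.

Lemma power_of_commuting : star_commuting star -> star_power_commuting star.
Proof. by move=> h x; exists 1%N; rewrite // expr1 h. Qed.
End CentralTraces.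

Section DivisionCommuting.
Variables (D : unitRingType) (divD : GRing.field_axiom D).
Variables (star : D -> D) (hstar : involution_first_kind star).
Hypothesis hcomm : star_commuting star.

Lemma commuting_trace_br x y : br (star x) y = br x (star y).
Proof.
have := hcomm (x + y); rewrite (starD hstar); have := hcomm x; have := hcomm y.
rewrite /br; move: (star x) (star y) => X Y e1 e2 e3.
have -> : X * y - y * X = ((X + Y) * (x + y) - (x + y) * (X + Y))
  - (X * x - x * X) - (Y * y - y * Y) + (x * Y - Y * x) by ncr.
by rewrite e1 e2 e3 !subrr ?subr0 add0r.
Qed.

(** If [x] and [x*] always commute then, for [y] and [z], the product of
    [[x + x*, y]] and [[x*, z]] vanishes. *)
Lemma traces_of_commuting : central_traces star.
Proof.
move=> x; pose ep y := br (star x) y.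
have twist y : x * ep y = ep y * star x.
  have cx : br x (star x) = 0 by apply/br_comm; rewrite /GRing.comm hcomm.
  have cx' : br (star x) x = 0 by apply/br_comm; exact: hcomm.
  have := commuting_trace_br x (x * y).
  rewrite (starM hstar) !brMr cx cx' mul0r mulr0 add0r addr0 -commuting_trace_br.
  by move=> ->.
have prod y z : br (x + star x) y * ep z = 0.
  have := twist (y * z); have := twist y; have := twist z.
  have -> : ep (y * z) = ep y * z + y * ep z by exact: brMr.
  have -> : br (x + star x) y = br x y + ep y by exact: brDl.
  have -> : (br x y + ep y) * ep z = br x y * ep z + ep y * br (star x) z.
    by rewrite mulrDl.
  rewrite /br; move: (ep y) (ep z) (star x) => a b X h1 h2 h3.
  have -> : (x * y - y * x) * b + a * (X * z - z * X)
    = (x * (a * z + y * b) - (a * z + y * b) * X)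
      - (x * a - a * X) * z - y * (x * b - b * X) by ncr.
  by rewrite h1 h2 h3 !subrr mul0r mulr0 !subr0.
move=> y; apply/br_comm; have [//|/eqP b0] := eqVneq (br (x + star x) y) 0.
have cx : is_central (star x).
  by move=> z; apply/br_comm; move/eqP: (prod y z); rewrite (mulD_eq0 divD) => /orP[/eqP/b0|/eqP].
have xx : x = star x by have := star_central hstar cx; rewrite (starK hstar).
by case: b0; apply/br_comm; rewrite {1}xx; apply: commr_sym; apply: commrD; apply: commr_sym.
Qed.
End DivisionCommuting.

(** * Quaternion algebras *)

Section Quaternion.
Variables (F : fieldType) (D : unitAlgType F) (hD : division_ring_with_center D).
Variables (star : D -> D) (hstar : involution_first_kind star).
Hypotheses (tr : central_traces star) (ncD : ~ forall x : D, is_central x).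

Let divD : GRing.field_axiom D. Proof. by case: hD. Qed.

Lemma alg_central (a : F) : is_central (a%:A : D).
Proof. by move=> y; rewrite /GRing.comm mulr_algl mulr_algr. Qed.

Lemma central_alg (z : D) : is_central z -> exists a : F, z = a%:A.
Proof. by case: hD => _; apply. Qed.

Lemma nonsymmetric_elt : exists x, star x != x.
Proof.
apply: contrapT => h; apply: ncD => x y.
have s z : star z = z by apply/eqP; apply: contrapT => /negP n; apply: h; exists z.
by rewrite /GRing.comm -[x * y]s (starM hstar) !s.
Qed.

Let nm : central_norms star := central_norms_of_traces hstar.1 tr.

Section NonSymmetric.
Variables (x : D) (nx : star x != x).

Lemma nonsymmetric_noncentral : ~ is_central x.
Proof. by move/(star_central hstar) => h; move: (nx); rewrite h eqxx. Qed.

(** If [y] commutes with [x], then [y (x - x* )] is [t x - f] for the traces [t]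
    of [y] and [f] of [x y*], and [(x - x* )^2] is minus a norm. *)
Lemma quadratic_centralizer y : GRing.comm x y -> exists a b : F, y = a%:A + b *: x.
Proof.
move=> cxy; pose S := x + star x; pose T := y + star y.
pose N := x * star x; pose f := x * star y + star (x * star y).
have cS : is_central S := tr x; have cT : is_central T := tr y.
have cN : is_central N := nm x; have cf : is_central f := tr _.
have sx : star x = S - x by rewrite /S addrC addKr.
have sy : star y = T - y by rewrite /T addrC addKr.
have xx : x * x = S * x - N by rewrite /N sx mulrBr (cS x) opprB addrC subrK.
pose e := x - star x.
have eE : e = x + x - S by rewrite /e sx opprB addrA.
have e0 : e != 0 by rewrite subr_eq0 eq_sym.
have ye : y * e = T * x - f.
  have -> : f = x * (T - y) + y * (S - x) by rewrite /f (starM hstar) (starK hstar) sy sx.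
  by rewrite eE (cT x) !mulrBr mulrDr cxy; ncr.
have ce : is_central (e * e).
  have := nm e; rewrite {2}/e (starB hstar) (starK hstar) -opprB mulrN.
  by move=> h z; have := h z; rewrite /GRing.comm mulrN mulNr => /oppr_inj.
have dZ := central_div_closed D.
have ee0 : e * e != 0 by rewrite (mulD_neq0 divD).
have yE : y = (e * e)^-1 * (f * S - (T * N + T * N)) + (e * e)^-1 * (T * S - (f + f)) * x.
  apply: (mulDI divD ee0).
  have gen u A B : u != 0 -> u * (u^-1 * A + u^-1 * B * x) = A + B * x.
    by move=> u0; rewrite mulrDr -(mulrA u^-1) !(mulVKD divD).
  rewrite gen // (ce y) mulrA ye.
  have -> : (T * x - f) * e = T * (x * x) + T * (x * x) - T * (x * S)
     - f * x - f * x + f * S.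
    by rewrite eE; ncr.
  by rewrite xx -(cS x); ncr.
have [a ha] : exists a : F, (e * e)^-1 * (f * S - (T * N + T * N)) = a%:A.
  apply: central_alg.
  by repeat first [exact: ce | exact: cf | exact: cS | exact: cT | exact: cN |
    apply: (dcV dZ) | apply: (dcM dZ) | apply: (dcB dZ) | apply: (dcD dZ)].
have [b hb] : exists b : F, (e * e)^-1 * (T * S - (f + f)) = b%:A.
  apply: central_alg.
  by repeat first [exact: ce | exact: cf | exact: cS | exact: cT |
    apply: (dcV dZ) | apply: (dcM dZ) | apply: (dcB dZ) | apply: (dcD dZ)].
by exists a, b; rewrite yE ha hb mulr_algl.
Qed.

(** The conjugation by a bracket with [x] exchanges [x] and [x*]. *)
Lemma br_twist y : star x * br x y = br x y * x.
Proof.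
have := central_traces_quadratic hstar.1 x y tr.
have cs := tr x; set s := x + star x in cs *.
have -> : star x = s - x by rewrite /s addrC addKr.
rewrite /br => h; have e : s * y * x = y * x * s by rewrite -mulrA (cs (y * x)).
have e2 : x * s = s * x by rewrite (cs x).
move: s h e e2 {cs} => s h e e2; apply/eqP; rewrite -subr_eq0; apply/eqP.
have -> : (s - x) * (x * y - y * x) - (x * y - y * x) * x
  = - (x * (x * y + y * x - s * y) - (x * y + y * x - s * y) * x)
    + (s * x - x * s) * y by ncr.
by rewrite h e2 subrr mul0r oppr0 addr0.
Qed.

Lemma br_comb (c d : F) y :
  br x (c *: y + d *: (x * y)) = (c%:A + d *: x) * br x y.
Proof.
have brZ (k : F) u : br x (k *: u) = k *: br x u.
  by rewrite /br -scalerAr -scalerAl scalerBr.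
by rewrite brDr !brZ brMr brxx mul0r add0r mulrDl mulr_algl scalerAl.
Qed.

(** Let [j = [x, y0]]. The elements [[x, y] j^-1] commute with [x], since
    brackets with [x] exchange [x] and [x*]. *)
Lemma quaternion_span y0 : br x y0 != 0 -> forall y,
  exists a b c d : F, y = a%:A + b *: x + c *: y0 + d *: (x * y0).
Proof.
move=> j0 y; set j := br x y0 in j0.
have cu : GRing.comm x (br x y * j^-1).
  have hs := br_twist y; have hj : star x * j = j * x := br_twist y0.
  have hj2 : x * j^-1 = j^-1 * star x.
    by apply: (mulDI divD j0); rewrite (mulVKD divD) // mulrA -hj (mulDK divD).
  have cx : GRing.comm (star x) (br x y * j^-1).
    by rewrite /GRing.comm mulrA hs -!mulrA hj2.
  have cs := tr x; have xE : x = (x + star x) - star x by rewrite addrK.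
  apply: commr_sym; rewrite [X in GRing.comm _ X]xE.
  by apply: commrB; apply: commr_sym => //; apply: cs.
have [c [d hcd]] := quadratic_centralizer cu.
have hy : br x y = br x (c *: y0 + d *: (x * y0)).
  by rewrite br_comb -hcd (mulDVK divD).
have cz : GRing.comm x (y - (c *: y0 + d *: (x * y0))).
  by apply/br_comm; rewrite brBr hy subrr.
have [a [b hab]] := quadratic_centralizer cz.
by exists a, b, c, d; rewrite -addrA -hab subrK.
Qed.

Lemma quaternion_free y0 : br x y0 != 0 -> forall a b c d : F,
  a%:A + b *: x + c *: y0 + d *: (x * y0) = 0 -> [/\ a = 0, b = 0, c = 0 & d = 0].
Proof.
move=> j0 a b c d h.
have fr (u v : F) : u%:A + v *: x = 0 -> u = 0 /\ v = 0.
  move=> huv; have v0 : v = 0.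
    apply/eqP; apply: contrapT => /negP v0; apply: nonsymmetric_noncentral.
    have -> : x = (- (v^-1 * u))%:A.
      apply: (scalerI v0); rewrite scalerA mulrN mulrA mulfV // mul1r scaleNr.
      by apply/eqP; rewrite -addr_eq0 addrC huv.
    exact: alg_central.
  split=> //; move: huv; rewrite v0 scale0r addr0 => /eqP; rewrite scaler_eq0 oner_eq0 orbF.
  by move/eqP.
have [c0 d0] : c = 0 /\ d = 0.
  apply: fr; move: (congr1 (br x) h); rewrite -addrA brDr br_comb.
  rewrite (iffRL (br_comm x (a%:A + b *: x))); last first.
    apply: commrD; first exact: commr_sym (alg_central a _).
    by rewrite /GRing.comm -scalerAl -scalerAr.
  rewrite add0r [br x 0]/br mulr0 mul0r subrr => /eqP.
  by rewrite (mulD_eq0 divD) (negPf j0) orbF => /eqP.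
move: h; rewrite c0 d0 !scale0r !addr0 => /fr[a0 b0].
by split.
Qed.
End NonSymmetric.

Lemma quaternion_of_traces : quaternion_division_algebra D.
Proof.
split=> //; have [x nx] := nonsymmetric_elt.
have [y0 j0] : exists y0, br x y0 != 0.
  apply: contrapT => h; apply: (nonsymmetric_noncentral nx) => y.
  by apply/br_comm/eqP; apply: contrapT => /negP hy; apply: h; exists y.
pose phi (v : 'rV[F]_4) : D := (v 0 0)%:A + (v 0 1) *: x + (v 0 2%:R) *: y0 + (v 0 3%:R) *: (x * y0).
have phiL a u v : phi (a *: u + v) = a *: phi u + phi v.
  by rewrite /phi !mxE !scalerDl !scalerDr !scalerA; ncr.
have phi0 v : phi v = 0 -> v = 0.
  move=> /(quaternion_free nx j0)[h0 h1 h2 h3]; apply/rowP => i; rewrite mxE.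
  have : i \in [:: 0; 1; 2%:R; 3%:R] by case: i => [[|[|[|[|]]]]] //.
  by rewrite !inE => /or4P[]/eqP->.
have phi_inj : injective phi.
  move=> u v h; apply/eqP; rewrite -subr_eq0; apply/eqP; apply: phi0.
  by rewrite addrC -scaleN1r phiL scaleN1r h addNr.
have surj y : exists v, phi v = y.
  have [a [b [c [d ->]]]] := quaternion_span nx j0 y.
  exists (\row_i [:: a; b; c; d]`_i).
  by rewrite /phi !mxE.
pose psi y := sval (cid (surj y)).
have psiK y : phi (psi y) = y by rewrite /psi; case: cid.
constructor; exists psi; first by move=> a u v; apply: phi_inj; rewrite phiL !psiK.
exists phi => // v; apply: phi_inj; exact: psiK.
Qed.
End Quaternion.

(** * Commutators modulo a normal subgroup *)

Lemma sq0_inverses (R : pzRingType) (N : R) : N * N = 0 -> mutual_inverses (1 + N) (1 - N).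
Proof.
move=> h; split.
  have -> : (1 + N) * (1 - N) = 1 - N * N by ncr.
  by rewrite h subr0.
have -> : (1 - N) * (1 + N) = 1 - N * N by ncr.
by rewrite h subr0.
Qed.

Section CommMod.
Variables (R : pzRingType) (K H : R -> Prop).
Hypotheses (gK : is_unit_subgroup K) (gH : is_unit_subgroup H) (HK : is_normal_in H K).

Lemma inverses_uniq (x y z : R) : mutual_inverses x y -> mutual_inverses x z -> y = z.
Proof. by move=> [xy yx] [xz zx]; rewrite -[y]mulr1 -xz mulrA yx mul1r. Qed.

Lemma inverses_sym (x y : R) : mutual_inverses x y -> mutual_inverses y x.
Proof. by case. Qed.

Variables (v v' : R).
Hypothesis vv' : mutual_inverses v v'.

Definition comm_mod x := exists x', [/\ K x, mutual_inverses x x' & H (x * v * x' * v')].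

Lemma comm_modM x y : comm_mod x -> comm_mod y -> comm_mod (x * y).
Proof.
have [_ Hn] := HK; have [_ HM _] := gH; have [_ KM _] := gK.
move=> [x' [Kx xx' Hx]] [y' [Ky yy' Hy]]; exists (y' * x'); split; first exact: KM.
  case: xx' yy' => [xx x'x] [yy y'y].
  by split; rewrite mulrA; [rewrite -(mulrA x) yy mulr1 | rewrite -(mulrA y') x'x mulr1].
have -> : x * y * v * (y' * x') * v' = x * (y * v * y' * v') * x' * (x * v * x' * v').
  rewrite !mulrA -(mulrA _ x' x) xx'.2 mulr1 -(mulrA _ v' v) vv'.2 mulr1 //.
by apply: HM => //; apply: Hn.
Qed.

Lemma comm_mod_comm x : K x -> GRing.comm x v -> comm_mod x.
Proof.
move=> Kx cxv; have [_ _ KV] := gK; have [x' Kx' xx'] := KV x Kx.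
exists x'; split=> //; rewrite cxv -(mulrA v) xx'.1 mulr1 vv'.1; by case: gH.
Qed.

Lemma comm_mod_sub x : K v -> H x -> comm_mod x.
Proof.
have [HsK Hn] := HK; have [_ HM HV] := gH.
move=> Kv Hx; have [x' Hx' xx'] := HV x Hx; exists x'; split=> //; first exact: HsK.
by rewrite -!mulrA; apply: HM => //; rewrite mulrA; apply: Hn.
Qed.

(** Modulo [H], the element [w] equals its conjugate by [h]. *)
Lemma comm_mod_conj w h : K v -> K w -> H h ->
  (forall h', mutual_inverses h h' -> GRing.comm (h * w * h') v) -> comm_mod w.
Proof.
have [HsK Hn] := HK; have [_ HM HV] := gH; have [_ KM KV] := gK.
move=> Kv Kw Hh hc; have [h' Hh' hh'] := HV h Hh; have [w' Kw' ww'] := KV w Kw.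
have -> : w = (w * h * w' * h') * (h * w * h').
  by rewrite !mulrA -(mulrA _ h' h) hh'.2 mulr1 -(mulrA _ w' w) ww'.2 mulr1 -mulrA hh'.1 mulr1.
apply: comm_modM; first by apply: comm_mod_sub => //; apply: HM => //; apply: Hn.
by apply: comm_mod_comm; [apply: (KM); [apply: KM |]; try exact: HsK | apply: hc].
Qed.
End CommMod.

(** * Transvections *)

Lemma comm_add1 (R : pzRingType) (N M : R) : GRing.comm N M -> GRing.comm (1 + N) (1 + M).
Proof.
move=> c; apply: commrD; first exact: commr1.
by apply: commr_sym; apply: commrD; [exact: commr1 | exact: commr_sym].
Qed.

Section Matrices.
Variables (D : unitRingType) (divD : GRing.field_axiom D) (n : nat).
Local Notation A := 'M[D]_n.
Implicit Types (g h u v w x y z : A) (a b c d : D) (i j k l : 'I_n).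

Definition eu i j d : A := d *: delta_mx i j.
Definition tv i j d : A := 1 + eu i j d.

Lemma euE i j d k l : eu i j d k l = if (k == i) && (l == j) then d else 0.
Proof. by rewrite !mxE; case: ifP; rewrite ?mulr1 ?mulr0. Qed.

Lemma mulmx_entry x y (i j : 'I_n) : (x * y) i j = \sum_k x i k * y k j.
Proof. by rewrite -[x * y]/(x *m y) mxE. Qed.

Lemma eu_mulE i j d x k l : (eu i j d * x) k l = if k == i then d * x j l else 0.
Proof.
rewrite mulmx_entry (bigD1 j) //= big1 ?addr0 => [|m mj]; rewrite euE.
  by rewrite eqxx andbT; case: ifP; rewrite ?mul0r.
by rewrite (negPf mj) andbF mul0r.
Qed.
Lemma mul_euE i j d x k l : (x * eu i j d) k l = if l == j then x k i * d else 0.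
Proof.
rewrite mulmx_entry (bigD1 i) //= big1 ?addr0 => [|m mi]; rewrite euE.
  by rewrite eqxx /=; case: ifP; rewrite ?mulr0.
by rewrite (negPf mi) mulr0.
Qed.
Lemma eu_mul_eu i j d x k l c : eu i j d * x * eu k l c = eu i l (d * x j k * c).
Proof.
apply/matrixP => p q; rewrite mul_euE eu_mulE euE.
by case: (q == l); case: (p == i); rewrite //= mul0r.
Qed.
Lemma eu_mul i j k d c : eu i j d * eu j k c = eu i k (d * c).
Proof.
apply/matrixP => p q; rewrite eu_mulE !euE eqxx /=.
by case: (p == i); case: (q == k); rewrite //= mulr0.
Qed.
Lemma eu_mul0 i j k l d c : j != k -> eu i j d * eu k l c = 0.
Proof.
move=> jk; apply/matrixP => p q; rewrite eu_mulE !euE mxE (negPf jk) /= mulr0.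
by case: ifP.
Qed.
Lemma eu0 i j : eu i j 0 = 0. Proof. by rewrite /eu scale0r. Qed.
Lemma euD i j c d : eu i j (c + d) = eu i j c + eu i j d.
Proof. by rewrite /eu scalerDl. Qed.
Lemma euN i j d : eu i j (- d) = - eu i j d. Proof. by rewrite /eu scaleNr. Qed.
Lemma eu_inj i j : injective (eu i j).
Proof. by move=> c d /matrixP/(_ i j); rewrite !euE !eqxx. Qed.

Lemma eu_sum x : x = \sum_i \sum_j eu i j (x i j).
Proof. exact: matrix_sum_delta. Qed.

Lemma tvK i j d : i != j -> mutual_inverses (tv i j d) (tv i j (- d)).
Proof.
move=> ij; rewrite /tv euN.
by apply: sq0_inverses; apply: eu_mul0; rewrite eq_sym.
Qed.

Lemma tv_mul_eu k l a i j c :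
  tv k l a * eu i j c = eu i j c + (if l == i then eu k j (a * c) else 0).
Proof.
rewrite /tv mulrDl mul1r; have [->|li] := eqVneq l i; first by rewrite eu_mul.
by rewrite eu_mul0.
Qed.
Lemma eu_mul_tv k l a i j c :
  eu i j c * tv k l a = eu i j c + (if j == k then eu i l (c * a) else 0).
Proof.
rewrite /tv mulrDr mulr1; have [->|li] := eqVneq j k; first by rewrite eu_mul.
by rewrite eu_mul0.
Qed.

Lemma eu_comm_central x : (forall i j d, i != j -> GRing.comm x (eu i j d)) ->
  (1 < n)%N -> is_central x.
Proof.
move=> hx n1 y; rewrite [y]eu_sum; apply: commr_sum => i _; apply: commr_sum => j _.
have [<-|ij] := eqVneq i j; last exact: hx.
have [l il] : exists l, l != i.
  have [i0|i0] := eqVneq (val i) 0%N.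
    by exists (Ordinal n1); rewrite -val_eqE /= i0.
  by exists (Ordinal (ltnW n1)); rewrite -val_eqE /= eq_sym.
rewrite -[y i i]mulr1 -(eu_mul i l i); apply: commrM; apply: hx => //.
by rewrite eq_sym.
Qed.

Lemma scalar_central c : is_central c -> is_central (c%:M : A).
Proof.
move=> cc y; rewrite /GRing.comm -!mulmxE mul_scalar_mx.
apply/matrixP => i j; rewrite !mxE (bigD1 j) //= big1 ?addr0 => [|l lj].
  by rewrite !mxE eqxx mulr1n cc.
by rewrite !mxE (negPf lj) mulr0n mulr0.
Qed.

Lemma central_scalar z : is_central z -> forall i, z = (z i i)%:M /\ is_central (z i i).
Proof.
move=> cz i.
have h k l c p q := congr1 (fun M : A => M p q) (cz (eu k l c)).
have zD k l : k != l -> z k l = 0.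
  move=> kl; have := h l l 1 k l; rewrite mul_euE eu_mulE eqxx (negPf kl) mulr1.
  by [].
have zE k l c : z k k * c = c * z l l.
  by have := h k l c k l; rewrite mul_euE eu_mulE !eqxx.
split; last by move=> y; apply: zE.
apply/matrixP => k l; rewrite !mxE; have [<-|kl] := eqVneq k l; last exact: zD.
by rewrite mulr1n; have := zE k i 1; rewrite mulr1 mul1r.
Qed.

Lemma central_unit z : is_central z -> z = 0 \/ exists2 z', is_central z' & mutual_inverses z z'.
Proof.
move=> cz; have [z0|z0] := eqVneq z 0; [by left | right].
have [i] : exists i, z i i != 0.
  apply: contrapT => h; move/eqP: z0; apply; apply/matrixP => i j.
  have [-> _] := central_scalar cz i; rewrite !mxE.
  have -> : z i i = 0 by apply/eqP; apply: contrapT => /negP zi; apply: h; exists i.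
  by case: eqP.
move=> zi; have [zE czi] := central_scalar cz i.
exists ((z i i)^-1)%:M.
  by apply: scalar_central; apply: (dcV (central_div_closed D)).
have mulS c d : (c%:M : A) * d%:M = (c * d)%:M by rewrite scalar_mxM.
move: (z i i) zE zi => c -> c0.
by rewrite /mutual_inverses !mulS (mulDV divD) // (mulVD divD).
Qed.

(** * Subnormal subgroups of the general linear group *)

Section NormalStep.
Variables (n1 : (1 < n)%N) (aF : D).
Hypotheses (aF0 : aF != 0) (aF2 : aF ^+ 2 != 1) (aFc : is_central aF).
Variables (K H : A -> Prop).
Hypotheses (gK : is_unit_subgroup K) (gH : is_unit_subgroup H) (HK : is_normal_in H K).
Hypothesis tvKK : forall i j d, i != j -> K (tv i j d).

Let KM x y : K x -> K y -> K (x * y). Proof. by case: gK => _ h _; apply: h. Qed.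

Lemma column_transvection i (r : seq 'I_n) (a : 'I_n -> D) :
  K (1 + \sum_(k <- r | k != i) eu k i (a k)).
Proof.
elim: r => [|k r IHr]; first by rewrite big_nil addr0; case: gK.
rewrite big_cons; case: ifP => // ki.
have -> : 1 + (eu k i (a k) + \sum_(l <- r | l != i) eu l i (a l))
   = tv k i (a k) * (1 + \sum_(l <- r | l != i) eu l i (a l)).
  rewrite mulrDr mulr1 mulrDl mul1r mulr_sumr [X in _ + (_ + X)]big1 ?addr0 ?addrA //.
  by move=> l li; rewrite eu_mul0 // eq_sym.
by apply: KM => //; apply: tvKK.
Qed.

Lemma conj_column h g g' j k : (forall l, g' l j = (l == j)%:R) ->
  (g * h * g') k j = (g * h) k j.
Proof.
move=> hg; rewrite mulmx_entry (bigD1 j) //= big1 ?addr0 => [|l lj]; rewrite hg.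
  by rewrite eqxx mulr1.
by rewrite (negPf lj) mulr0.
Qed.

(** A member of [H] that moves the line of the basis vector [j] can be
    conjugated by matrices that fix this vector so as to move it to the line of
    the basis vector [i]. *)
Lemma move_line i j h k : i != j -> H h -> k != j -> h k j != 0 ->
  exists2 h', H h' & forall l, l != i -> h' l j = 0.
Proof.
move=> ij Hh kj hkj; wlog hij : h Hh hkj / h i j != 0.
  move=> wl; have [hij|hij] := eqVneq (h i j) 0; last exact: wl hij.
  have ki : k != i by apply: contraNneq hkj => ->; rewrite hij.
  have ik : i != k by rewrite eq_sym.
  have [_ Hn] := HK.
  have Hh' := Hn _ _ _ Hh (tvKK 1 ik) (tvK 1 ik).
  have col l : tv i k (- 1) l j = (l == j)%:R.
    by rewrite mxE euE [(1 : A) l j]mxE [j == k]eq_sym (negPf kj) andbF addr0.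
  have hE l : (tv i k 1 * h * tv i k (- 1)) l j = h l j + (if l == i then h k j else 0).
    by rewrite conj_column // mulrDl mul1r mxE eu_mulE mul1r.
  apply: (wl _ Hh'); rewrite hE ?eqxx ?(negPf ki) ?addr0 //.
  by rewrite hij add0r.
pose a l := - (h l j / h i j).
pose N := \sum_(l | l != i) eu l i (a l).
have N2 : N * N = 0.
  rewrite mulr_sumr big1 // => l li; rewrite mulr_suml big1 // => m mi.
  by rewrite eu_mul0 // eq_sym.
have KN : K (1 + N) by apply: column_transvection.
have [_ Hn] := HK; have Hh' := Hn _ _ _ Hh KN (sq0_inverses N2).
have NE l m : N l m = if (l != i) && (m == i) then a l else 0.
  rewrite summxE; have [li|li] := eqVneq l i.
    by rewrite big1 // => p pi; rewrite euE li eq_sym (negPf pi).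
  rewrite (bigD1 l) //= big1 ?addr0 ?euE ?eqxx // => p /andP[_ pl].
  by rewrite euE eq_sym (negPf pl).
exists ((1 + N) * h * (1 - N)) => // l li.
rewrite conj_column => [|m]; last first.
  by rewrite !mxE NE (eq_sym j) (negPf ij) andbF subr0.
rewrite mulrDl mul1r mxE mulmx_entry (bigD1 i) //= big1 ?addr0 => [|m mi]; rewrite NE.
  by rewrite li eqxx /a mulNr (mulDVK divD) ?subrr.
by rewrite (negPf mi) andbF mul0r.
Qed.

(** Conversely, a member of [H] all of whose conjugates fix the line of the
    basis vector [j] is a central scalar matrix. *)
Lemma exists_moved_line j : (exists2 h, H h & ~ is_central h) ->
  exists2 h, H h & exists2 k, k != j & h k j != 0.
Proof.
move=> [h Hh nch]; apply: contrapT => hfix.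
have fix_col g k : H g -> k != j -> g k j = 0.
  move=> Hg kj; apply/eqP; apply: contrapT => /negP gk.
  by apply: hfix; exists g => //; exists k.
have hj k : k != j -> h k j = 0 by apply: fix_col.
pose la := h j j.
(* the conjugates of h by the transvections 1 - a E_kj *)
have cond a k l : k != j -> l != j ->
    h l k * a = (if l == k then a * (la + h j k * a) else 0).
  move=> kj lj; have [_ Hn] := HK.
  have Hg := Hn _ _ _ Hh (tvKK (- a) kj) (tvK (- a) kj).
  have := fix_col _ l Hg lj; rewrite opprK.
  have -> : (tv k j (- a) * h * tv k j a) l j
    = (tv k j (- a) * h) l j + (tv k j (- a) * h) l k * a.
    by rewrite [tv k j a]/(1 + eu k j a) mulrDr mulr1 mxE mul_euE eqxx.
  have e m : (tv k j (- a) * h) l m = h l m + (if l == k then - a * h j m else 0).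
    by rewrite mulrDl mul1r mxE eu_mulE.
  rewrite !e (hj l lj) add0r; case: eqP => _; last first.
    by rewrite !add0r addr0.
  rewrite mulrDl => h0; apply/eqP; rewrite -subr_eq0 -[X in _ == X]h0; apply/eqP.
  by rewrite -/la; move: (h l k) (h j k) => u v; ncr.
have diag k l : k != j -> l != j -> l != k -> h l k = 0.
  by move=> kj lj lk; have := cond 1 k l kj lj; rewrite (negPf lk) mulr1.
have hkk k : k != j -> h k k = la + h j k.
  by move=> kj; have := cond 1 k k kj kj; rewrite eqxx !mulr1 mul1r.
have hjk k : k != j -> h j k = 0.
  move=> kj; have := cond aF k k kj kj; rewrite eqxx hkk // mulrDl mulrDr -(aFc la) => /addrI.
  rewrite -(aFc (h j k)) => h0.
  have : aF * (1 - aF) * h j k == 0 by rewrite mulrBr mulr1 mulrBl -mulrA -h0 subrr.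
  rewrite !(mulD_eq0 divD) (negPf aF0) /= subr_eq0 => /orP[/eqP a1|/eqP //].
  by move: aF2; rewrite -a1 expr1n eqxx.
have hlk k : k != j -> h k k = la by move=> kj; rewrite hkk // hjk // addr0.
have cla d : la * d = d * la.
  have [k kj] : exists k, k != j.
    have [j0|j0] := eqVneq (val j) 0%N.
      by exists (Ordinal n1); rewrite -val_eqE /= j0.
    by exists (Ordinal (ltnW n1)); rewrite -val_eqE /= eq_sym.
  by have := cond d k k kj kj; rewrite eqxx hlk // (hjk k kj) mul0r addr0.
apply: nch; have -> : h = la%:M; last exact: scalar_central.
apply/matrixP => p q; rewrite mxE; have [<-|pq] := eqVneq p q.
  by rewrite mulr1n; have [->//|pj] := eqVneq p j; apply: hlk.
rewrite mulr0n; have [qj|qj] := eqVneq q j; first by rewrite qj hj // -qj.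
by have [->|pj] := eqVneq p j; [apply: hjk | apply: diag].
Qed.

(** The generators [tv j i d] of one root subgroup are congruent modulo [H] to
    matrices that commute with the opposite root subgroup, so [H] contains all
    the commutators of the group generated by both; such a commutator, with a
    matrix whose restriction to the plane is triangular with diagonal entries
    [aF] and [aF^-1], is a transvection with an arbitrary coefficient. *)
Lemma normal_transvections : (exists2 h, H h & ~ is_central h) ->
  forall i j d, i != j -> H (tv i j d).
Proof.
move=> nc i j d0 ij; have ji : j != i by rewrite eq_sym.
have [h0 Hh0 [k kj hkj]] := exists_moved_line j nc.
have [h Hh hcol] := move_line ij Hh0 kj hkj.
have [h' Hh' hh'] : exists2 h', H h' & mutual_inverses h h' by case: gH => _ _; apply.
pose d := (aF ^+ 2 - 1)^-1 * d0.
have da : aF ^+ 2 * d - d = d0.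
  by rewrite -{2}[d]mul1r -mulrBl (mulVKD divD) // subr_eq0.
pose v := tv i j d; have Kv : K v by apply: tvKK.
have vv' : mutual_inverses v (tv i j (- d)) := tvK d ij.
set C := comm_mod K H v (tv i j (- d)).
have CM := @comm_modM _ K H gK gH HK _ _ vv'.
have Cij c : C (tv i j c).
  apply: (@comm_mod_comm _ K H gK gH _ _ vv'); first exact: tvKK.
  have z a b : eu i j a * eu i j b = 0 by apply: eu_mul0.
  by apply: comm_add1; rewrite /GRing.comm !z.
have Cji c : C (tv j i c).
  apply: (@comm_mod_conj _ K H gK gH HK _ _ vv' (tv j i c) h) => //; first exact: tvKK.
  move=> x' hx'; have -> : x' = h' by apply: inverses_uniq hx' hh'.
  have h'ii : h' i i = 0.
    have hij : h i j != 0.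
      apply/eqP => hij; have := congr1 (fun M : A => M j j) hh'.2.
      rewrite mulmx_entry big1 => [|l _]; last first.
        by have [->|li] := eqVneq l i; rewrite ?hij ?(hcol l li) mulr0.
      by rewrite mxE eqxx => /eqP; rewrite eq_sym oner_eq0.
    have := congr1 (fun M : A => M i j) hh'.2.
    rewrite mulmx_entry (bigD1 i) //= big1 => [|l li]; last by rewrite hcol // mulr0.
    rewrite mxE (negPf ij) addr0 => /eqP; rewrite (mulD_eq0 divD) (negPf hij) orbF.
    by move/eqP.
  have NE k1 l : (h * eu j i c * h') k1 l = h k1 j * c * h' i l.
    rewrite mulmx_entry (bigD1 i) //= big1 ?addr0 => [|m mi]; rewrite mul_euE ?eqxx //.
    by rewrite (negPf mi) mul0r.
  have -> : h * tv j i c * h' = 1 + h * eu j i c * h'.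
    by rewrite /tv mulrDr mulr1 mulrDl hh'.1.
  have z1 : h * eu j i c * h' * eu i j d = 0.
    apply/matrixP => p q; rewrite mul_euE NE h'ii mulr0 mul0r mxE.
    by case: ifP.
  have z2 : eu i j d * (h * eu j i c * h') = 0.
    apply/matrixP => p q; rewrite eu_mulE NE (hcol j ji) !mul0r mulr0 mxE.
    by case: ifP.
  by apply: comm_add1; rewrite /GRing.comm z1 z2.
pose X := tv j i (- aF^-1) * (tv i j (aF - 1) * tv j i 1).
have CX : C X by apply: (CM); [exact: Cji | apply: (CM); [exact: Cij | exact: Cji]].
have Xe c : X * eu i j c = eu i j (aF * c).
  rewrite /X -!mulrA tv_mul_eu eqxx mul1r mulrDr !tv_mul_eu eqxx (negPf ji) addr0.
  rewrite addrCA [eu i j c + _]addrC -euD.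
  have -> : (aF - 1) * c + c = aF * c by rewrite mulrBl mul1r subrK.
  rewrite mulrDr !tv_mul_eu eqxx (negPf ij) addr0.
  by rewrite mulNr (mulKD divD) // euN addrCA [eu j j c + _]addrC addNr addr0.
have eX c : eu i j c * X = eu i j (c * aF^-1).
  rewrite /X !mulrA eu_mul_tv eqxx mulrDl !eu_mul_tv eqxx (negPf ji) addr0.
  set q := c * - aF^-1.
  have cq : c + q * (aF - 1) = c * aF^-1.
    by rewrite /q mulrN mulNr mulrBr mulr1 (mulDVK divD) // opprB addrC subrK.
  rewrite addrCA -euD cq mulrDl !eu_mul_tv eqxx (negPf ij) addr0 mulr1.
  by rewrite addrCA -euD /q mulrN addNr eu0 addr0.
have Xv : X * v = tv i j (aF ^+ 2 * d) * X.
  rewrite /v /tv mulrDr mulrDl mul1r mulr1 Xe eX; congr (X + eu i j _).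
  have h2 a : aF * a = aF ^+ 2 * a * aF^-1.
    by rewrite expr2 -!mulrA (mulrA aF a) [in RHS](aFc a) (mulDK divD).
  exact: h2.
have [x' [_ XX' HX]] := CX.
have := HX; rewrite Xv -(mulrA _ X) XX'.1 mulr1 /tv.
have -> : (1 + eu i j (aF ^+ 2 * d)) * (1 + eu i j (- d)) = 1 + eu i j d0.
  rewrite mulrDl mul1r mulrDr mulr1 eu_mul0 // addr0 -addrA -euD addrC -da.
  by rewrite [- d + _]addrC [RHS]addrC.
by [].
Qed.
End NormalStep.
End Matrices.

Lemma unit_group_subgroup (R : pzRingType) : is_unit_subgroup (@unit_group R).
Proof.
split=> [|x y [x' [xx x'x]] [y' [yy y'y]]|x [x' [xx x'x]]].
- by exists 1; split; rewrite mulr1.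
- exists (y' * x'); split; rewrite mulrA.
    by rewrite -(mulrA x) yy mulr1.
  by rewrite -(mulrA y') x'x mulr1.
- by exists x'; [exists x |]; split.
Qed.

Lemma subnormal_subgroup (R : pzRingType) (H : R -> Prop) :
  subnormal_in_units H -> is_unit_subgroup H.
Proof. by case=> // *; exact: unit_group_subgroup. Qed.

Lemma noncentral_elt (R : pzRingType) (H : R -> Prop) : ~ central_subset H ->
  exists2 h, H h & ~ is_central h.
Proof.
move=> nc; apply: contrapT => h; apply: nc => x Hx.
by apply: contrapT => ncx; apply: h; exists x.
Qed.

(** [s N s^-1 = (z - 1) + z N] has square 0. *)
Lemma sq0_commute_up_to (R : pzRingType) (s s' z N : R) : s * s' = 1 -> s' * s = 1 ->
  is_central z -> N * N = 0 -> s * (1 + N) = z * ((1 + N) * s) ->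
  (z - 1) * (z - 1) * N = 0.
Proof.
move=> ss' s's cz NN hz.
have sN : s * N * s' = (z - 1) + z * N.
  have : s * (1 + N) * s' = z * (1 + N) by rewrite hz -!mulrA ss' mulr1.
  rewrite mulrDr mulr1 mulrDl ss' mulrDr mulr1 => h.
  by rewrite -[LHS](addKr 1) h addrA [- 1 + _]addrC.
have : (s * N * s') * (s * N * s') * N = 0.
  by rewrite !mulrA -(mulrA (s * N)) s's mulr1 -(mulrA s) NN mulr0 !mul0r.
rewrite sN => <-.
have -> : (z - 1 + z * N) * (z - 1 + z * N) * N = (z - 1) * (z - 1) * N
  + (z - 1) * z * (N * N) + z * (N * z - z * N) * N + z * z * (N * N)
  - z * (N * N) + z * N * z * (N * N) by ncr.
by rewrite NN (cz N) subrr !(mulr0, mul0r, addr0, subr0).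
Qed.

Section GeneralLinear.
Variables (D : unitRingType) (divD : GRing.field_axiom D) (n : nat) (n1 : (1 < n)%N).
Variable aF : D.
Hypotheses (aF0 : aF != 0) (aF2 : aF ^+ 2 != 1) (aFc : is_central aF).
Local Notation A := 'M[D]_n.

Lemma subnormal_transvections (H : A -> Prop) : subnormal_in_units H ->
  ~ central_subset H -> forall i j d, i != j -> H (tv i j d).
Proof.
elim=> [_ i j d ij|{}H K sK IHK gH HK nc]; first by exists (tv i j (- d)); apply: tvK.
have nK : ~ central_subset K by move=> cK; apply: nc => x /HK.1/cK.
apply: (normal_transvections divD n1 aF0 aF2 aFc (subnormal_subgroup sK) gH HK) => //.
  exact: IHK.
exact: noncentral_elt.
Qed.

(** By [sq0_commute_up_to] the central factors for transvections are 1, and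
    transvections generate the matrix ring. *)
Lemma subnormal_qcomm (G : A -> Prop) s : subnormal_in_units G ->
  ~ central_subset G -> unit_group s -> (forall x, G x -> qcomm s x) -> is_central s.
Proof.
move=> sG nG [s' [ss' s's]] hs; apply: eu_comm_central => // i j d ij.
have [z cz hz] := hs _ (subnormal_transvections sG nG d ij).
set N := eu i j d in hz *; have NN : N * N = 0 by apply: eu_mul0; rewrite eq_sym.
have sq : (z - 1) * (z - 1) * N = 0 by apply: (sq0_commute_up_to ss' s's cz NN).
have [zE cze] := central_scalar cz i.
have := congr1 (fun M : A => M i j) sq; rewrite mul_euE eqxx [RHS]mxE.
have -> : (z - 1) * (z - 1) = ((z i i - 1) * (z i i - 1))%:M.
  have -> : z - 1 = (z i i - 1)%:M by rewrite {1}zE [in RHS]raddfB.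
  by rewrite scalar_mxM.
rewrite mxE eqxx mulr1n => /eqP; rewrite !(mulD_eq0 divD) orbb => /orP[z1|/eqP d0]; last first.
  by rewrite /N d0 eu0; apply: commr0.
have z1' : z = 1 by rewrite zE; move: z1; rewrite subr_eq0 => /eqP->.
move: hz; rewrite z1' mul1r /tv mulrDr mulr1 mulrDl mul1r => /addrI; exact.
Qed.
End GeneralLinear.

(** * Central norms and traces on a subnormal subgroup *)

Section Ascent.
Variables (R : pzRingType) (star : R -> R) (hstar : involution_first_kind star).
Hypothesis subn_central : forall (G : R -> Prop) s, subnormal_in_units G ->
  ~ central_subset G -> unit_group s -> (forall x, G x -> qcomm s x) -> is_central s.
Hypothesis central_inv : forall z : R, is_central z ->
  z = 0 \/ exists2 z', is_central z' & mutual_inverses z z'.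

Let sM : {morph star : x y / x * y >-> y * x}. Proof. by case: hstar => -[]. Qed.
Let s1 : star 1 = 1.
Proof. by case: hstar => _; apply=> y; apply: commr_sym; apply: commr1. Qed.

Lemma star_inverses x x' : mutual_inverses x x' -> mutual_inverses (star x) (star x').
Proof. by move=> [h1 h2]; split; rewrite -sM ?h1 ?h2 s1. Qed.

Lemma inv_central (c c1 : R) : is_central c -> mutual_inverses c c1 -> is_central c1.
Proof.
move=> cc [h1 h2] y; rewrite /GRing.comm.
by rewrite -[y * c1]mul1r -h2 -!mulrA (mulrA c y) cc -!mulrA h1 mulr1.
Qed.

(** With [c] and [c'] the norms of [x] and [h x h^-1] and [s = h* h], the equality
    [x* = x^-1 c] turns the definition of [c'] into [s x s^-1 x^-1 = c' c^-1]. *)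
Lemma norm_qcomm h h' x x' : mutual_inverses h h' -> mutual_inverses x x' ->
  is_central (x * star x) -> is_central ((h * x * h') * star (h * x * h')) ->
  qcomm (star h * h) x.
Proof.
move=> hh xx; set X := star x; set c := x * X => cc.
rewrite !sM -/X; set H := star h; set H' := star h'; set c' := _ * _ => cc'.
have [hH' h'H] : mutual_inverses H H' := star_inverses hh.
have [XX X'X] : mutual_inverses X (star x') := star_inverses xx.
have cinv : mutual_inverses c (star x' * x').
  by split; rewrite /c !mulrA; [rewrite -(mulrA x) XX mulr1 xx.1
    | rewrite -(mulrA (star x')) xx.2 mulr1].
have key : H * h * x * (h' * H') * X = c'.
  have -> : c' = H * c' * H' by rewrite -(cc' H) -mulrA hH' mulr1.
  by rewrite /c' !mulrA -(mulrA _ H H') hH' mulr1.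
exists (c' * (star x' * x')).
  by move=> y; apply: commr_sym; apply: commrM; apply: commr_sym => //; exact: inv_central cinv y.
have hz : H * h * x * (h' * H') * x' = c' * (star x' * x').
  rewrite -key !mulrA -[X in _ = X * x']mulrA XX mulr1 //.
rewrite -hz !mulrA -(mulrA _ x' x) xx.2 mulr1 -(mulrA _ H' H) h'H mulr1.
by rewrite -(mulrA _ h' h) hh.2 mulr1.
Qed.

Lemma central_norm_swap h h' : mutual_inverses h h' ->
  is_central (star h * h) -> is_central (h * star h).
Proof.
move=> hh cs; have -> : h * star h = star h * h; last by [].
rewrite -[LHS]mulr1 -hh.1 mulrA -(mulrA h) -(cs h).
by rewrite -mulrA hh.1 mulr1.
Qed.

(** If [G] is normal in [K] and [k] is in [K], then [k* k] commutes with [G] up to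
    central factors by [norm_qcomm], so it is central. *)
Lemma ascend_norms (G : R -> Prop) : subnormal_in_units G -> ~ central_subset G ->
  central_norms_on G star -> central_norms_on (@unit_group R) star.
Proof.
elim=> // {}G K sK IHK gG GK nG nm.
have nK : ~ central_subset K by move=> cK; apply: nG => x /GK.1/cK.
have gK := subnormal_subgroup sK.
apply: IHK => // k Kk; have [_ _ /(_ k Kk)[k' Kk' kk]] := gK.
apply: (central_norm_swap kk); apply: (subn_central (Subnormal_step sK gG GK) nG).
  have [_ uM uV] := unit_group_subgroup R; apply: uM; last by exists k'.
  by exists (star k'); apply: star_inverses.
move=> x Gx; have [_ _ /(_ x Gx)[x' _ xx]] := gG.
by apply: (norm_qcomm kk xx); apply: nm => //; apply: GK.2.
Qed.

(** Let [s = h* h] with [h] normalizing [G]. Central traces on [G] give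
    [s x s^-1 = x + l x] with [l x] central. If some [l x] is not 0, then
    comparing with [l (x y)] shows that [G] lies in [Z + Z x] and is abelian. *)
Lemma trace_step (G K : R -> Prop) : subnormal_in_units G -> ~ central_subset G ->
  is_unit_subgroup K -> (forall x k k', G x -> K k -> mutual_inverses k k' -> G (k * x * k')) ->
  central_traces_on G star -> central_norms_on K star.
Proof.
move=> sG nG gK GK tr k Kk; have gG := subnormal_subgroup sG.
have [_ _ /(_ k Kk)[k' Kk' kk]] := gK; have [_ GM GV] := gG.
have [hH' h'H] := star_inverses kk; apply: (central_norm_swap kk).
set H := star k in hH' h'H *; set H' := star k' in hH' h'H.
have [s sE] : exists s, s = H * k by exists (H * k).
have [s' s'E] : exists s', s' = k' * H' by exists (k' * H').
have ss' : mutual_inverses s s'.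
  rewrite sE s'E; split; rewrite mulrA.
    by rewrite -(mulrA H) kk.1 mulr1 hH'.
  by rewrite -(mulrA k') h'H mulr1 kk.2.
have us : unit_group s by exists s'.
rewrite -sE.
have hl x : G x -> exists2 l, is_central l & s * x * s' = x + l.
  move=> Gx; have ct := tr x Gx; have ct' := tr _ (GK x k k' Gx Kk kk).
  set t' := _ + _ in ct'; exists (t' - (x + star x)).
    by move=> y; apply: commr_sym; apply: commrB; apply: commr_sym.
  have -> : s * x * s' = H * (k * x * k') * H' by rewrite sE s'E !mulrA.
  have -> : k * x * k' = t' - H' * star x * H by rewrite /t' !sM (mulrA (star k')) addrK.
  rewrite mulrBr mulrBl (_ : H * t' * H' = t'); last by rewrite -ct' -mulrA hH' mulr1.
  rewrite (_ : H * (H' * star x * H) * H' = star x); last first.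
    by rewrite !mulrA hH' mul1r -mulrA hH' mulr1.
  by rewrite opprD (addrCA x) (addrA x) subrr add0r.
have [[x [Gx nx]]|hcomm] := EM (exists x, G x /\ s * x * s' <> x); last first.
  apply: (subn_central sG nG us) => x Gx; exists 1; first by move=> w; apply: commr_sym; apply: commr1.
  rewrite mul1r; have -> : s * x = s * x * s' * s by rewrite -mulrA ss'.2 mulr1.
  by congr (_ * _); apply: contrapT => nx; apply: hcomm; exists x.
case: (nG); have [l cl hx] := hl x Gx.
have [l0|[l' cl' ll']] := central_inv cl; first by case: nx; rewrite hx l0 addr0.
have span y : G y -> exists a b, [/\ is_central a, is_central b & y = a + b * x].
  move=> Gy; have [m cm hy] := hl y Gy; have [q cq hxy] := hl _ (GM _ _ Gx Gy).
  have e : (x + l) * (y + m) = x * y + q.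
    by rewrite -hx -hy -hxy !mulrA -(mulrA (s * x)) ss'.2 mulr1.
  have e2 : l * y = q - l * m - m * x.
    apply: (addrI (x * y)); rewrite !addrA -e mulrDl !mulrDr (cm x).
    by rewrite !addrA addrK; move: (x * y) (x * m) => u w; rewrite addrAC addrK.
  exists (l' * (q - l * m)), (- (l' * m)); split.
  - by move=> z; apply: commr_sym; apply: commrM; [|apply: commrB; [|apply: commrM]];
      apply: commr_sym.
  - by move=> z; apply: commr_sym; apply: commrN; apply: commrM; apply: commr_sym.
  - by rewrite -[y]mul1r -ll'.2 -mulrA e2 mulrBr mulNr mulrA.
move=> y Gy; apply: (subn_central sG nG).
  by have [_ _ /(_ y Gy)[y' _ yy]] := gG; exists y'.
move=> z Gz; exists 1; first by move=> w; apply: commr_sym; apply: commr1.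
rewrite mul1r; have [a [b [ca cb ->]]] := span y Gy.
have [a' [b' [ca' cb' ->]]] := span z Gz.
have cx (c d : R) : is_central c -> is_central d -> GRing.comm x (c + d * x).
  by move=> cc cd; apply: commrD; [|apply: commrM => //]; apply: commr_sym.
apply: commr_sym; apply: commrD; first exact: commr_sym (ca _).
by apply: commrM; [exact: commr_sym (cb _) | apply: commr_sym; apply: cx].
Qed.

Lemma ascend_traces (G : R -> Prop) : subnormal_in_units G -> ~ central_subset G ->
  central_traces_on G star -> central_norms_on (@unit_group R) star.
Proof.
move=> sG; case: sG {-1}(sG) => [|{}G K sK gG GK] sG nG tr.
  apply: (trace_step sG nG (unit_group_subgroup R)) => // x k k' ux uk kk.
  have [_ uM uV] := unit_group_subgroup R.
  by apply: (uM); [apply: uM | exists k; apply: inverses_sym].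
have nK : ~ central_subset K by move=> cK; apply: nG => x /GK.1/cK.
apply: (ascend_norms sK nK); apply: (trace_step sG nG (subnormal_subgroup sK)) => //.
by move=> x k k'; apply: GK.2.
Qed.
End Ascent.

(** * Matrix rings of degree greater than one *)

Section Idempotents.
Variables (R : pzRingType) (star : R -> R) (hstar : is_involution star).
Hypothesis idem_comm : forall e : R, e * e = e -> star e * e = e * star e.

Let sD : {morph star : x y / x + y}. Proof. by case: hstar. Qed.
Let sM : {morph star : x y / x * y >-> y * x}. Proof. by case: hstar. Qed.
Let sK : involutive star. Proof. by case: hstar. Qed.

(** [E + N] is an idempotent. *)
Lemma idem_corner (E N : R) : E * E = E -> E * N = N -> N * E = 0 ->
  (star E + star N) * (E + N) = (E + N) * (star E + star N).
Proof.
move=> EE EN NE; have NN : N * N = 0 by rewrite -{2}EN mulrA NE mul0r.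
have := idem_comm (e := E + N); rewrite sD; apply.
by rewrite mulrDl !mulrDr EE EN NE NN add0r addr0.
Qed.

Lemma sym_idem_corner (E N : R) : E * E = E -> star E = E -> E * N = N ->
  N * E = 0 -> N = 0.
Proof.
move=> EE sE EN NE.
have := idem_corner EE EN NE; rewrite sE; set M := star N => h.
have ME : M * E = M by rewrite /M -{1}sE -sM EN.
have EM : E * M = 0.
  rewrite /M -{1}sE -sM NE; apply: (addIr (star 0)).
  by rewrite -sD !add0r.
have := congr1 (fun y => E * y * (1 - E)) h; rewrite /=.
have -> : E * ((E + M) * (E + N)) * (1 - E)
  = E * E * (E + N) * (1 - E) + E * M * (E + N) * (1 - E) by ncr.
have -> : E * ((E + N) * (E + M)) * (1 - E)
  = E * E * (E * (1 - E)) + E * (E * M) * (1 - E) + E * (N * E) * (1 - E)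
    + E * N * (M - M * E) by ncr.
rewrite EE EM NE ME subrr !mul0r !mulr0 !mul0r !addr0.
have EF : E * (1 - E) = 0 by rewrite mulrBr mulr1 EE subrr.
rewrite EF mulr0 (mulrDr E E N) EE EN mulrDl EF add0r mulrBr mulr1 NE subr0.
by [].
Qed.
End Idempotents.

Section Structure.
Variables (D : unitRingType) (divD : GRing.field_axiom D) (n : nat).
Local Notation A := 'M[D]_n.
Variables (star : A -> A) (hstar : is_involution star).
Hypothesis idem_comm : forall e : A, e * e = e -> star e * e = e * star e.
Implicit Types (i j k : 'I_n) (c d : D).

Let sD : {morph star : x y / x + y}. Proof. by case: hstar. Qed.
Let sM : {morph star : x y / x * y >-> y * x}. Proof. by case: hstar. Qed.
Let sK : involutive star. Proof. by case: hstar. Qed.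
Let s0 : star 0 = 0.
Proof. by apply: (addIr (star 0)); rewrite -sD !add0r. Qed.

Lemma matrix_prime (x y : A) : (forall a, x * a * y = 0) -> x = 0 \/ y = 0.
Proof.
move=> h; have [->|x0] := eqVneq x 0; [by left | right].
have [i [k xik]] : exists i k, x i k != 0.
  apply: contrapT => h0; move/eqP: x0; apply; apply/matrixP => i k; rewrite mxE.
  by apply/eqP; apply: contrapT => /negP xik; apply: h0; exists i, k.
apply/matrixP => l j; have := congr1 (fun M : A => M i j) (h (eu k l 1)).
rewrite mulmx_entry (bigD1 l) //= big1 ?addr0 => [|m ml]; rewrite mul_euE ?eqxx.
  by rewrite mulr1 !mxE => /eqP; rewrite (mulD_eq0 divD) (negPf xik) => /eqP.
by rewrite (negPf ml) mul0r.
Qed.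

Lemma sym_idem (E : A) : E * E = E -> star E = E -> E = 0 \/ E = 1.
Proof.
move=> EE sE; have [|->|/eqP] := @matrix_prime E (1 - E); [|by left|].
  move=> a; apply: (sym_idem_corner hstar idem_comm EE sE).
    by rewrite !mulrA EE.
  by rewrite -(mulrA (E * a)) mulrBl mul1r EE subrr mulr0.
by rewrite subr_eq0 => /eqP; right.
Qed.

Lemma one_entry i j : (1 : A) i j = (i == j)%:R. Proof. by rewrite mxE. Qed.

Lemma eu11 i : eu i i 1 * eu i i 1 = eu i i (1 : D).
Proof. by rewrite eu_mul mulr1. Qed.

(** The rank one idempotent [E_ii] is not symmetric, hence [E_ii E_ii* = 0] and
    [E_ii + E_ii*] is a symmetric idempotent. *)
Lemma star_diag i j : i != j -> star (eu i i 1) = 1 - eu i i 1.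
Proof.
move=> ij; set e := eu i i 1; set f := star e.
have ee : e * e = e by apply: eu11.
have ff : f * f = f by rewrite /f -sM ee.
have e0 : e <> 0 by move/matrixP/(_ i i); rewrite euE !eqxx mxE => /eqP; rewrite oner_eq0.
have fe : f * e = e * f := idem_comm ee.
have efE : e * f = eu i i (f i i).
  by rewrite -{1}ee -mulrA -fe mulrA eu_mul_eu mul1r mulr1.
have : f i i * f i i = f i i.
  apply: (@eu_inj D n i i); rewrite -(eu_mul i i i) -efE.
  by rewrite -mulrA (mulrA f) fe -mulrA ff mulrA ee.
move/eqP; rewrite -subr_eq0 -{3}[f i i]mulr1 -mulrBr (mulD_eq0 divD) subr_eq0.
case/orP=> /eqP fii; rewrite fii in efE; last first.
  have ef : e = f.
    have h : e * f = e by rewrite efE.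
    by have := congr1 star h; rewrite sM sK h.
  case: (sym_idem ee (esym ef)) => // e1.
  have := congr1 (fun M : A => M j j) e1; rewrite euE one_entry eqxx.
  by rewrite eq_sym (negPf ij) => /eqP; rewrite eq_sym oner_eq0.
rewrite eu0 in efE; rewrite efE in fe.
have [|| h | h] := @sym_idem (e + f).
- by rewrite mulrDl !mulrDr efE fe ee ff addr0 add0r.
- by rewrite sD sK addrC.
- case: e0; rewrite -ee; have -> : e * e = e * (e + f) by rewrite mulrDr efE addr0.
  by rewrite h mulr0.
- by rewrite -h [e + f]addrC addrK.
Qed.

(** Apply [star] to [E_ii E_jj = 0]. *)
Lemma two_indices i j k : i != j -> k = i \/ k = j.
Proof.
move=> ij; have [->|ki] := eqVneq k i; [by left | right].
apply/eqP; apply: contrapT => /negP kj.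
have ji : j != i by rewrite eq_sym.
have : star (eu i i 1 * eu j j 1) = 0 by rewrite eu_mul0 // s0.
rewrite sM (star_diag ij) (star_diag ji) mulrBl mul1r mulrBr mulr1 eu_mul0 // subr0.
move/matrixP/(_ k k); rewrite !mxE !eqxx (negPf ki) (negPf kj) /= !mulr0 !subr0.
by move/eqP; rewrite oner_eq0.
Qed.

Section Two.
Variables (i j : 'I_n) (ij : i != j).

Lemma eu_diag_sum : eu i i 1 + eu j j 1 = 1 :> A.
Proof.
have ji : j != i by rewrite eq_sym.
apply/matrixP => k l; rewrite mxE !euE one_entry.
case: (two_indices k ij) => ->; case: (two_indices l ij) => ->;
  by rewrite ?eqxx ?(negPf ij) ?(negPf ji) /= ?addr0 ?add0r.
Qed.

(** The idempotent [E_ii + d E_ij] commutes with its image. *)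
Lemma star_offdiag d : star (eu i j d) = - eu i j d.
Proof.
have ji : j != i by rewrite eq_sym.
set e := eu i i (1 : D); set f := eu j j (1 : D); set N := eu i j d.
have sum1 : e + f = 1 := eu_diag_sum.
have se : star e = f by rewrite (star_diag ij) -sum1 [e + f]addrC addrK.
have sf : star f = e by rewrite -se sK.
have ee : e * e = e by apply: eu11.
have eN : e * N = N by rewrite eu_mul mul1r.
have Nf : N * f = N by rewrite eu_mul mulr1.
have Ne : N * e = 0 by apply: eu_mul0.
have fN : f * N = 0 by apply: eu_mul0.
have fe : f * e = 0 by apply: eu_mul0.
have ef : e * f = 0 by apply: eu_mul0.
have := idem_corner hstar idem_comm ee eN Ne; rewrite se; set M := star N.
have eM : e * M = M by rewrite /M -sf -sM Nf.
have Me : M * e = 0 by rewrite /M -sf -sM fN s0.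
have MN : M * N = 0 by rewrite -eN mulrA Me mul0r.
have NM : N * M = 0 by rewrite -eM mulrA Ne mul0r.
rewrite !mulrDl !mulrDr fe fN Me MN ef eM Nf NM !addr0 !add0r => h.
by apply/eqP; rewrite -addr_eq0 -h.
Qed.
End Two.

Lemma star_eu_diag i j d : i != j -> star (eu i i d) = eu j j d.
Proof.
move=> ij; have ji : j != i by rewrite eq_sym.
have -> : eu i i d = eu i j d * eu j i 1 by rewrite eu_mul mulr1.
by rewrite sM !star_offdiag // mulrNN eu_mul mul1r.
Qed.

(** [star] reverses the product of [c E_ii] and [d E_ii] and sends them to
    [c E_jj] and [d E_jj]. *)
Lemma entries_comm i j c d : i != j -> c * d = d * c.
Proof.
move=> ij; apply: (@eu_inj D n j j).
by rewrite -(star_eu_diag _ ij) -(eu_mul i i i) sM !(star_eu_diag _ ij) eu_mul.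
Qed.

Lemma star_two i j x : i != j ->
  star x = eu i i (x j j) - eu i j (x i j) - eu j i (x j i) + eu j j (x i i).
Proof.
move=> ij; have ji : j != i by rewrite eq_sym.
have xE : x = eu i i (x i i) + eu i j (x i j) + eu j i (x j i) + eu j j (x j j).
  apply/matrixP => k l; rewrite mxE [X in X + _]mxE [X in X + _ + _]mxE !euE.
  case: (two_indices k ij) => ->; case: (two_indices l ij) => ->;
    by rewrite ?eqxx ?(negPf ij) ?(negPf ji) /= ?addr0 ?add0r.
rewrite {1}xE !sD (star_eu_diag _ ij) (star_eu_diag _ ji) !star_offdiag //.
by rewrite addrC -!addrA; congr (_ + _); rewrite addrC -addrA.
Qed.

Lemma traces_two i j : i != j -> central_traces star.
Proof.
move=> ij x; have ji : j != i by rewrite eq_sym.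
have -> : x + star x = (x i i + x j j)%:M.
  apply/matrixP => k l; rewrite (star_two x ij) !mxE.
  case: (two_indices k ij) => ->; case: (two_indices l ij) => ->;
    rewrite ?eqxx ?(negPf ij) ?(negPf ji) /= ?(mulr1, mulr0, subr0, addr0, mulr1n, mulr0n, oppr0, add0r) ?subrr //.
  by rewrite addrC.
by apply: scalar_central => y; apply: entries_comm ij.
Qed.

Lemma degree_two : (1 < n)%N -> n = 2%N.
Proof.
move=> n1; apply/eqP; rewrite eqn_leq n1 andbT leqNgt; apply/negP => n2.
have ij : Ordinal (ltnW n1) != Ordinal n1 by [].
by case: (two_indices (Ordinal n2) ij) => /(congr1 val).
Qed.
End Structure.

Lemma star_symplectic (D : unitRingType) (divD : GRing.field_axiom D)
    (star : 'M[D]_(1 + 1) -> 'M[D]_(1 + 1)) : is_involution star ->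
  (forall e : 'M[D]_(1 + 1), e * e = e -> star e * e = e * star e) ->
  forall x, star x = symplectic2 x.
Proof.
move=> hstar idem x; have ij : lshift 1 (0 : 'I_1) != rshift 1 (0 : 'I_1) by [].
rewrite (star_two divD hstar idem x ij) -[LHS]submxK /symplectic2.
congr block_mx; apply/matrixP => k l; rewrite !ord1 !mxE /=;
  by rewrite ?(mulr1, mulr0, subr0, addr0, oppr0, add0r).
Qed.

(** * Idempotents under the various conditions *)

Section IdempotentConditions.
Variables (R : pzRingType) (star : R -> R) (hstar : is_involution star).

Let sD : {morph star : x y / x + y}. Proof. by case: hstar. Qed.
Let sM : {morph star : x y / x * y >-> y * x}. Proof. by case: hstar. Qed.
Let s1 : star 1 = 1.
Proof. by case: hstar => _ _ sK; have := sM (star 1) 1; rewrite mulr1 !sK mulr1. Qed.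

(** Since [ad e] satisfies [T^3 = T], its nilpotent vectors are in its kernel. *)
Lemma inner_der_idem3 (e y : R) : e * e = e ->
  inner_der e (inner_der e (inner_der e y)) = inner_der e y.
Proof.
move=> ee; rewrite /inner_der.
have -> : ((y * e - e * y) * e - e * (y * e - e * y)) * e
    - e * ((y * e - e * y) * e - e * (y * e - e * y))
  = y * (e * e * e) - (e * y * (e * e) + e * y * (e * e) + e * y * (e * e))
    + (e * e * y * e + e * e * y * e + e * e * y * e) - e * e * e * y by ncr.
by rewrite !ee; ncr.
Qed.

Lemma idem_engel : star_engel star ->
  forall e : R, e * e = e -> star e * e = e * star e.
Proof.
move=> eng e ee; have [N _] := eng e; move: (star e) => y hN.
suff: inner_der e y = 0 by move/eqP; rewrite subr_eq0 => /eqP.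
have d0 : inner_der e 0 = 0 by rewrite /inner_der mul0r mulr0 subrr.
elim/ltn_ind: N hN => -[|[|[|N]]] IHN hN //.
- by move: hN => /= ->.
- by rewrite -(inner_der_idem3 y ee); move: hN => /= ->.
- by apply: (IHN N.+1) => //; move: hN; rewrite !iterSr inner_der_idem3.
Qed.

Lemma idem_power : star_power_commuting star ->
  forall e : R, e * e = e -> star e * e = e * star e.
Proof.
move=> hp e ee; have [N N0] := hp e.
have -> // : e ^+ N = e.
by case: N N0 => // N _; elim: N => [|N IHN]; rewrite ?expr1 // exprS IHN.
Qed.

Lemma central1 : is_central (1 : R).
Proof. by move=> y; apply: commr_sym; apply: commr1. Qed.
Lemma centralB (x y : R) : is_central x -> is_central y -> is_central (x - y).
Proof. by move=> cx cy z; apply: commr_sym; apply: commrB; apply: commr_sym. Qed.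
Lemma centralM (x y : R) : is_central x -> is_central y -> is_central (x * y).
Proof. by move=> cx cy z; apply: commr_sym; apply: commrM; apply: commr_sym. Qed.

Lemma central_cancel (z z' x : R) : is_central z' -> mutual_inverses z z' ->
  is_central (z * x) -> is_central x.
Proof.
move=> cz' [_ h] hx; have -> : x = z' * (z * x) by rewrite mulrA h mul1r.
exact: centralM.
Qed.

(** The norm of the unit [1 + z e] is [1 + z (e + e* ) + z^2 e e*]; two values of
    the central unit [z] show that [e e*] and [e + e*] are central. *)
Lemma idem_unit_norms (z1 z1' z2 z2' w1 w2 u : R) :
  (forall z, is_central z -> star z = z) ->
  central_norms_on (@unit_group R) star ->
  is_central z1 -> is_central z2 -> is_central z1' -> is_central z2' -> is_central u ->
  is_central w1 -> is_central w2 ->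
  mutual_inverses z1 z1' -> mutual_inverses z2 z2' -> mutual_inverses (z1 - z2) u ->
  z1 + w1 + z1 * w1 = 0 -> z2 + w2 + z2 * w2 = 0 ->
  forall e : R, e * e = e -> star e * e = e * star e.
Proof.
move=> sc nm c1 c2 c1' c2' cu cw1 cw2 i1 i2 iu h1 h2 e ee.
have hz z z' w : is_central z -> is_central z' -> is_central w -> mutual_inverses z z' ->
    z + w + z * w = 0 -> is_central (e + star e + z * (e * star e)).
  move=> cz cz' cw iz hw; apply: (central_cancel cz' iz).
  have prod a b : is_central b -> a + b + a * b = 0 -> (1 + a * e) * (1 + b * e) = 1.
    move=> cb hab.
    have -> : (1 + a * e) * (1 + b * e) = 1 + (a + b) * e + a * (e * b) * e by ncr.
    rewrite -(cb e) -!mulrA ee mulrA -addrA -mulrDl.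
    by rewrite hab mul0r addr0.
  have ux : unit_group (1 + z * e).
    exists (1 + w * e); split; apply: prod => //.
    by rewrite [w + z]addrC -(cz w).
  have := nm _ ux; rewrite sD s1 sM (sc z cz) => h.
  have -> : z * (e + star e + z * (e * star e)) = (1 + z * e) * (1 + star e * z) - 1.
    rewrite -(cz (star e)).
    have -> : (1 + z * e) * (1 + z * star e) - 1
      = z * (e + star e) + z * (e * z) * star e by ncr.
    by rewrite -(cz e) mulrDr !mulrA.
  by apply: centralB => //; apply: central1.
have k1 := hz _ _ _ c1 c1' cw1 i1 h1; have k2 := hz _ _ _ c2 c2' cw2 i2 h2.
have cq : is_central (e * star e).
  apply: (central_cancel cu iu).
  have -> : (z1 - z2) * (e * star e)
    = (e + star e + z1 * (e * star e)) - (e + star e + z2 * (e * star e)) by ncr.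
  exact: centralB.
have ct : is_central (e + star e).
  have -> : e + star e = (e + star e + z1 * (e * star e)) - z1 * (e * star e).
    by rewrite addrK.
  by apply: centralB => //; apply: centralM.
by have := ct e; rewrite /GRing.comm mulrDl mulrDr => /addrI.
Qed.
End IdempotentConditions.

(** * Degree one *)

(** Everything is transported along the isomorphism [A |-> A 0 0] to [D], whose
    structure of unit ring is needed for the results on division rings. *)
Section DegreeOne.
Variables (D : unitRingType) (divD : GRing.field_axiom D).
Local Notation A := 'M[D]_1.
Let ps (x : A) : D := x 0 0.

Lemma mx1K (x : A) : (x 0 0)%:M = x. Proof. by rewrite -mx11_scalar. Qed.
Lemma scalar1K (d : D) : (d%:M : A) 0 0 = d. Proof. by rewrite mxE eqxx. Qed.
Lemma mx1_inj : injective ps. Proof. exact: can_inj mx1K. Qed.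
Lemma mx1M (x y : A) : (x * y) 0 0 = x 0 0 * y 0 0.
Proof. by rewrite mulmx_entry big_ord1. Qed.
Lemma mx1D (x y : A) : (x + y) 0 0 = x 0 0 + y 0 0. Proof. by rewrite mxE. Qed.
Lemma mx1B (x y : A) : (x - y) 0 0 = x 0 0 - y 0 0. Proof. by rewrite !mxE. Qed.
Lemma mx11 : (1 : A) 0 0 = 1. Proof. exact: scalar1K. Qed.
Lemma mx1X (x : A) N : (x ^+ N) 0 0 = x 0 0 ^+ N.
Proof. by elim: N => [|N IHN]; rewrite ?mx11 // !exprS mx1M IHN. Qed.

Lemma scalar1M (c d : D) : (c * d)%:M = c%:M * d%:M :> A.
Proof. by rewrite scalar_mxM. Qed.
Lemma scalar1D (c d : D) : (c + d)%:M = c%:M + d%:M :> A.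
Proof. exact: raddfD. Qed.

Lemma mx1_central (x : A) : is_central x <-> is_central (x 0 0).
Proof.
split=> [cx d|cx y]; last by apply: mx1_inj; rewrite /ps !mx1M cx.
by have := congr1 ps (cx d%:M); rewrite /ps !mx1M scalar1K.
Qed.
Lemma scalar1_central (d : D) : is_central (d%:M : A) <-> is_central d.
Proof. by rewrite mx1_central scalar1K. Qed.

Lemma mx1_inverses (c d : D) : mutual_inverses (c%:M : A) d%:M <-> mutual_inverses c d.
Proof.
split=> -[h1 h2]; first by split; [have := congr1 ps h1 | have := congr1 ps h2];
  rewrite /ps mx1M !scalar1K.
by split; rewrite -scalar1M ?h1 ?h2.
Qed.
Lemma mx1_unit (d : D) : unit_group (d%:M : A) <-> unit_group d.
Proof.
split=> [[y]|[e he]]; last by exists e%:M; apply/mx1_inverses.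
by rewrite -[y]mx1K => /mx1_inverses; exists (y 0 0).
Qed.

Lemma mx1_subn r (G : A -> Prop) : subn r G -> subn r (fun d => G d%:M).
Proof.
elim: r G => [|r IHr] G /=; first by move=> hG d; rewrite hG mx1_unit.
move=> [K [sK [G1 GM GV] [GK Gn]]]; exists (fun d => K d%:M); split; first exact: IHr.
  split=> // [c d Gc Gd|d /GV[y Gy]]; first by rewrite scalar1M; apply: GM.
  rewrite -[y]mx1K => /mx1_inverses hd; exists (y 0 0) => //.
  by rewrite mx1K.
split=> [d|h k k' Gh Kk /mx1_inverses kk]; first exact: GK.
by rewrite !scalar1M; apply: Gn.
Qed.

Lemma degree_one_qcomm (G : A -> Prop) s : subnormal_in_units G ->
  ~ central_subset G -> unit_group s -> (forall x, G x -> qcomm s x) -> is_central s.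
Proof.
move=> /subnormal_subn[r sG] nG us hs; apply/mx1_central.
apply: (subn_qcomm divD (mx1_subn sG)) => [|d Gd].
  have [h Gh nh] := noncentral_elt nG; exists (h 0 0); first by rewrite mx1K.
  by move/mx1_central.
have [z /mx1_central cz hz] := hs _ Gd; exists (z 0 0) => //.
by have := congr1 ps hz; rewrite /ps !mx1M scalar1K.
Qed.

Section Star.
Variables (star : A -> A) (hstar : involution_first_kind star).
Definition star1x (d : D) : D := star d%:M 0 0.

Lemma star1x_scalar d : (star1x d)%:M = star d%:M. Proof. exact: mx1K. Qed.

Lemma star1x_involution : involution_first_kind star1x.
Proof.
case: hstar => -[sD sM sK] sc; split=> [|d cd]; last first.
  by rewrite /star1x sc ?scalar1K //; apply/scalar1_central.
split=> [c d|c d|d]; rewrite /star1x.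
- by rewrite scalar1D sD mx1D.
- by rewrite scalar1M sM mx1M.
- by rewrite star1x_scalar sK scalar1K.
Qed.

Lemma star1x_commuting : star_commuting star -> star_commuting star1x.
Proof. by move=> h d; have := congr1 ps (h d%:M); rewrite /ps !mx1M scalar1K. Qed.

Lemma star1x_engel : star_engel star -> forall d, engel_at star1x d.
Proof.
move=> h d; have [N _ hN] := h d%:M; exists N.
have itE (y : A) : iter N (inner_der d) (y 0 0) = iter N (inner_der (d%:M : A)) y 0 0.
  by elim: N {hN} => //= N ->; rewrite /inner_der mx1B !mx1M scalar1K.
by rewrite /star1x itE hN mxE.
Qed.

Lemma star1x_power : star_power_commuting star -> star_power_commuting star1x.
Proof.
move=> h d; have [N N0 hN] := h d%:M; exists N => //.
by have := congr1 ps hN; rewrite /ps !mx1M mx1X scalar1K.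
Qed.

Lemma star1x_traces : central_traces star <-> central_traces star1x.
Proof.
split=> h x.
  by have /mx1_central := h x%:M; rewrite mx1D scalar1K.
by apply/mx1_central; rewrite mx1D -{2}[x]mx1K; apply: h.
Qed.
End Star.
End DegreeOne.

(** * The equivalence *)

Section Scalars.
Variables (F : fieldType) (D : unitAlgType F).
Variables (s : seq F) (us : uniq s) (ss : (4 <= size s)%N).

Lemma scalar_avoiding (t : seq F) : (size t < size s)%N -> exists2 a, a \in s & a \notin t.
Proof.
move=> ts; apply: contrapT => h; move: ts; rewrite ltnNge uniq_leq_size // => a sa.
by apply: contrapT => /negP ta; apply: h; exists a.
Qed.

Lemma alg_inj : injective (fun a : F => a%:A : D).
Proof.
move=> a b /eqP; rewrite -subr_eq0 -scalerBl scaler_eq0 oner_eq0 orbF subr_eq0.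
by move/eqP.
Qed.

Lemma alg_neq0 (a : F) : a != 0 -> a%:A != 0 :> D.
Proof. by move=> a0; rewrite scaler_eq0 oner_eq0 orbF. Qed.

Lemma scalar_sq_neq1 : exists2 a : F, a%:A != 0 :> D & (a%:A : D) ^+ 2 != 1.
Proof.
have [|a _] := @scalar_avoiding [:: 0; 1; -1]; first exact: leq_trans ss.
rewrite !inE !negb_or => /and3P[a0 a1 an1]; exists a; first exact: alg_neq0.
have -> : (a%:A : D) ^+ 2 = (a ^+ 2)%:A by rewrite expr2 -scalerAl mul1r scalerA.
apply: contraNneq a1 => h; have : a ^+ 2 = 1 by apply: alg_inj; rewrite /= h scale1r.
by move=> /eqP; rewrite sqrf_eq1 (negPf an1) orbF.
Qed.
End Scalars.

Section DegreeAboveOne.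
Variables (F : fieldType) (D : unitAlgType F) (divD : GRing.field_axiom D).
Variables (s : seq F) (us : uniq s) (ss : (4 <= size s)%N).
Variables (n : nat) (n1 : (1 < n)%N).
Variables (star : 'M[D]_n -> 'M[D]_n) (hstar : involution_first_kind star).

Let mxs (a : F) : 'M[D]_n := (a%:A)%:M.

Lemma mxs_central a : is_central (mxs a).
Proof. by apply: scalar_central; apply: alg_central. Qed.
Lemma mxsM a b : mxs (a * b) = mxs a * mxs b.
Proof. by rewrite /mxs -[RHS]scalar_mxM -scalerAl mul1r scalerA. Qed.
Lemma mxsD a b : mxs (a + b) = mxs a + mxs b.
Proof. by rewrite /mxs scalerDl raddfD. Qed.
Lemma mxs0 : mxs 0 = 0. Proof. by rewrite /mxs scale0r raddf0. Qed.
Lemma mxs1 : mxs 1 = 1. Proof. by rewrite /mxs scale1r. Qed.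
Lemma mxs_inverses a : a != 0 -> mutual_inverses (mxs a) (mxs a^-1).
Proof. by move=> a0; split; rewrite -mxsM ?mulfV ?mulVf ?mxs1. Qed.

Lemma idem_of_unit_norms : central_norms_on (@unit_group _) star ->
  forall e : 'M[D]_n, e * e = e -> star e * e = e * star e.
Proof.
move=> nm.
have [|a _] := @scalar_avoiding F s us [:: 0; -1]; first exact: leq_trans ss.
rewrite !inE !negb_or => /andP[a0 an1].
have [|b _] := @scalar_avoiding F s us [:: 0; -1; a]; first exact: leq_trans ss.
rewrite !inE !negb_or => /and3P[b0 bn1 ba].
have hw c : c != -1 -> mxs c + mxs (- (c / (1 + c))) + mxs c * mxs (- (c / (1 + c))) = 0.
  move=> cn1; have c1 : 1 + c != 0 by rewrite addrC -[1]opprK subr_eq0.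
  rewrite -mxsM -!mxsD -mxs0; congr (mxs _).
  by field.
have ab : a - b != 0 by rewrite subr_eq0 eq_sym.
have iab : mutual_inverses (mxs a - mxs b) (mxs (a - b)^-1).
  have -> : mxs a - mxs b = mxs (a - b).
    by apply/eqP; rewrite subr_eq -mxsD subrK.
  exact: mxs_inverses.
have [hi sc] := hstar.
exact: (@idem_unit_norms _ star hi (mxs a) (mxs a^-1) (mxs b) (mxs b^-1)
  (mxs (- (a / (1 + a)))) (mxs (- (b / (1 + b)))) _ sc nm
  (mxs_central _) (mxs_central _) (mxs_central _) (mxs_central _) (mxs_central _)
  (mxs_central _) (mxs_central _) (mxs_inverses a0) (mxs_inverses b0) iab (hw a an1) (hw b bn1)).
Qed.

Lemma idem_of_condition (G : 'M[D]_n -> Prop) :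
  subnormal_in_units G -> ~ central_subset G ->
  star_commuting star \/ star_engel star \/ star_power_commuting star \/
  central_traces star \/ central_norms star \/
  central_traces_on G star \/ central_norms_on G star ->
  forall e : 'M[D]_n, e * e = e -> star e * e = e * star e.
Proof.
move=> sG nG; have [a a0 a2] := scalar_sq_neq1 D us ss.
have S := @subnormal_qcomm D divD n n1 _ a0 a2 (@alg_central F D a).
have cinv := @central_unit D divD n; have hi := hstar.1.
case=> [h e _|[h|[h|[h e _|[h e _|[h|h]]]]]].
- exact: h.
- exact: idem_engel.
- exact: idem_power.
- exact: (commuting_of_traces h).
- exact: (commuting_of_traces (central_traces_of_norms hi h)).
- by apply: idem_of_unit_norms; apply: (ascend_traces hstar S cinv sG nG).
- by apply: idem_of_unit_norms; apply: (ascend_norms hstar S sG nG).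
Qed.
End DegreeAboveOne.

Section Conditions.
Variables (F : fieldType) (D : unitAlgType F) (hD : division_ring_with_center D).
Variables (s : seq F) (us : uniq s) (ss : (4 <= size s)%N).

Lemma traces_of_condition1 (star : 'M[D]_1 -> 'M[D]_1) (G : 'M[D]_1 -> Prop) :
  involution_first_kind star -> subnormal_in_units G -> ~ central_subset G ->
  star_commuting star \/ star_engel star \/ star_power_commuting star \/
  central_traces star \/ central_norms star \/
  central_traces_on G star \/ central_norms_on G star ->
  central_traces star.
Proof.
move=> hstar sG nG; have [divD _] := hD; have hi := hstar.1.
have hs := star1x_involution hstar.
pose cs : seq D := [seq a%:A | a <- s].
have ucs : uniq cs by rewrite map_inj_uniq //; apply: alg_inj.
have scs : (4 <= size cs)%N by rewrite size_map.
have ccs f : f \in cs -> is_central f.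
  by move=> /mapP[a _ ->]; apply: alg_central.
have of_comm : star_commuting (star1x star) -> central_traces star.
  by move=> h; apply/star1x_traces; apply: (traces_of_commuting divD hs).
have of_unit_norms : central_norms_on (@unit_group _) star -> central_traces star.
  move=> nm; apply: (central_traces_of_norms hi) => x.
  have [->|x0] := eqVneq x 0.
    by rewrite mul0r => y; apply: commr_sym; apply: commr0.
  apply: nm; rewrite -[x]mx1K; apply/mx1_unit/(unit_groupD divD).
  by apply: contraNneq x0 => h; rewrite -[x]mx1K h raddf0.
have S := @degree_one_qcomm D divD; have cinv := @central_unit D divD 1.
case=> [h|[h|[h|[h|[h|[h|h]]]]]].
- by apply: of_comm; apply: star1x_commuting.
- by apply/of_comm/(engel_commuting divD hs ucs scs ccs); apply: star1x_engel.
- by apply/of_comm/(power_commuting divD hs ucs scs ccs); apply: star1x_power.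
- exact: h.
- exact: central_traces_of_norms.
- by apply/of_unit_norms/(ascend_traces hstar S cinv sG nG).
- by apply/of_unit_norms/(ascend_norms hstar S sG nG).
Qed.

Lemma traces_of_condition n (star : 'M[D]_n -> 'M[D]_n) (G : 'M[D]_n -> Prop) :
  (0 < n)%N -> involution_first_kind star -> subnormal_in_units G -> ~ central_subset G ->
  star_commuting star \/ star_engel star \/ star_power_commuting star \/
  central_traces star \/ central_norms star \/
  central_traces_on G star \/ central_norms_on G star ->
  central_traces star.
Proof.
move=> n0 hstar sG nG hc; have [divD _] := hD.
have [n1|n1] := leqP n 1.
  have nE : n = 1%N by apply/eqP; rewrite eqn_leq n1.
  by subst n; apply: traces_of_condition1 hc.
have idem := idem_of_condition divD us ss n1 hstar sG nG hc.
have ij : Ordinal (ltnW n1) != Ordinal n1 by [].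
exact: (traces_two divD hstar.1 idem ij).
Qed.

Lemma conclusion_of_traces n (star : 'M[D]_n -> 'M[D]_n) (G : 'M[D]_n -> Prop) :
  (0 < n)%N -> involution_first_kind star -> ~ central_subset G ->
  central_traces star ->
  (n = 1%N /\ quaternion_division_algebra D) \/
  (exists e : n = (1 + 1)%N,
    (forall x : D, exists a : F, x = a%:A) /\
    forall x : 'M[D]_n, castmx (e, e) (star x) = symplectic2 (castmx (e, e) x)).
Proof.
move=> n0 hstar nG tr; have [divD cD] := hD; have hi := hstar.1.
have [n1|n1] := leqP n 1.
  have nE : n = 1%N by apply/eqP; rewrite eqn_leq n1.
  subst n; left; split=> //.
  apply: (quaternion_of_traces hD (star1x_involution hstar)).
    exact/star1x_traces.
  by move=> h; apply: nG => x _; apply/mx1_central.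
have idem e : e * e = e -> star e * e = e * star e by move=> _; apply: commuting_of_traces.
right; have nE : n = (1 + 1)%N := degree_two divD hi idem n1.
subst n; exists erefl; split=> x.
  have ij : lshift 1 (0 : 'I_1) != rshift 1 (0 : 'I_1) by [].
  by apply: cD => y; apply: (entries_comm divD hi idem _ _ ij).
by rewrite !castmx_id (star_symplectic divD hi idem).
Qed.
End Conditions.

Theorem corollary4p10 (F : fieldType) (D : unitAlgType F)
    (hD : division_ring_with_center D)
    (hF : exists s : seq F, uniq s /\ (4 <= size s)%N)
    (n : nat) (hn : (0 < n)%N)
    (G : 'M[D]_n -> Prop)
    (hG : is_unit_subgroup G) (hGsub : subnormal_in_units G)
    (hGnc : ~ central_subset G)
    (star : 'M[D]_n -> 'M[D]_n) (hstar : involution_first_kind star) :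
  [<-> star_commuting star;
       star_engel star;
       star_power_commuting star;
       central_traces star;
       central_norms star;
       central_traces_on G star;
       central_norms_on G star] /\
  (star_commuting star \/ star_engel star \/ star_power_commuting star \/
   central_traces star \/ central_norms star \/
   central_traces_on G star \/ central_norms_on G star ->
   (n = 1%N /\ quaternion_division_algebra D) \/
   (exists e : n = (1 + 1)%N,
      (forall x : D, exists a : F, x = a%:A) /\
      forall x : 'M[D]_n,
        castmx (e, e) (star x) = symplectic2 (castmx (e, e) x))).
Proof.
have [s [us ss]] := hF.
have tr := traces_of_condition hD us ss hn hstar hGsub hGnc.
have hi := hstar.1.
split; last by move=> /tr; apply: (conclusion_of_traces hD hn hstar hGnc).
have comm : central_traces star -> star_commuting star by apply: commuting_of_traces.
have norms : central_traces star -> central_norms star by apply: central_norms_of_traces.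
tfae.
- exact: engel_of_commuting.
- by move=> h; apply/power_of_commuting/comm/tr; right; left.
- by move=> h; apply/tr; do 2!right; left.
- exact: norms.
- by move=> h x _; apply: (central_traces_of_norms hi h).
- by move=> h x _; apply: norms; apply: tr; do 5!right; left.
- by move=> h; apply: comm; apply: tr; do 6!right.
Qed.
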